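(* Let $n,q,m$ be integers with $n\ge 3$, $1\le q<n/2$, $m\geq 1$, and let $(M,g)$ be the graph of a smooth asymptotically flat map $f:\mathbb{R}^n\to\mathbb{R}^m$ of order $\tau>(n-2q)/(q+1)$, with the metric $g$ induced from $\mathbb{R}^{n+m}$. If the $q$-th Gauss--Bonnet curvature $L_{(q)}$ of $(M,g)$ is integrable on $M$, then the $q$-th Gauss--Bonnet--Chern mass $\mathrm{m}_q$ of $(M,g)$ satisfies $$\mathrm{m}_q=\frac12 c_q(n)\int_M\left(L_{(q)}+(2q-1)!\,\left\langle [T_{(2q-1)\alpha},A_\beta]\cdot e_\alpha^\top,\,e_\beta^\top\right\rangle\right)\frac{1}{\sqrt G}\,dM,$$ where $c_q(n)=\frac{(n-2q)!}{2^{q-1}(n-1)!\,\omega_{n-1}}$, $G=\det(g_{ij})$, $[T_{(2q-1)\alpha},A_\beta]=T_{(2q-1)\alpha}\circ A_\beta-A_\beta\circ T_{(2q-1)\alpha}$, and repeated indices $\alpha,\beta$ are summed from $1$ to $m$. Moreover, if $M$ has flat normal bundle and $L_{(q)}\ge 0$, then $\mathrm{m}_q\ge 0$.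
   Context: Conventions. Latin indices run over $1,\dots,n$, Greek indices over $1,\dots,m$; repeated indices (also when both are down or both up) are summed. $\omega_{n-1}$ is the volume of the unit sphere $\mathbb{S}^{n-1}$. $\langle\ ,\ \rangle$ is the Euclidean inner product of $\mathbb{R}^{n+m}=\mathbb{R}^n\times\mathbb{R}^m$. $\delta^{a_1\cdots a_k}_{b_1\cdots b_k}=\det(\delta^{a_i}_{b_j})$ is the generalized Kronecker delta. Empty products equal $1$. Graphs. Let $f=(f^1,\dots,f^m)$, with partial derivatives $f^\alpha_i,f^\alpha_{ij},f^\alpha_{ijk}$ and Euclidean gradients $Df^\alpha$. $f$ is asymptotically flat of order $\tau$ if $|f^\alpha_i(x)|+|f^\alpha_{ij}(x)||x|+|f^\alpha_{ijk}(x)||x|^2=O(|x|^{-\tau/2})$ as $|x|\to\infty$ for all $\alpha,i,j,k$. $M=\{(x,f(x))\}\subset\mathbb{R}^{n+m}$ is the graph, parametrized by $x\in\mathbb{R}^n$, with induced metric $g_{ij}=\delta_{ij}+f^\alpha_if^\alpha_j$, inverse $g^{ij}$, and volume form $dM=\sqrt G\,dx$. Indices are raised and lowered with $g$. Let $e_i,e_\alpha$ be the standard bases of $\mathbb{R}^n$ and $\mathbb{R}^m$ (each $e_\alpha$ also viewed as the vector $(0,e_\alpha)$ of $\mathbb{R}^{n+m}$). Coordinate fields: $\partial_i=(e_i,f^\alpha_ie_\alpha)$. Global normal frame: $\eta_\alpha=(-Df^\alpha,e_\alpha)$, $1\le\alpha\le m$. $e_\alpha^\top$ is the component of $e_\alpha$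 tangent to $M$, i.e. $e_\alpha^\top=g^{ij}f^\alpha_j\partial_i$. Extrinsic quantities. $B$ is the (normal-bundle valued) second fundamental form of $M$, $B_{ij}=$ normal part of $\bar D_{\partial_i}\partial_j$ with $\bar D$ the flat connection of $\mathbb{R}^{n+m}$; $B_a^b=g^{bc}B_{ac}$. $(B_\alpha)_{ij}=\langle B_{ij},\eta_\alpha\rangle=f^\alpha_{ij}$, and $A_\alpha$ is the corresponding shape operator, $A_\alpha\partial_i=f^\alpha_{ik}g^{kj}\partial_j$. The Newton tensor of order $2q-1$ is the normal-bundle valued tensor $$(T_{(2q-1)})_i{}^j=\frac1{(2q-1)!}\delta^{a_1\cdots a_{2q-1}j}_{b_1\cdots b_{2q-1}i}\langle B_{a_1}^{b_1},B_{a_2}^{b_2}\rangle\cdots\langle B_{a_{2q-3}}^{b_{2q-3}},B_{a_{2q-2}}^{b_{2q-2}}\rangle B_{a_{2q-1}}^{b_{2q-1}},$$ and $T_{(2q-1)\alpha}=\langle T_{(2q-1)},\eta_\alpha\rangle$, regarded as an endomorphism of $TM$, $T_{(2q-1)\alpha}\partial_i=(T_{(2q-1)\alpha})_i{}^j\partial_j$. Flat normal bundle means that the normal curvature vanishes identically. Curvature and mass. The Riemann tensor is normalized so that the Gauss equation reads $R_{ijkl}=\langle B_{ik},B_{jl}\rangle-\langle B_{il},B_{jk}\rangle$, and $R_{ab}{}^{cd}=g^{ck}g^{dl}R_{abkl}$. The $q$-th Gauss--Bonnet curvature is $$L_{(q)}=\frac1{2^q}\delta^{a_1\cdots a_{2q}}_{b_1\cdots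 b_{2q}}\prod_{s=1}^qR_{a_{2s-1}a_{2s}}{}^{b_{2s-1}b_{2s}},$$ and $$P_{(q)}^{ijkl}=\frac1{2^q}\delta^{a_1\cdots a_{2q-2}\,i\,j}_{b_1\cdots b_{2q-2}b_{2q-1}b_{2q}}\Big(\prod_{s=1}^{q-1}R_{a_{2s-1}a_{2s}}{}^{b_{2s-1}b_{2s}}\Big)g^{b_{2q-1}k}g^{b_{2q}l}.$$ The $q$-th Gauss--Bonnet--Chern mass, computed in the graph coordinates $x\in\mathbb{R}^n$, is $$\mathrm{m}_q=c_q(n)\lim_{r\to\infty}\int_{S_r}P_{(q)}^{ijkl}\,g_{jk,l}\,\nu_i\,dS_r,\qquad c_q(n)=\frac{(n-2q)!}{2^{q-1}(n-1)!\,\omega_{n-1}},$$ where $g_{jk,l}=\partial g_{jk}/\partial x_l$, $S_r$ is the Euclidean sphere of radius $r$ centred at the origin, $\nu=x/r$, and $dS_r$ is its Euclidean volume form. (It is known that this limit exists, is finite and is independent of the asymptotically flat coordinates when $\tau>(n-2q)/(q+1)$ and $L_{(q)}$ is integrable.) *)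

(* Defs.v *)
From HB Require Import structures.
From mathcomp Require Import all_boot all_order all_algebra.
From mathcomp Require Import all_classical all_reals all_analysis.

Set Implicit Arguments.
Unset Strict Implicit.
Unset Printing Implicit Defensive.
Import Order.TTheory GRing.Theory Num.Theory.
Import numFieldNormedType.Exports.

Local Open Scope classical_set_scope.
Local Open Scope ring_scope.

Section PowerMeasure.
Context d (T : measurableType d) (R : realType).

Definition cons_tuple n (z : T * n.-tuple T) : n.+1.-tuple T :=
  [tuple of z.1 :: z.2].

Definition uncons_tuple n (t : n.+1.-tuple T) : T * n.-tuple T :=
  (thead t, [tuple of behead t]).

Lemma cons_tupleK n : cancel (@cons_tuple n) (@uncons_tuple n).
Proof.
by case=> x t; rewrite /cons_tuple /uncons_tuple /= theadE;
  congr pair; exact/val_inj.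
Qed.

Lemma measurable_cons_tuple n : measurable_fun setT (@cons_tuple n).
Proof. exact: measurable_cons. Qed.

Lemma measurable_uncons_tuple n : measurable_fun setT (@uncons_tuple n).
Proof.
apply/measurable_fun_pairP; split => /=.
  exact: (measurable_tnth ord0).
exact: measurable_behead.
Qed.

Section cons_measure.
Variables (n : nat) (m1 : {sigma_finite_measure set T -> \bar R}).
Variable m2 : {sigma_finite_measure set (n.-tuple T) -> \bar R}.

Definition cons_measure : set (n.+1.-tuple T) -> \bar R :=
  pushforward (m1 \x m2)%E (@cons_tuple n).

Let cons_measure0 : cons_measure set0 = 0%E.
Proof. by rewrite /cons_measure /pushforward preimage_set0 measure0. Qed.

Let cons_measure_ge0 A : (0 <= cons_measure A)%E.
Proof. by apply: (measure_ge0 (m1 \x m2)%E). Qed.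

Let cons_measure_additive : semi_sigma_additive cons_measure.
Proof.
have mc A : measurable A -> measurable (@cons_tuple n @^-1` A).
  by move=> mA; rewrite -[X in measurable X]setTI; exact: measurable_cons_tuple.
move=> F mF tF mUF; rewrite /cons_measure /pushforward preimage_bigcup.
apply: measure_semi_sigma_additive.
- by move=> k; exact: mc.
- apply/trivIsetP => /= i j _ _ ij; rewrite -preimage_setI.
  by move/trivIsetP : tF => /(_ _ _ _ _ ij) ->//; rewrite preimage_set0.
- by rewrite -preimage_bigcup; exact: mc.
Qed.

HB.instance Definition _ := isMeasure.Build _ _ _
  cons_measure cons_measure0 cons_measure_ge0 cons_measure_additive.

Let cons_measure_sigma_finite : sigma_finite setT cons_measure.
Proof.
have /sigma_finiteP[F [TF ndF Foo]] := sigma_finiteT m1.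
have /sigma_finiteP[G [TG ndG Goo]] := sigma_finiteT m2.
exists (fun k => @uncons_tuple n @^-1` (F k `*` G k)) => /=.
  rewrite -preimage_bigcup (_ : \bigcup_k (F k `*` G k) = setT) ?preimage_setT//.
  rewrite -subTset => -[x y] _.
  have [i _ Fx] : (\bigcup_k F k) x by rewrite -TF.
  have [j _ Gy] : (\bigcup_k G k) y by rewrite -TG.
  exists (maxn i j) => //; split => /=.
    by move: x Fx; exact/subsetPset/ndF/leq_maxl.
  by move: y Gy; exact/subsetPset/ndG/leq_maxr.
move=> k; have [mF Fk] := Foo k; have [mG Gk] := Goo k; split.
  rewrite -[X in measurable X]setTI; apply: measurable_uncons_tuple => //.
  exact: measurableX.
rewrite /cons_measure /pushforward -comp_preimage.
rewrite (_ : @uncons_tuple n \o @cons_tuple n = id) ?preimage_id//; last first.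
  by apply/funext => z /=; rewrite cons_tupleK.
by rewrite product_measure1E// lte_mul_pinfty// ge0_fin_numE.
Qed.

HB.instance Definition _ := Measure_isSigmaFinite.Build _ _ _
  cons_measure cons_measure_sigma_finite.

End cons_measure.

Fixpoint power_measure (m1 : {sigma_finite_measure set T -> \bar R}) (n : nat) :
    {sigma_finite_measure set (n.-tuple T) -> \bar R} :=
  match n with
  | 0 => \d_([tuple] : 0.-tuple T)
  | k.+1 => cons_measure m1 (power_measure m1 k)
  end.

End PowerMeasure.

(* Lebesgue measure on R^n, as the n-fold product of the one on R; points of
   R^n are row vectors in everything that follows, hence [rv]. *)
Definition leb (R : realType) (n : nat) := power_measure (@lebesgue_measure R) n.

Definition rv (R : realType) (n : nat) (t : n.-tuple R) : 'rV[R]_n :=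
  \row_i tnth t i.

Section Calculus.
Context {R : realType}.

Definition dotv {n} (u v : 'rV[R]_n) : R := \sum_k u 0 k * v 0 k.

(* The library norm `|x| on row vectors is the max norm, not this one. *)
Definition enorm {n} (x : 'rV[R]_n) : R := Num.sqrt (dotv x x).

Definition pd {n} {W : normedModType R} (i : 'I_n) (h : 'rV[R]_n -> W) :
    'rV[R]_n -> W :=
  fun x => 'D_(delta_mx 0 i) h x.

(* C^oo: all iterated partial derivatives exist and are continuous. *)
Definition smooth {n} {W : normedModType R} (h : 'rV[R]_n -> W) : Prop :=
  forall s : seq 'I_n,
    continuous (foldr pd h s) /\
    forall (i : 'I_n) (x : 'rV[R]_n),
      derivable (foldr pd h s) x (delta_mx 0 i).

(* a : indices upstairs, b : indices downstairs *)
Definition gdelta {n k} (a b : k.-tuple 'I_n) : R :=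
  \det (\matrix_(i < k, j < k) ((tnth a i == tnth b j)%:R : R)).

End Calculus.

(* The multi-indices a_1, ..., a_{2k} are 2k-tuples read in consecutive pairs:
   [odd_ix s] is the position of a_{2s-1} and [even_ix s] that of a_{2s} when
   s is counted from 1. *)
Lemma odd_ix_subproof k (s : 'I_k) : (s.*2 < k.*2)%N.
Proof. by rewrite ltn_double. Qed.

Lemma even_ix_subproof k (s : 'I_k) : (s.*2.+1 < k.*2)%N.
Proof. by rewrite ltn_Sdouble. Qed.

Definition odd_ix k (s : 'I_k) : 'I_k.*2 := Ordinal (odd_ix_subproof s).
Definition even_ix k (s : 'I_k) : 'I_k.*2 := Ordinal (even_ix_subproof s).

Section GraphGeometry.
Context {R : realType} {n m : nat}.
Variable f : 'rV[R]_n -> 'rV[R]_m.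

Definition fcomp (al : 'I_m) : 'rV[R]_n -> R := fun x => f x 0 al.

Definition asymptotically_flat (tau : R) : Prop :=
  exists C r0 : R, forall x : 'rV[R]_n, r0 <= enorm x ->
    forall (al : 'I_m) (i j k : 'I_n),
      `|pd i (fcomp al) x| + `|pd i (pd j (fcomp al)) x| * enorm x
        + `|pd i (pd j (pd k (fcomp al))) x| * enorm x ^+ 2
      <= C * (enorm x) `^ (- (tau / 2)).

Definition metric (x : 'rV[R]_n) : 'M[R]_n :=
  \matrix_(i, j)
    ((i == j)%:R + \sum_al pd i (fcomp al) x * pd j (fcomp al) x).

Definition imetric (x : 'rV[R]_n) : 'M[R]_n := invmx (metric x).

Definition Gdet (x : 'rV[R]_n) : R := \det (metric x).

(* g_{ij,k} *)
Definition dmetric (i j k : 'I_n) : 'rV[R]_n -> R :=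
  pd k (fun y => metric y i j).

(* Vectors and vector fields along the graph take values in R^(n+m). *)
Definition tangent (i : 'I_n) (x : 'rV[R]_n) : 'rV[R]_(n + m) :=
  row_mx (delta_mx 0 i) (\row_al pd i (fcomp al) x).

Definition eta (al : 'I_m) (x : 'rV[R]_n) : 'rV[R]_(n + m) :=
  row_mx (- \row_i pd i (fcomp al) x) (delta_mx 0 al).

Definition evec (al : 'I_m) : 'rV[R]_(n + m) := row_mx 0 (delta_mx 0 al).

(* Tangent vectors are also handled through their components in the frame
   [tangent]: X stands for X^i d_i. *)
Definition of_coord (x : 'rV[R]_n) (X : 'rV[R]_n) : 'rV[R]_(n + m) :=
  \sum_i X 0 i *: tangent i x.

Definition tan_coord (x : 'rV[R]_n) (v : 'rV[R]_(n + m)) : 'rV[R]_n :=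
  \row_i \sum_j imetric x i j * dotv v (tangent j x).

Definition normal_part (x : 'rV[R]_n) (v : 'rV[R]_(n + m)) : 'rV[R]_(n + m) :=
  v - of_coord x (tan_coord x v).

Definition sff (i j : 'I_n) (x : 'rV[R]_n) : 'rV[R]_(n + m) :=
  normal_part x (pd i (tangent j) x).

(* B_a^b, lower index first *)
Definition sff_mixed (a b : 'I_n) (x : 'rV[R]_n) : 'rV[R]_(n + m) :=
  \sum_c imetric x b c *: sff a c x.

(* A linear endomorphism S of the tangent space is given by the matrix of the
   S_i^j with S d_i = S_i^j d_j, and acts on components by X |-> X *m S. *)
Definition shape (al : 'I_m) (x : 'rV[R]_n) : 'M[R]_n :=
  \matrix_(i, j) \sum_k dotv (sff i k x) (eta al x) * imetric x k j.

(* (T_(2q-1))_i^j, of order 2q-1 although the argument is q; (c, d) is the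
   unpaired last pair of summation indices (a_{2q-1}, b_{2q-1}). *)
Definition newton (q : nat) (i j : 'I_n) (x : 'rV[R]_n) : 'rV[R]_(n + m) :=
  ((q.*2.-1)`!)%:R^-1 *:
  \sum_(a : (q.-1).*2.-tuple 'I_n) \sum_(b : (q.-1).*2.-tuple 'I_n)
  \sum_(c : 'I_n) \sum_(d : 'I_n)
    (gdelta [tuple of a ++ [:: c; j]] [tuple of b ++ [:: d; i]] *
     \prod_(s < q.-1)
       dotv (sff_mixed (tnth a (odd_ix s)) (tnth b (odd_ix s)) x)
            (sff_mixed (tnth a (even_ix s)) (tnth b (even_ix s)) x))
    *: sff_mixed c d x.

Definition newton_comp (q : nat) (al : 'I_m) (x : 'rV[R]_n) : 'M[R]_n :=
  \matrix_(i, j) dotv (newton q i j x) (eta al x).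

Definition commutator (S T : 'M[R]_n) (X : 'rV[R]_n) : 'rV[R]_n :=
  (X *m T) *m S - (X *m S) *m T.

Definition commutator_term (q : nat) (x : 'rV[R]_n) : R :=
  \sum_al \sum_be
    dotv (of_coord x (commutator (newton_comp q al x) (shape be x)
                                 (tan_coord x (evec al))))
         (of_coord x (tan_coord x (evec be))).

Definition normal_field (xi : 'rV[R]_n -> 'rV[R]_(n + m)) : Prop :=
  forall x i, dotv (xi x) (tangent i x) = 0.

Definition normal_connection (i : 'I_n) (xi : 'rV[R]_n -> 'rV[R]_(n + m)) :
    'rV[R]_n -> 'rV[R]_(n + m) :=
  fun x => normal_part x (pd i xi x).

(* No bracket term, as the coordinate fields commute. *)
Definition normal_curvature (i j : 'I_n) (xi : 'rV[R]_n -> 'rV[R]_(n + m))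
    (x : 'rV[R]_n) : 'rV[R]_(n + m) :=
  normal_connection i (normal_connection j xi) x
  - normal_connection j (normal_connection i xi) x.

Definition flat_normal_bundle : Prop :=
  forall xi, smooth xi -> normal_field xi ->
    forall i j x, normal_curvature i j xi x = 0.

(* christoffel k i j = Gamma^k_{ij} *)
Definition christoffel (k i j : 'I_n) (x : 'rV[R]_n) : R :=
  2^-1 * \sum_l imetric x k l *
    (dmetric j l i x + dmetric i l j x - dmetric i j l x).

(* The Levi-Civita curvature of the induced metric,
   R_{ijkl} = < nabla_i nabla_j d_l - nabla_j nabla_i d_l, d_k >;
   this sign makes the Gauss equation read
   R_{ijkl} = <B_ik, B_jl> - <B_il, B_jk>. *)
Definition riemann (i j k l : 'I_n) (x : 'rV[R]_n) : R :=
  \sum_p metric x k p *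
    (pd i (christoffel p j l) x - pd j (christoffel p i l) x
     + \sum_s (christoffel p i s x * christoffel s j l x
               - christoffel p j s x * christoffel s i l x)).

(* The first two indices are down, the last two up. *)
Definition riemann_up (a b c d : 'I_n) (x : 'rV[R]_n) : R :=
  \sum_k \sum_l imetric x c k * imetric x d l * riemann a b k l x.

Definition riemann_prod (k : nat) (a b : k.*2.-tuple 'I_n) (x : 'rV[R]_n) : R :=
  \prod_(s < k) riemann_up (tnth a (odd_ix s)) (tnth a (even_ix s))
                           (tnth b (odd_ix s)) (tnth b (even_ix s)) x.

Definition gauss_bonnet (q : nat) (x : 'rV[R]_n) : R :=
  (2 ^+ q)^-1 *
  \sum_(a : q.*2.-tuple 'I_n) \sum_(b : q.*2.-tuple 'I_n)
    gdelta a b * riemann_prod a b x.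

(* P_(q)^{ijkl}; (c, d) is (b_{2q-1}, b_{2q}). *)
Definition gb_tensor (q : nat) (i j k l : 'I_n) (x : 'rV[R]_n) : R :=
  (2 ^+ q)^-1 *
  \sum_(a : (q.-1).*2.-tuple 'I_n) \sum_(b : (q.-1).*2.-tuple 'I_n)
  \sum_(c : 'I_n) \sum_(d : 'I_n)
    gdelta [tuple of a ++ [:: i; j]] [tuple of b ++ [:: c; d]]
    * riemann_prod a b x * imetric x c k * imetric x d l.

(* The volume form of the graph is sqrt G dx. *)
Definition graph_integrable (h : 'rV[R]_n -> R) : Prop :=
  (leb R n).-integrable setT
    (fun t => (h (rv t) * Num.sqrt (Gdet (rv t)))%:E).

Definition graph_integral (h : 'rV[R]_n -> R) : \bar R :=
  (\int[leb R n]_t (h (rv t) * Num.sqrt (Gdet (rv t)))%:E)%E.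

End GraphGeometry.

Section Mass.
Context {R : realType}.

(* The sphere S_r of R^n is, up to its equator {x_0 = 0}, the union of the two
   graphs x_0 = +- sqrt(r^2 - |y|^2) over the ball |y| < r of R^(n-1); its
   volume form in the coordinates y is that of a graph, sqrt G dy.
   [conform_mx] only identifies R^(1 + (n-1)) with R^n for n > 0. *)
Definition hemisphere {k} (r : R) (lower : bool) (y : 'rV[R]_k) : 'rV[R]_1 :=
  const_mx ((-1) ^+ lower * Num.sqrt (r ^+ 2 - enorm y ^+ 2)).

Definition sphere_point {n} (r : R) (lower : bool) (y : 'rV[R]_(n.-1)) :
    'rV[R]_n :=
  conform_mx 0 (row_mx (hemisphere r lower y) y).

Definition sphere_integral {n} (r : R) (h : 'rV[R]_n -> R) : R :=
  \sum_(lower : bool)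
    \int[leb R n.-1]_(t in [set t | enorm (rv t) < r])
      (h (sphere_point r lower (rv t))
       * Num.sqrt (Gdet (hemisphere r lower) (rv t))).

(* For the unit sphere of R^n, of dimension n - 1. *)
Definition sphere_volume (n : nat) : R :=
  sphere_integral 1 (fun _ : 'rV[R]_n => 1).

Definition gbc_const (n q : nat) : R :=
  ((n - q.*2)`!)%:R / (2 ^+ q.-1 * ((n.-1)`!)%:R * sphere_volume n).

Definition gbc_flux {n m} (f : 'rV[R]_n -> 'rV[R]_m) (q : nat) (r : R) : R :=
  sphere_integral r (fun x =>
    \sum_i \sum_j \sum_k \sum_l
      gb_tensor f q i j k l x * dmetric f j k l x * (x 0 i / r)).

Definition gbc_mass {n m} (f : 'rV[R]_n -> 'rV[R]_m) (q : nat) : R :=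
  gbc_const n q * lim (gbc_flux f q r @[r --> +oo]).

End Mass.

(* Main.v *)
(* Write X^i = P_(q)^{ijkl} g_{jk,l} for the vector field whose flux is the mass.
   With Y_al = g^-1 Df^al, the shape operators h_al and their duals
   k_al = (delta_{al be} - <Df^al, Y_be>) h_be, the Gauss equation reads
   R_ab^cd = P(a,c,b,d) - P(a,d,b,c) with P = sum_al h_al (x) k_al, and X^i is half
   the contraction of the generalized delta with q - 1 factors P and one factor
   sum_al h_al (x) Y_al, the last upper index being i.  In div X the derivatives
   of h_al and k_al are symmetric in i and a row index of the delta up to
   lower-order terms, and symmetric parts are killed by the delta.  What is left
   is L_(q)/2 plus a sum over the slots of the delta, which the infinitesimal
   invariance of the delta under simultaneous changes of rows and columns and a
   Bianchi-type identity (antisymmetrizing over all rows and one column) turn into the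
   commutator term.

   The flux through S_r is then the integral of div X over the ball.  The normal
   direction of the graph coordinates is Fubini and the fundamental theorem of
   calculus; for the other directions one first rewrites the spherical integral
   by the substitution u = sqrt(rho^2 - v^2) on the circles in the (x_0, x_i)
   planes.  The commutator term is O(|x|^-((q+1)tau+2q)), hence integrable, and
   dominated convergence gives the limit.  If the normal bundle is flat, the
   curvature applied to the frame eta_al shows that Hess f^al and Hess f^be
   commute with respect to g, and the left-over slot terms vanish. *)

Require Import Defs.
From HB Require Import structures.
From mathcomp Require Import all_boot all_order all_algebra all_fingroup.
From mathcomp Require Import all_classical all_reals all_analysis.
From mathcomp Require Import measurable_realfun ring lra.
Set Implicit Arguments.
Unset Strict Implicit.
Unset Printing Implicit Defensive.
Import Order.TTheory GRing.Theory Num.Theory.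
Import numFieldNormedType.Exports.
Local Open Scope classical_set_scope.
Local Open Scope ring_scope.

(** * Algebra of the generalized Kronecker delta *)

Section GramDeterminant.
Context {R : numFieldType} {N n : nat}.
Local Notation ix := {ffun 'I_N -> 'I_n}.
Implicit Types (a b c : ix) (t u v : 'I_N) (G M : 'M[R]_n).

(** The operators h_al = Hess f^al g^-1 are symmetric only with respect to g, whereas the
    Bianchi-type identity needs symmetric matrices in the slots. The delta is therefore treated
    within the family [gram G]: for G = g^-1 the metric moves from the slots into the delta and
    leaves plain Hessians behind. The frame eta_al is not orthonormal, so each scalar product
    couples h_al with a dual k_al; the coefficients of the normal connection enter their derivatives
    with opposite signs and cancel. Since a sum of tensor products is not a tensor product, the sums
    over normal indices are expanded into labellings, one normal index per pair of slots; each
    labelling gives a mixed discriminant with one matrix per slot, and the labellings are resummed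
    at the end. On the analytic side, [leb] and the hemisphere charts both single out coordinate 0;
    the other coordinates are reached only through Tonelli and the circles, where the weight is
    unbounded at the equator and is handled by a monotone limit. *)

Definition upd (T : Type) (a : {ffun 'I_N -> T}) t (x : T) : {ffun 'I_N -> T} :=
  [ffun u => if u == t then x else a u].

Lemma upd_same T (a : {ffun 'I_N -> T}) t x : upd a t x t = x.
Proof. by rewrite ffunE eqxx. Qed.

Lemma upd_other T (a : {ffun 'I_N -> T}) t x u : u != t -> upd a t x u = a u.
Proof. by rewrite ffunE => /negPf ->. Qed.

Lemma upd_upd T (a : {ffun 'I_N -> T}) t x y : upd (upd a t x) t y = upd a t y.
Proof. by apply/ffunP => u; rewrite !ffunE; case: eqP. Qed.

Lemma upd_id T (a : {ffun 'I_N -> T}) t : upd a t (a t) = a.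
Proof. by apply/ffunP => u; rewrite !ffunE; case: eqP => // ->. Qed.

(** For [G] the inverse metric this is the generalized delta with its lower indices raised; [kdet]
    is the generalized delta itself. *)
Definition gram G a b : R := \det (\matrix_(i, j) G (a i) (b j)).
Definition kdet a b : R := gram 1%:M a b.

Lemma gramE G a b :
  gram G a b = \sum_(s : 'S_N) (-1) ^+ s * \prod_u G (a u) (b (s u)).
Proof.
rewrite /gram /determinant; apply: eq_bigr => s _; congr (_ * _).
by apply: eq_bigr => u _; rewrite mxE.
Qed.

Definition swapf a t u : ix := [ffun w => a (tperm t u w)].

Lemma swapfK t u : involutive (fun a => swapf a t u).
Proof. by move=> a; apply/ffunP => w; rewrite !ffunE tpermK. Qed.

Lemma gram_swapl G a b t u : t != u -> gram G (swapf a t u) b = - gram G a b.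
Proof.
move=> tu; rewrite !gramE -sumrN (reindex_inj (mulgI (tperm t u))) /=.
apply: eq_bigr => s _; rewrite odd_mul_tperm tu /= signrN mulNr.
congr (- (_ * _)); rewrite (reindex_inj (@perm_inj _ (tperm t u))) /=.
by apply: eq_bigr => w _; rewrite permM ffunE !tpermK.
Qed.

Lemma gram_swapr G a b t u : t != u -> gram G a (swapf b t u) = - gram G a b.
Proof.
move=> tu; rewrite !gramE -sumrN.
rewrite (reindex_inj (mulIg (tperm t u))) /=.
apply: eq_bigr => s _; rewrite odd_permM odd_tperm tu /= addbT signrN mulNr.
congr (- (_ * _)).
by apply: eq_bigr => w _; rewrite permM ffunE !tpermK.
Qed.

Lemma sum_gram_antisym G (F : ix -> ix -> R) t u :
  t != u -> (forall a b, F (swapf a t u) b = F a b) ->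
  \sum_(a : ix) \sum_(b : ix) gram G a b * F a b = 0.
Proof.
move=> tu FE; set S := LHS.
have : S = - S.
  rewrite {1}/S (reindex_inj (inv_inj (swapfK t u))) /= -sumrN.
  apply: eq_bigr => a _; rewrite -sumrN; apply: eq_bigr => b _.
  by rewrite gram_swapl// FE mulNr.
by move/eqP; rewrite -addr_eq0 -mulr2n mulrn_eq0 /= => /eqP.
Qed.

Lemma sum_gram_antisymr G (F : ix -> ix -> R) t u :
  t != u -> (forall a b, F a (swapf b t u) = F a b) ->
  \sum_(a : ix) \sum_(b : ix) gram G a b * F a b = 0.
Proof.
move=> tu FE; apply: big1 => a _; set S := LHS.
have : S = - S.
  rewrite {1}/S (reindex_inj (inv_inj (swapfK t u))) /= -sumrN.
  by apply: eq_bigr => b _; rewrite gram_swapr// FE mulNr.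
by move/eqP; rewrite -addr_eq0 -mulr2n mulrn_eq0 /= => /eqP.
Qed.

(** The equality holds permutation by permutation: once the slots on the left are reindexed by [s],
    slot [t] contributes on both sides the factor [(b (s t) == k) * (a t == p)] next to the same
    remaining product. *)
Lemma kdet_shift a b (k p : 'I_n) :
  \sum_t (b t == k)%:R * kdet a (upd b t p) =
  \sum_t (a t == p)%:R * kdet (upd a t k) b.
Proof.
rewrite /kdet.
under eq_bigr do rewrite gramE big_distrr /=.
under [RHS]eq_bigr do rewrite gramE big_distrr /=.
rewrite exchange_big [RHS]exchange_big /=; apply: eq_bigr => s _.
rewrite (reindex_inj (@perm_inj _ s)) /=; apply: eq_bigr => t _.
rewrite !(mulrCA _ ((-1) ^+ s)); congr (_ * _).
rewrite (bigD1 t) //= [in RHS](bigD1 t) //= !upd_same !mxE (eq_sym k).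
rewrite (eq_bigr (fun u => (1%:M : 'M[R]_n) (upd a t k u) (b (s u)))); first by ring.
by move=> u ut; rewrite !upd_other// (inj_eq perm_inj).
Qed.

Lemma sum_upd_exchange t (F : ix -> 'I_n -> R) :
  \sum_b \sum_k F b k = \sum_b \sum_p F (upd b t p) (b t).
Proof.
rewrite !pair_big /=.
rewrite (reindex_inj (_ : injective (fun x => (upd x.1 t x.2, x.1 t)))) //=.
apply: (inv_inj (f := fun x : ix * 'I_n => (upd x.1 t x.2, x.1 t))).
by case=> b k /=; rewrite upd_upd upd_id upd_same.
Qed.

Definition updS (S : 'I_N -> 'M[R]_n) t M : 'I_N -> 'M[R]_n :=
  fun u => if u == t then M else S u.

(** The polarization of N! e_N, with e_N the N-th elementary symmetric function of the eigenvalues;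
    a mixed discriminant up to normalization. *)
Definition mixdisc (S : 'I_N -> 'M[R]_n) : R :=
  \sum_(a : ix) \sum_(b : ix) kdet a b * \prod_u S u (a u) (b u).

Lemma prod_updS S t M a b :
  \prod_u updS S t M u (a u) (b u) =
  M (a t) (b t) * \prod_(u | u != t) S u (a u) (b u).
Proof.
rewrite (bigD1 t) //= /updS eqxx; congr (_ * _).
by apply: eq_bigr => u /negPf ->.
Qed.

Lemma mixdisc_mulr S t M :
  mixdisc (updS S t (S t *m M)) =
  \sum_(a : ix) \sum_(b : ix) \sum_p
    (\prod_u S u (a u) (b u)) * (M (b t) p * kdet a (upd b t p)).
Proof.
apply: eq_bigr => a _.
under eq_bigr => b _.
  rewrite prod_updS mxE [X in _ * X]big_distrl /= big_distrr /=; over.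
rewrite (sum_upd_exchange t); apply: eq_bigr => b _; apply: eq_bigr => p _.
rewrite upd_same [in RHS](bigD1 t) //=.
rewrite (eq_bigr (fun u : 'I_N => S u (a u) (b u))); first by ring.
by move=> u ut; rewrite upd_other.
Qed.

Lemma mixdisc_mull S t M :
  mixdisc (updS S t (M *m S t)) =
  \sum_(a : ix) \sum_(b : ix) \sum_k
    (\prod_u S u (a u) (b u)) * (M k (a t) * kdet (upd a t k) b).
Proof.
rewrite /mixdisc exchange_big [RHS]exchange_big /=; apply: eq_bigr => b _.
under eq_bigr => a _.
  rewrite prod_updS mxE [X in _ * X]big_distrl /= big_distrr /=; over.
rewrite (sum_upd_exchange t); apply: eq_bigr => a _; apply: eq_bigr => p _.
rewrite upd_same [in RHS](bigD1 t) //=.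
rewrite (eq_bigr (fun u : 'I_N => S u (a u) (b u))); first by ring.
by move=> u ut; rewrite upd_other.
Qed.

(* The infinitesimal form of the invariance of [mixdisc] under simultaneous
   conjugation of all its arguments. *)
Lemma mixdisc_equivariant S M :
  \sum_t mixdisc (updS S t (S t *m M)) = \sum_t mixdisc (updS S t (M *m S t)).
Proof.
under eq_bigr do rewrite mixdisc_mulr.
under [RHS]eq_bigr do rewrite mixdisc_mull.
rewrite exchange_big [RHS]exchange_big /=; apply: eq_bigr => a _.
rewrite exchange_big [RHS]exchange_big /=; apply: eq_bigr => b _.
under eq_bigr do rewrite -big_distrr /=.
under [RHS]eq_bigr do rewrite -big_distrr /=.
rewrite -!big_distrr /=; congr (_ * _).
transitivity (\sum_k \sum_p M k p * \sum_t (b t == k)%:R * kdet a (upd b t p)).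
  rewrite exchange_big [RHS]exchange_big /=; apply: eq_bigr => p _.
  under [RHS]eq_bigr do rewrite big_distrr /=.
  rewrite exchange_big; apply: eq_bigr => t _ /=.
  rewrite (bigD1 (b t)) //= eqxx mul1r big1 ?addr0// => k kb.
  by rewrite eq_sym (negPf kb) mul0r mulr0.
transitivity (\sum_k \sum_p M k p * \sum_t (a t == p)%:R * kdet (upd a t k) b).
  by apply: eq_bigr => k _; apply: eq_bigr => p _; rewrite kdet_shift.
rewrite [RHS]exchange_big; apply: eq_bigr => k _ /=.
under eq_bigr do rewrite big_distrr /=.
rewrite exchange_big; apply: eq_bigr => t _ /=.
rewrite (bigD1 (a t)) //= eqxx mul1r big1 ?addr0// => p pa.
by rewrite eq_sym (negPf pa) mul0r mulr0.
Qed.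

Lemma sum_kdet_mul a c G :
  \sum_b kdet a b * \prod_u G (c u) (b u) = gram G^T a c.
Proof.
rewrite gramE /kdet.
under eq_bigr do rewrite gramE big_distrl /=.
rewrite exchange_big /=; apply: eq_bigr => s _.
under eq_bigr do rewrite -mulrA.
rewrite -big_distrr /=; congr (_ * _).
rewrite [RHS](eq_bigr (fun u => \sum_k (a u == k)%:R * G (c (s u)) k)); last first.
  move=> u _; rewrite mxE (bigD1 (a u)) //= eqxx mul1r big1 ?addr0// => k ka.
  by rewrite eq_sym (negPf ka) mul0r.
rewrite bigA_distr_bigA /=.
have inj : injective (fun b : ix => [ffun u => b (s u)]).
  move=> b b' /ffunP h; apply/ffunP => u.
  by have := h (s^-1 u)%g; rewrite !ffunE permKV.
rewrite [RHS](reindex_inj inj) /=; apply: eq_bigr => b _.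
rewrite [X in _ * X](reindex_inj (@perm_inj _ s)) /= -big_split /=.
by apply: eq_bigr => u _; rewrite ffunE mxE.
Qed.

(** A factor [G] common to all slots is absorbed by the delta. What remains in the slots may then be
    symmetric, although the products [s t *m G] are not. *)
Lemma mixdisc_gram (s : 'I_N -> 'M[R]_n) G : G^T = G ->
  mixdisc (fun t => s t *m G) =
  \sum_(a : ix) \sum_(c : ix) gram G a c * \prod_u s u (a u) (c u).
Proof.
move=> sG; apply: eq_bigr => a _.
under eq_bigr => b _.
  rewrite (eq_bigr (fun u => \sum_k s u (a u) k * G k (b u))); last first.
    by move=> u _; rewrite mxE.
  rewrite bigA_distr_bigA /= big_distrr /=; over.
rewrite exchange_big /=; apply: eq_bigr => c _.
rewrite -[in RHS]sG -sum_kdet_mul big_distrl /=; apply: eq_bigr => b _.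
by rewrite big_split /= mulrCA mulrC; ring.
Qed.

(* Antisymmetrizing [gram G] over all the rows and one more column gives 0,
   because exchanging a row with the column it is paired with does not change
   the pairing. *)
Lemma gram_bianchi G a b v : G^T = G ->
  gram G a b = \sum_t gram G (upd a t (b v)) (upd b v (a t)).
Proof.
move=> sG.
have Gs i j : G i j = G j i by rewrite -[in LHS]sG mxE.
pose F t (s : 'S_N) := (-1) ^+ s *
  \prod_u G (upd a t (b v) u) (upd b v (a t) (s u)).
have -> : \sum_t gram G (upd a t (b v)) (upd b v (a t)) =
    \sum_t \sum_(s : 'S_N) F t s.
  by apply: eq_bigr => t _; rewrite gramE.
under eq_bigr => t _ do rewrite (bigID (fun s : 'S_N => s t == v)) /=.
rewrite big_split /= [X in _ + X](_ : _ = 0) ?addr0; last first.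
  pose P (x : 'I_N * 'S_N) := x.2 x.1 != v.
  rewrite pair_big_dep /=.
  set S := \sum_(_ | _) _.
  suff : S = - S.
    by move/eqP; rewrite -addr_eq0 -mulr2n mulrn_eq0 /= => /eqP.
  (* A sign-reversing involution on the terms with [s t != v]. With [u] the row paired with column
     [v], it exchanges the images of [t] and [u] and makes [u] the marked row. Rows [t] and [u]
     contribute [G (a u) (a t)] and [G (b v) (b (s t))] before and after, up to the symmetry of
     [G]. *)
  pose h (x : 'I_N * 'S_N) : 'I_N * 'S_N :=
    let u := (x.2^-1 v)%g in (u, (tperm x.1 u * x.2)%g).
  have hK x : h (h x) = x.
    case: x => t s; rewrite /h /= invMg tpermV permM -[(s^-1 v)%g]/(_).
    set u := (s^-1 v)%g; rewrite tpermR; congr pair.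
    by rewrite mulgA (tpermC u t) tperm2 mul1g.
  rewrite {1}/S (reindex_inj (inv_inj hK)) /= -sumrN.
  apply: eq_big => [[t s]/=|[t s]/=].
    rewrite permM tpermR.
    by rewrite (can2_eq (permK s) (permKV s)) -(can2_eq (permK s) (permKV s)).
  rewrite permM tpermR => stv; rewrite /F.
  set u := (s^-1 v)%g.
  have su : s u = v by rewrite /u permKV.
  have ut : t != u by apply: contraNneq stv => ->; rewrite su.
  rewrite odd_mul_tperm ut /= signrN mulNr; congr (- (_ * _)).
  rewrite (bigD1 u) //= (bigD1 t) //= [in RHS](bigD1 u) //= [in RHS](bigD1 t) //=.
  rewrite !permM tpermR tpermL su.
  rewrite !upd_same ![upd a u _ t]upd_other// ![upd a t _ u]upd_other 1?eq_sym//.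
  rewrite (Gs (b v)) ![upd b v _ (s t)]upd_other//.
  rewrite !mulrA; congr (_ * _).
    by rewrite mulrC (Gs (a u)) (Gs (b v)).
  apply: eq_bigr => w /andP[wu wt].
  have swv : s w != v by apply: contraNneq wu => swv; rewrite /u -swv permK.
  by rewrite permM tpermD 1?eq_sym// !upd_other.
rewrite gramE (exchange_big_dep xpredT) //=; apply: eq_bigr => s _.
rewrite [RHS](big_pred1 (s^-1 v)%g) => [|t]; last first.
  by rewrite /= (can2_eq (permK s) (permKV s)).
rewrite /F; congr (_ * _); set u := (s^-1 v)%g.
have su : s u = v by rewrite /u permKV.
rewrite (bigD1 u) //= [in RHS](bigD1 u) //= su !upd_same Gs; congr (_ * _).
apply: eq_bigr => w wu; rewrite !upd_other//.
by apply: contraNneq wu => swv; rewrite /u -swv permK.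
Qed.

Lemma sum_kdet_rows a (w : 'I_N -> 'rV[R]_n) G : G^T = G ->
  \sum_b kdet a b * \prod_u (w u *m G) 0 (b u) =
  \sum_c gram G a c * \prod_u w u 0 (c u).
Proof.
move=> sG.
under eq_bigr => b _.
  rewrite (eq_bigr (fun u => \sum_k w u 0 k * G k (b u))); last first.
    by move=> u _; rewrite mxE.
  rewrite bigA_distr_bigA /= big_distrr /=; over.
rewrite exchange_big /=; apply: eq_bigr => c _.
rewrite -[in RHS]sG -sum_kdet_mul big_distrl /=; apply: eq_bigr => b _.
by rewrite big_split /=; ring.
Qed.

(** [gram_bianchi] for the column [p], with the exchange of [a t] and [b p] carried over to the
    summand. The rows [t = p] and [t = q] give the two terms on the right. For any other [t], the
    slot becomes [s t (b p) (b t)], symmetric in two columns, and the sum vanishes. *)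
Lemma sum_gram_bianchi G (s : 'I_N -> 'M[R]_n) p q
    (theta : 'I_n -> 'I_n -> 'I_n -> 'I_n -> R) :
  G^T = G -> p != q -> (forall u, (s u)^T = s u) ->
  let S (a b : ix) :=
    \prod_(u | (u != p) && (u != q)) s u (a u) (b u) in
  \sum_(a : ix) \sum_(b : ix) gram G a b * (S a b * theta (a p) (a q) (b p) (b q)) =
  \sum_(a : ix) \sum_(b : ix) gram G a b * (S a b * theta (b p) (a q) (a p) (b q)) +
  \sum_(a : ix) \sum_(b : ix) gram G a b * (S a b * theta (a p) (b p) (a q) (b q)).
Proof.
move=> sG pq ss S.
have ssE u i j : s u i j = s u j i by rewrite -[in LHS]ss mxE.
pose Psi (a b : ix) := S a b * theta (a p) (a q) (b p) (b q).
pose F t (a b : ix) := Psi (upd a t (b p)) (upd b p (a t)).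
have step t : \sum_(a : ix) \sum_(b : ix) gram G (upd a t (b p)) (upd b p (a t)) * Psi a b =
              \sum_(a : ix) \sum_(b : ix) gram G a b * F t a b.
  rewrite !pair_big /=.
  pose h (x : ix * ix) :=
    (upd x.1 t (x.2 p), upd x.2 p (x.1 t)).
  have hK : involutive h.
    by case=> a b; rewrite /h /= !upd_same !upd_upd !upd_id.
  rewrite (reindex_inj (inv_inj hK)) /=; apply: eq_bigr => -[a b] _ /=.
  by rewrite !upd_same !upd_upd !upd_id.
transitivity (\sum_t \sum_(a : ix) \sum_(b : ix) gram G a b * F t a b).
  under [RHS]eq_bigr do rewrite -step.
  rewrite [RHS]exchange_big; apply: eq_bigr => a _ /=.
  rewrite [RHS]exchange_big; apply: eq_bigr => b _ /=.
  by rewrite -big_distrl /= -gram_bianchi.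
rewrite (bigD1 p) //= (bigD1 q) 1?eq_sym //= [X in _ + (_ + X)]big1 ?addr0; last first.
  move=> t /andP[tp tq].
  apply: (@sum_gram_antisymr G (F t) t p tp) => a b.
  rewrite /F /Psi /S.
  have ht : (t != p) && (t != q) by rewrite tp.
  rewrite (bigD1 t) //= [in RHS](bigD1 t) //=.
  rewrite !upd_same !(upd_other _ _ tp) ![upd _ t _ p]upd_other 1?eq_sym//.
  rewrite ![upd _ t _ q]upd_other 1?eq_sym// ![upd _ p _ q]upd_other 1?eq_sym//.
  have qp : q != p by rewrite eq_sym.
  have qt : q != t by rewrite eq_sym.
  rewrite !ffunE tpermL tpermR tpermD 1?eq_sym// ssE; congr (_ * _ * _).
  apply: eq_bigr => u /andP[/andP[up uq] ut].
  by rewrite !upd_other// ffunE tpermD// eq_sym.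
congr (_ + _); apply: eq_bigr => a _; apply: eq_bigr => b _; congr (_ * _).
  rewrite /F /Psi !upd_same !upd_other 1?eq_sym//; congr (_ * _).
  by apply: eq_bigr => u /andP[up uq]; rewrite !upd_other.
rewrite /F /Psi !upd_same !(upd_other _ _ pq) upd_other 1?eq_sym//.
congr (_ * _).
by apply: eq_bigr => u /andP[up uq]; rewrite !upd_other.
Qed.

Definition slot_rest (S : 'I_N -> 'M[R]_n) p q (a b : ix) :=
  \prod_(u | (u != p) && (u != q)) S u (a u) (b u).

Lemma prod_slots (S : 'I_N -> 'M[R]_n) p q a b : p != q ->
  \prod_u S u (a u) (b u) = S p (a p) (b p) * S q (a q) (b q) * slot_rest S p q a b.
Proof.
move=> pq; rewrite (bigD1 p) //= (bigD1 q) /= 1?eq_sym // mulrA.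
by rewrite /slot_rest; congr (_ * _).
Qed.

(** With [G] moved into the delta, slot [t] holds [n0 = s t G m] in one term and its transpose in
    the other. By the Bianchi identity their difference is the sum in which both indices of the
    matrix sit in the rows [t] and [q]; only the antisymmetric part counts there, so transposing
    changes the sign. *)
Lemma mixdisc_commutator_slot G (s : 'I_N -> 'M[R]_n) (m : 'M[R]_n)
    (y z : 'rV[R]_n) t q :
  G^T = G -> m^T = m -> (forall u, (s u)^T = s u) -> t != q ->
  let h u := s u *m G in
  let S := updS h q (y^T *m (z *m G)) in
  mixdisc (updS S t (m *m G *m h t)) - mixdisc (updS S t (h t *m (m *m G))) =
  - \sum_(a : ix) \sum_(b : ix) kdet a b * (slot_rest h t q a b *
     ((h t *m m) (a t) (a q) * (y *m G) 0 (b t) * (z *m G) 0 (b q))).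
Proof.
move=> sG sm ss tq h S.
pose s' := updS s q (y^T *m z).
have E1 w w' : w = w' *m G ->
    mixdisc (updS S t w) = \sum_(a : ix) \sum_(c : ix) gram G a c *
      (slot_rest s t q a c * (w' (a t) (c t) * (y 0 (a q) * z 0 (c q)))).
  move=> ->.
  transitivity (mixdisc (fun u => updS s' t w' u *m G)).
    apply: eq_bigr => a _; apply: eq_bigr => b _; congr (_ * _).
    apply: eq_bigr => u _; rewrite /updS; case: eqP => // _.
    by rewrite /S /s' /updS; case: eqP => // _; rewrite mulmxA.
  rewrite mixdisc_gram//; apply: eq_bigr => a _; apply: eq_bigr => b _.
  congr (_ * _); rewrite (prod_slots _ _ _ tq) /updS eqxx eq_sym (negPf tq).
  rewrite /s' /updS eqxx mulrC; congr (_ * _).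
    apply: eq_bigr => u /andP[ut uq].
    by rewrite (negPf ut) (negPf uq).
  by congr (_ * _); rewrite !mxE big_ord1 !mxE.
pose n0 := h t *m m.
have n0T : n0^T = m *m G *m s t.
  by rewrite /n0 /h !trmx_mul sm sG ss mulmxA.
rewrite (E1 _ n0^T); last by rewrite n0T /h !mulmxA.
rewrite (E1 _ n0); last by rewrite /n0 !mulmxA.
pose th (K : 'M[R]_n) i j k l := K i k * (y 0 j * z 0 l).
set L := LHS.
pose L1 (K : 'M[R]_n) := \sum_(a : ix) \sum_(b : ix) gram G a b *
  (slot_rest s t q a b * th K (a t) (a q) (b t) (b q)).
pose L2 (K : 'M[R]_n) := \sum_(a : ix) \sum_(b : ix) gram G a b *
  (slot_rest s t q a b * th K (a t) (b t) (a q) (b q)).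
have LE : L = L1 n0^T - L1 n0 by [].
have L1tr K : L1 K^T = \sum_(a : ix) \sum_(b : ix) gram G a b *
  (slot_rest s t q a b * th K (b t) (a q) (a t) (b q)).
  by apply: eq_bigr => a _; apply: eq_bigr => b _; rewrite /th mxE.
have B K : L1 K = L1 K^T + L2 K.
  by rewrite {1}/L1 (sum_gram_bianchi (th K) sG tq ss) L1tr.
have L2tr : L2 n0^T = - L2 n0.
  apply/eqP; rewrite -addr_eq0; apply/eqP; rewrite /L2 -big_split /=.
  under eq_bigr do rewrite -big_split /=.
  pose FF (a b : ix) := slot_rest s t q a b *
   (th n0^T (a t) (b t) (a q) (b q) + th n0 (a t) (b t) (a q) (b q)).
  rewrite -[RHS](@sum_gram_antisym G FF t q)//.
    apply: eq_bigr => a _; apply: eq_bigr => b _.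
    by rewrite /FF mulrDr mulrDr.
  move=> a b; rewrite /FF /slot_rest; congr (_ * _).
    apply: eq_bigr => u /andP[ut uq].
    by rewrite !ffunE tpermD// eq_sym.
  by rewrite /th !ffunE tpermL tpermR !mxE addrC.
have LL2 : L = - L2 n0.
  have := B n0^T; rewrite trmxK L2tr LE => ->.
  by rewrite addrC addKr.
rewrite LL2; congr (- _); apply: eq_bigr => a _.
(* For fixed rows [a], each column index now occurs in a single row vector, so [G] can be moved back
   from the delta into the slots. *)
pose w u : 'rV[R]_n := if u == t then y else if u == q then z else row (a u) (s u).
transitivity (n0 (a t) (a q) * \sum_c gram G a c * \prod_u w u 0 (c u)).
  rewrite big_distrr /=; apply: eq_bigr => b _.
  rewrite (bigD1 t) //= (bigD1 q) 1?eq_sym //= /th /w !eqxx eq_sym (negPf tq).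
  rewrite (eq_bigr (fun u => s u (a u) (b u))); last first.
    by move=> u /andP[/negPf -> /negPf ->]; rewrite mxE.
  by rewrite -/(slot_rest s t q a b); ring.
rewrite -sum_kdet_rows// big_distrr /=; apply: eq_bigr => b _.
rewrite (bigD1 t) //= (bigD1 q) 1?eq_sym //= /w !eqxx eq_sym (negPf tq).
rewrite (eq_bigr (fun u => h u (a u) (b u))); last first.
  by move=> u /andP[/negPf -> /negPf ->]; rewrite -row_mul mxE.
by rewrite -/(slot_rest h t q a b) -/n0; ring.
Qed.

(** Equivariance applied to the slots [h] with the rank-one matrix [y^T (z G)] in slot [q]: the
    commutator with [m G] in slot [q] is minus the sum of the commutators in the other slots. *)
Lemma mixdisc_commutator G (s : 'I_N -> 'M[R]_n) (m : 'M[R]_n)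
    (y z : 'rV[R]_n) q :
  G^T = G -> m^T = m -> (forall u, (s u)^T = s u) ->
  let h u := s u *m G in
  mixdisc (updS h q (y^T *m (z *m G *m (m *m G)))) -
  mixdisc (updS h q (m *m G *m y^T *m (z *m G))) =
  - \sum_(t | t != q) \sum_(a : ix) \sum_(b : ix) kdet a b * (slot_rest h t q a b *
     ((h t *m m) (a t) (a q) * (y *m G) 0 (b t) * (z *m G) 0 (b q))).
Proof.
move=> sG sm ss h.
pose S := updS h q (y^T *m (z *m G)).
have updSS w : mixdisc (updS S q w) = mixdisc (updS h q w).
  apply: eq_bigr => a _; apply: eq_bigr => b _; congr (_ * _).
  by apply: eq_bigr => u _; rewrite /S /updS; case: eqP.
have := mixdisc_equivariant S (m *m G).
rewrite (bigD1 q) //= [in X in _ = X](bigD1 q) //= !updSS.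
have -> : S q = y^T *m (z *m G) by rewrite /S /updS eqxx.
rewrite -[y^T *m _ *m _]mulmxA [m *m G *m (y^T *m _)]mulmxA.
set A := mixdisc _; set B := mixdisc (updS h q (_ *m (z *m G))) => e.
have -> : A - B = \sum_(t | t != q) mixdisc (updS S t (m *m G *m S t))
             - \sum_(t | t != q) mixdisc (updS S t (S t *m (m *m G))).
  move: e; set C := \sum_(_ | _) _; set D := \sum_(_ | _) _ => e.
  have -> : A = B + D - C by rewrite -e addrK.
  ring.
rewrite -sumrB -sumrN; apply: eq_bigr => t tq.
have -> : S t = h t by rewrite /S /updS (negPf tq).
by rewrite (mixdisc_commutator_slot y z sG sm ss tq).
Qed.

End GramDeterminant.

(** * Partial derivatives *)

Section Topology.
Context {R : realType}.

Lemma mx_continuous (T : topologicalType) p q (M : T -> 'M[R]_(p, q)) :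
  (forall i j, continuous (fun x => M x i j)) -> continuous M.
Proof.
move=> cM x A [P MP sPA].
have : \forall y \near x, forall ij, P ij.1 ij.2 (M y ij.1 ij.2).
  by apply: filter_forall => -[i j]; exact: cM (MP i j).
by apply: filterS => y Py; apply: sPA => i j; exact: (Py (i, j)).
Qed.

Lemma continuous_add (T : topologicalType) (h g : T -> R) :
  continuous h -> continuous g -> continuous (fun x => h x + g x).
Proof. by move=> ch cg x; exact: cvgD (ch x) (cg x). Qed.

Lemma continuous_mul (T : topologicalType) (h g : T -> R) :
  continuous h -> continuous g -> continuous (fun x => h x * g x).
Proof. by move=> ch cg x; exact: cvgM (ch x) (cg x). Qed.

Lemma continuous_neg (T : topologicalType) (h : T -> R) :
  continuous h -> continuous (fun x => - h x).
Proof. by move=> ch x; exact: cvgN (ch x). Qed.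

Lemma continuous_inv (T : topologicalType) (h : T -> R) :
  (forall x, h x != 0) -> continuous h -> continuous (fun x => (h x)^-1).
Proof. by move=> h0 ch x; exact: cvgV (h0 x) (ch x). Qed.

Lemma continuous_bigsum (T : topologicalType) I (r : seq I) (P : pred I)
    (F : I -> T -> R) :
  (forall i, continuous (F i)) -> continuous (fun x => \sum_(i <- r | P i) F i x).
Proof.
move=> cF; elim: r => [|i r IH].
  by under eq_fun do rewrite big_nil; exact: cst_continuous.
under eq_fun do rewrite big_cons; case: (P i) => // x.
exact: cvgD (cF i x) (IH x).
Qed.

End Topology.

(** * Functions of class C^1 and the symmetry of second derivatives *)

Section C1.
Context {R : realType} {n : nat}.
Implicit Types (h g : 'rV[R]_n -> R) (i j : 'I_n) (x : 'rV[R]_n).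

Local Notation ev i := (delta_mx 0 i : 'rV[R]_n).

Definition C1 h : Prop :=
  continuous h /\ forall i, (forall x, derivable h x (ev i)) /\ continuous (pd i h).

Lemma C1_continuous h : C1 h -> continuous h. Proof. by case. Qed.

Lemma C1_derivable h i x : C1 h -> derivable h x (ev i).
Proof. by case=> _ /(_ i)[]. Qed.

Lemma C1_continuous_pd h i : C1 h -> continuous (pd i h).
Proof. by case=> _ /(_ i)[]. Qed.

Lemma pdD h g i x : C1 h -> C1 g ->
  pd i (fun y => h y + g y) x = pd i h x + pd i g x.
Proof. by move=> Ch Cg; apply: deriveD; exact: C1_derivable. Qed.

Lemma pdM h g i x : C1 h -> C1 g ->
  pd i (fun y => h y * g y) x = pd i h x * g x + h x * pd i g x.
Proof.
move=> Ch Cg; rewrite /pd (@deriveM _ _ h g)//; try exact: C1_derivable.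
by rewrite addrC [g x *: _]mulrC.
Qed.

Lemma pd_cst i (c : R) x : pd i (fun=> c) x = 0.
Proof. exact: derive_cst. Qed.

Lemma C1_cst (c : R) : C1 (fun=> c).
Proof.
split=> [x|i]; first exact: cst_continuous.
split=> [x|]; first exact: derivable_cst.
rewrite (_ : pd i _ = fun=> 0); first by exact: cst_continuous.
by apply/funext => x; exact: pd_cst.
Qed.

Lemma C1D h g : C1 h -> C1 g -> C1 (fun y => h y + g y).
Proof.
move=> Ch Cg; split=> [|i].
  by apply: continuous_add; exact: C1_continuous.
split=> [x|]; first by apply: derivableD; exact: C1_derivable.
rewrite (_ : pd i _ = fun x => pd i h x + pd i g x).
  by apply: continuous_add; exact: C1_continuous_pd.
by apply/funext => x; exact: pdD.
Qed.

Lemma C1M h g : C1 h -> C1 g -> C1 (fun y => h y * g y).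
Proof.
move=> Ch Cg; split=> [|i].
  by apply: continuous_mul; exact: C1_continuous.
split=> [x|]; first by apply: derivableM; exact: C1_derivable.
rewrite (_ : pd i _ = fun x => pd i h x * g x + h x * pd i g x).
  by apply: continuous_add; apply: continuous_mul;
    (exact: C1_continuous_pd || exact: C1_continuous).
by apply/funext => x; exact: pdM.
Qed.

Lemma C1N h : C1 h -> C1 (fun y => - h y).
Proof.
move=> Ch; have -> : (fun y => - h y) = (fun y => (-1) * h y).
  by apply/funext => y; rewrite mulN1r.
exact: C1M (C1_cst _) Ch.
Qed.

Lemma pdN h i x : C1 h -> pd i (fun y => - h y) x = - pd i h x.
Proof. by move=> Ch; apply: deriveN; exact: C1_derivable. Qed.

Lemma C1B h g : C1 h -> C1 g -> C1 (fun y => h y - g y).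
Proof. by move=> Ch Cg; exact: C1D Ch (C1N Cg). Qed.

Lemma pdB h g i x : C1 h -> C1 g ->
  pd i (fun y => h y - g y) x = pd i h x - pd i g x.
Proof. by move=> Ch Cg; rewrite pdD ?pdN//; exact: C1N. Qed.

Lemma pdZ h i x (c : R) : C1 h -> pd i (fun y => c * h y) x = c * pd i h x.
Proof. by move=> Ch; rewrite pdM ?pd_cst ?mul0r ?add0r//; exact: C1_cst. Qed.

Lemma C1V h : C1 h -> (forall x, h x != 0) -> C1 (fun y => (h y)^-1).
Proof.
move=> Ch h0; split=> [|i].
  by apply: continuous_inv => //; exact: C1_continuous.
split=> [x|]; first by apply: derivableV => //; exact: C1_derivable.
rewrite (_ : pd i _ = fun x => - ((h x)^-1 * (h x)^-1) * pd i h x).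
  apply: continuous_mul; last exact: C1_continuous_pd.
  by apply: continuous_neg; apply: continuous_mul; apply: continuous_inv => //;
    exact: C1_continuous.
apply/funext => x; rewrite /pd deriveV//; last exact: C1_derivable.
by rewrite /GRing.scale /= expr2 invfM.
Qed.

Lemma C1_sum I (r : seq I) (P : pred I) (F : I -> 'rV[R]_n -> R) :
  (forall k, C1 (F k)) -> C1 (fun x => \sum_(k <- r | P k) F k x).
Proof.
move=> CF; elim: r => [|k r IH].
  by under eq_fun do rewrite big_nil; exact: C1_cst.
by under eq_fun do rewrite big_cons; case: (P k) => //; exact: C1D.
Qed.

Lemma pd_sum I (r : seq I) (P : pred I) (F : I -> 'rV[R]_n -> R) i x :
  (forall k, C1 (F k)) ->
  pd i (fun x => \sum_(k <- r | P k) F k x) x = \sum_(k <- r | P k) pd i (F k) x.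
Proof.
move=> CF; elim: r => [|k r IH].
  by under eq_fun do rewrite big_nil; rewrite big_nil pd_cst.
under eq_fun do rewrite big_cons; rewrite big_cons; case: (P k) => //.
by rewrite pdD ?IH//; exact: C1_sum.
Qed.

Lemma C1_prod I (r : seq I) (P : pred I) (F : I -> 'rV[R]_n -> R) :
  (forall k, C1 (F k)) -> C1 (fun x => \prod_(k <- r | P k) F k x).
Proof.
move=> CF; elim: r => [|k r IH].
  by under eq_fun do rewrite big_nil; exact: C1_cst.
by under eq_fun do rewrite big_cons; case: (P k) => //; exact: C1M.
Qed.

Lemma pd_prod (I : finType) (P : pred I) (F : I -> 'rV[R]_n -> R) i x :
  (forall k, C1 (F k)) ->
  pd i (fun x => \prod_(k | P k) F k x) x =
  \sum_(k | P k) pd i (F k) x * \prod_(l | P l && (l != k)) F l x.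
Proof.
move=> CF.
suff H (r : seq I) : uniq r ->
    pd i (fun x => \prod_(k <- r | P k) F k x) x =
    \sum_(k <- r | P k) pd i (F k) x * \prod_(l <- r | P l && (l != k)) F l x.
  exact: H (index_enum_uniq I).
elim: r => [_|k r IH /= /andP[kr ur]].
  by under eq_fun do rewrite big_nil; rewrite big_nil pd_cst.
under eq_fun do rewrite big_cons; rewrite big_cons.
have rest (l : I) : l \in r -> l != k by apply: contraTneq => ->.
case: ifPn => Pk; last first.
  rewrite IH//; apply: eq_bigr => l Pl.
  by rewrite big_cons (negPf Pk).
rewrite pdM//; last exact: C1_prod.
congr (_ + _).
  rewrite big_cons eqxx andbF; congr (_ * _).
  rewrite big_seq_cond [RHS]big_seq_cond; apply: eq_bigl => l.
  by case: (boolP (l \in r)) => //= /rest ->; rewrite andbT.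
rewrite IH// big_distrr /= big_seq_cond [RHS]big_seq_cond.
apply: eq_bigr => l /andP[lr Pl]; rewrite big_cons Pk /= eq_sym rest//.
by rewrite mulrCA.
Qed.

Lemma C1_det p (M : 'rV[R]_n -> 'M[R]_p) :
  (forall a b, C1 (fun x => M x a b)) -> C1 (fun x => \det (M x)).
Proof.
move=> CM; apply: C1_sum => s; apply: C1M; first exact: C1_cst.
by apply: C1_prod => k; exact: CM.
Qed.

Lemma C1_invmx p (M : 'rV[R]_n -> 'M[R]_p) :
  (forall x, M x \in unitmx) ->
  (forall a b, C1 (fun x => M x a b)) ->
  forall a b, C1 (fun x => invmx (M x) a b).
Proof.
move=> uM CM i j.
rewrite (_ : (fun _ => _) = fun x => (\det (M x))^-1 * (\adj (M x)) i j); last first.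
  by apply/funext => x; rewrite /invmx uM mxE.
apply: C1M.
  apply: C1V; first exact: C1_det.
  by move=> x; rewrite -unitfE -unitmxE.
rewrite (_ : (fun _ => _) = fun x => (-1) ^+ (j + i) *
    \det (row' j (col' i (M x)))); last by apply/funext => x; rewrite mxE.
apply: C1M; first exact: C1_cst.
apply: C1_det => k l.
by rewrite (_ : (fun _ => _) = fun x => M x (lift j k) (lift i l)) //;
  apply/funext => x; rewrite !mxE.
Qed.

Lemma is_derive_line h i x (t : R) : C1 h ->
  is_derive t 1 (fun s : R => h (x + s *: ev i)) (pd i h (x + t *: ev i)).
Proof.
move=> Ch; have dh := @C1_derivable h i (x + t *: ev i) Ch.
have E : (fun s : R => s^-1 *: ((fun s : R => h (x + s *: ev i)) (s *: (1 : R) + t)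
      - h (x + t *: ev i))) =
    (fun s : R => s^-1 *: (h (s *: ev i + (x + t *: ev i)) - h (x + t *: ev i))).
  apply/funext => s; congr (_ *: (h _ - _)).
  by rewrite /= [s *: (1 : R)]mulr1 scalerDl addrCA.
apply: DeriveDef.
  by rewrite /derivable E.
by rewrite /derive E.
Qed.

Lemma continuous_line i x : continuous (fun s : R => x + s *: ev i).
Proof.
move=> s; apply: cvgD; first exact: cvg_cst.
by apply: cvgZr_tmp; exact: cvg_id.
Qed.

Lemma continuous_shift h (v : 'rV[R]_n) :
  continuous h -> continuous (fun y : 'rV[R]_n => h (y + v)).
Proof.
have cs : continuous (fun y : 'rV[R]_n => y + v).
  apply: mx_continuous => i j.
  under eq_fun do rewrite mxE.
  by apply: continuous_add; [exact: coord_continuous|exact: cst_continuous].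
by move=> ch y; exact: (continuous_comp (cs y) (ch (y + v))).
Qed.

Let shift_quotient h i (v x : 'rV[R]_n) :
  (fun s : R => s^-1 *: (h (s *: ev i + x + v) - h (x + v))) =
  (fun s : R => s^-1 *: (h (s *: ev i + (x + v)) - h (x + v))).
Proof. by apply/funext => s; rewrite addrA. Qed.

Lemma pd_shift h i (v x : 'rV[R]_n) :
  pd i (fun y : 'rV[R]_n => h (y + v)) x = pd i h (x + v).
Proof. by rewrite /pd /derive /= shift_quotient. Qed.

Lemma C1_shift h (v : 'rV[R]_n) : C1 h -> C1 (fun y : 'rV[R]_n => h (y + v)).
Proof.
move=> Ch; split=> [|i]; first exact: continuous_shift (C1_continuous Ch).
split=> [x|].
  by rewrite /derivable /= shift_quotient; exact: C1_derivable.
rewrite (_ : pd i _ = fun x : 'rV[R]_n => pd i h (x + v)).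
  exact: continuous_shift (C1_continuous_pd Ch).
by apply/funext => x; exact: pd_shift.
Qed.

Lemma MVT_line h i x (t : R) : C1 h -> 0 < t ->
  exists2 s, 0 < s < t & h (x + t *: ev i) - h x = t * pd i h (x + s *: ev i).
Proof.
move=> Ch t0.
have [|s] := @MVT R (fun s => h (x + s *: ev i)) (fun s => pd i h (x + s *: ev i))
  0 t t0 (fun s _ => is_derive_line i x s Ch).
  apply: continuous_subspaceT => s.
  apply: continuous_comp; [exact: continuous_line | exact: C1_continuous].
rewrite in_itv /= => s0t E; exists s => //.
by move: E; rewrite scale0r addr0 subr0 mulrC.
Qed.

(** The second difference of [h] over a square of side [t] is symmetric in the two directions.
    Applying the mean value theorem twice, in either order, gives t^2 times one of the mixed
    derivatives at a point within 2t of [x]; both are continuous at [x]. *)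
Lemma pd_comm h i j x : C1 h -> (forall k, C1 (pd k h)) ->
  pd i (pd j h) x = pd j (pd i h) x.
Proof.
move=> Ch Cph.
have key a b (t : R) : 0 < t -> exists s u : R, [/\ 0 < s < t, 0 < u < t &
   h (x + t *: ev a + t *: ev b) - h (x + t *: ev a) - h (x + t *: ev b) + h x =
   t * (t * pd b (pd a h) (x + s *: ev a + u *: ev b))].
  move=> t0.
  pose g y := h (y + t *: ev b) - h y.
  have Cg1 : C1 (fun y => h (y + t *: ev b)) by exact: C1_shift.
  have Cg : C1 g by exact: C1B.
  have [s s0t E1] := MVT_line a x Cg t0.
  have pg y : pd a g y = pd a h (y + t *: ev b) - pd a h y.
    by rewrite -pd_shift; exact: pdB.
  have [u u0t E2] := MVT_line b (x + s *: ev a) (Cph a) t0.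
  exists s, u; split => //.
  by rewrite -E2 -pg -E1 /g opprB addrA addrAC; ring.
have key2 (t : R) : 0 < t -> exists p q : 'rV[R]_n,
    [/\ `|p - x| < 2 * t, `|q - x| < 2 * t & pd j (pd i h) p = pd i (pd j h) q].
  move=> t0.
  have [s [u [s0t u0t E1]]] := key i j t t0.
  have [s' [u' [s0t' u0t' E2]]] := key j i t t0.
  have nev k : `|ev k| <= 1.
    rewrite [leLHS]/Num.Def.normr /= mx_normrE; apply/bigmax_leP; split=> // -[a b] _ /=.
    by rewrite !mxE; case: (_ && _); rewrite /= ?normr1 ?normr0.
  have nb (s1 u1 : R) a b : 0 < s1 < t -> 0 < u1 < t ->
      `|x + s1 *: ev a + u1 *: ev b - x| < 2 * t.
    move=> /andP[? ?] /andP[? ?].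
    rewrite addrAC [x + _]addrC addrK (le_lt_trans (ler_normD _ _))//.
    rewrite !normrZ !gtr0_norm// mulr2n mulrDl mul1r.
    apply: ltrD.
      by rewrite (le_lt_trans (ler_wpM2l _ (nev a)))// ?mulr1// ltW.
    by rewrite (le_lt_trans (ler_wpM2l _ (nev b)))// ?mulr1// ltW.
  exists (x + s *: ev i + u *: ev j), (x + s' *: ev j + u' *: ev i).
  split; [exact: nb|exact: nb|].
  have tn0 : t != 0 by rewrite gt_eqF.
  have E : t * (t * pd j (pd i h) (x + s *: ev i + u *: ev j)) =
           t * (t * pd i (pd j h) (x + s' *: ev j + u' *: ev i)).
    apply: (etrans (esym E1)); apply: etrans E2.
    have -> : x + t *: ev j + t *: ev i = x + t *: ev i + t *: ev j.
      by rewrite addrAC.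
    exact: (congr1 (fun z => z + h x) (addrAC _ _ _)).
  exact: (mulfI tn0 (mulfI tn0 E)).
have gap (e A B c d : R) :
    c = d -> `|A - c| < e / 2 -> `|B - d| < e / 2 -> `|A - B| <= e.
  by move=> ->; rewrite !ltr_norml !ler_norml => /andP[? ?] /andP[? ?]; lra.
apply/eqP; rewrite -subr_eq0 -normr_le0; apply/ler_addgt0Pr => e e0; rewrite add0r.
have e2 : 0 < e / 2 by rewrite divr_gt0.
have := @C1_continuous_pd _ i (Cph j) x.
move=> /cvgrPdist_lt /(_ _ e2) /nbhs_ballP[d1 /= d10 B1].
have := @C1_continuous_pd _ j (Cph i) x.
move=> /cvgrPdist_lt /(_ _ e2) /nbhs_ballP[d2 /= d20 B2].
pose t := Num.min d1 d2 / 2.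
have t0 : 0 < t by rewrite divr_gt0// lt_min d10.
have [p [q [px qx E]]] := key2 t t0.
have t2 : 2 * t = Num.min d1 d2 by rewrite /t mulrC divfK.
have b1 : `|pd i (pd j h) x - pd i (pd j h) q| < e / 2.
  apply: B1; rewrite -ball_normE; have : `|x - q| < d1; last by [].
  by rewrite distrC; apply: (lt_le_trans qx); rewrite t2 ge_min lexx.
have b2 : `|pd j (pd i h) x - pd j (pd i h) p| < e / 2.
  apply: B2; rewrite -ball_normE; have : `|x - p| < d2; last by [].
  by rewrite distrC; apply: (lt_le_trans px); rewrite t2 ge_min lexx orbT.
exact: gap (esym E) b1 b2.
Qed.

Lemma smooth_pd (W : normedModType R) (h : 'rV[R]_n -> W) i : smooth h -> smooth (pd i h).
Proof. by move=> sh s; have := sh (rcons s i); rewrite foldr_rcons. Qed.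

Lemma smooth_C1 h : smooth h -> C1 h.
Proof.
move=> sh; split=> [|i]; first by have [] := sh [::].
split=> [x|]; first by have [_] := sh [::]; exact.
by have [] := sh [:: i].
Qed.

Lemma smooth_cst (W : normedModType R) (c : W) : smooth (fun _ : 'rV[R]_n => c).
Proof.
move=> s.
have [c' ->] : exists c', foldr pd (fun _ : 'rV[R]_n => c) s = fun=> c'.
  elim: s => [|i s [c' IH]] /=; first by exists c.
  exists 0; rewrite IH; apply/funext => x; exact: derive_cst.
split; first exact: cst_continuous.
by move=> i x; exact: derivable_cst.
Qed.

Lemma smoothN (g : 'rV[R]_n -> R) : smooth g -> smooth (fun x => - g x).
Proof.
move=> sg s.
have -> : foldr pd (fun x => - g x) s = fun x => - foldr pd g s x.
  elim: s => [//|i s IH] /=; rewrite IH; apply/funext => x.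
  by apply: deriveN; have [_] := sg s; exact.
have [cg dg] := sg s; split; first exact: continuous_neg.
by move=> i x; apply: derivableN; exact: dg.
Qed.

Lemma smooth_row p (V : 'rV[R]_n -> 'rV[R]_p) :
  (forall b, smooth (fun x => V x 0 b)) -> smooth V.
Proof.
move=> sV s.
have E : (forall x i, derivable (foldr pd V s) x (delta_mx 0 i)) /\
    foldr pd V s = fun x => \row_b foldr pd (fun x => V x 0 b) s x.
  have D s' x i : derivable (fun x => \row_b foldr pd (fun x => V x 0 b) s' x) x (delta_mx 0 i).
    apply/derivable_mxP => a b; rewrite ord1.
    have -> : (fun x => (\row_b0 foldr pd (fun x => V x 0 b0) s' x) 0 b) =
      foldr pd (fun x => V x 0 b) s' by apply/funext => y; rewrite mxE.
    by have [_] := sV b s'; exact.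
  have E : foldr pd V s = fun x => \row_b foldr pd (fun x => V x 0 b) s x.
    elim: s => [|i s IH] /=; first by apply/funext => x; apply/rowP => b; rewrite mxE.
    rewrite IH; apply/funext => x; rewrite {1}/pd derive_mx//.
    apply/rowP => b; rewrite !mxE; congr ('D_ _ _ x).
    by apply/funext => y; rewrite mxE.
  by split => // x i; rewrite E.
split; last by move=> i x; exact: E.1.
rewrite E.2; apply: mx_continuous => a b.
have -> : (fun x => (\row_b0 foldr pd (fun x => V x 0 b0) s x) a b) =
  foldr pd (fun x => V x 0 b) s by apply/funext => y; rewrite mxE.
by have [] := sV b s.
Qed.

Lemma pd_row p (V : 'rV[R]_n -> 'rV[R]_p) i x : (forall b, C1 (fun x => V x 0 b)) ->
  pd i V x = \row_b pd i (fun y => V y 0 b) x.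
Proof.
move=> CV; rewrite /pd derive_mx; last first.
  apply/derivable_mxP => a b; rewrite ord1.
  exact: C1_derivable (CV b).
by apply/rowP => b; rewrite !mxE.
Qed.

End C1.

(** * Multi-indices in consecutive pairs *)

Section Pairs.
Context {K : nat}.

Lemma half_ix_subproof (u : 'I_K.*2) : (u./2 < K)%N.
Proof. by rewrite ltn_half_double. Qed.

Definition half_ix (u : 'I_K.*2) : 'I_K := Ordinal (half_ix_subproof u).

Lemma half_odd_ix (s : 'I_K) : half_ix (odd_ix s) = s.
Proof. by apply: val_inj; rewrite /= doubleK. Qed.

Lemma half_even_ix (s : 'I_K) : half_ix (even_ix s) = s.
Proof. by apply: val_inj; rewrite /= uphalf_double. Qed.

Lemma odd_odd_ix (s : 'I_K) : odd (odd_ix s) = false.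
Proof. by rewrite /= odd_double. Qed.

Lemma odd_even_ix (s : 'I_K) : odd (even_ix s) = true.
Proof. by rewrite /= odd_double. Qed.

Lemma odd_ix_inj : injective (@odd_ix K).
Proof. by move=> s t /(congr1 half_ix); rewrite !half_odd_ix. Qed.

Lemma even_ix_inj : injective (@even_ix K).
Proof. by move=> s t /(congr1 half_ix); rewrite !half_even_ix. Qed.

Lemma odd_even_neq (s t : 'I_K) : odd_ix s != even_ix t.
Proof.
apply/eqP => /(congr1 (fun u : 'I_K.*2 => odd u)).
by rewrite odd_odd_ix odd_even_ix.
Qed.

Lemma even_odd_neq (s t : 'I_K) : even_ix s != odd_ix t.
Proof. by rewrite eq_sym odd_even_neq. Qed.

Lemma big_pairs_cond (R : Type) (idx : R) (op : Monoid.com_law idx) (P : pred 'I_K.*2) (F : 'I_K.*2 -> R) :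
  \big[op/idx]_(t < K.*2 | P t) F t =
  \big[op/idx]_(s < K) op (if P (odd_ix s) then F (odd_ix s) else idx)
                          (if P (even_ix s) then F (even_ix s) else idx).
Proof.
pose p2 (x : 'I_K * bool) := if x.2 then even_ix x.1 else odd_ix x.1.
have p2b : bijective p2.
  apply: inj_card_bij; last by rewrite card_prod card_bool !card_ord muln2.
  move=> [s b] [s' b']; rewrite /p2 /=.
  have ho (b1 : bool) s1 : half_ix (if b1 then even_ix s1 else odd_ix s1) = s1.
    by case: b1; rewrite ?half_odd_ix ?half_even_ix.
  have oo (b1 : bool) s1 : odd (if b1 then even_ix s1 else odd_ix s1) = b1.
    by case: b1; rewrite /= odd_double.
  move=> e; congr pair.
    by have := congr1 half_ix e; rewrite !ho.
  by have := congr1 (fun u : 'I_K.*2 => odd u) e; rewrite !oo.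
rewrite big_mkcond (reindex p2) /=; last exact: onW_bij.
rewrite -(pair_bigA _ (fun s b => if P (p2 (s, b)) then F (p2 (s, b)) else idx)) /=.
by apply: eq_bigr => s _; rewrite big_bool /= Monoid.mulmC.
Qed.

Lemma prod_pairs (R : comNzRingType) (F : 'I_K.*2 -> R) :
  \prod_(t < K.*2) F t = \prod_(s < K) (F (odd_ix s) * F (even_ix s)).
Proof. by rewrite big_pairs_cond. Qed.

End Pairs.

(** * Sums over tuples rewritten as sums over functions on the slots *)

Section MultiIndexSums.
Context {R : realType} {n : nat}.

Local Notation ix N := {ffun 'I_N -> 'I_n}.

Lemma sum_tuple_ffun N (F : N.-tuple 'I_n -> R) :
  \sum_a F a = \sum_(a : ix N) F [tuple a t | t < N].
Proof.
rewrite (reindex (fun a : ix N => [tuple a t | t < N])) //=.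
apply: onW_bij; exists (fun t : N.-tuple 'I_n => [ffun u => tnth t u]).
  by move=> a; apply/ffunP => u; rewrite ffunE tnth_mktuple.
by move=> t; apply: eq_from_tnth => u; rewrite tnth_mktuple ffunE.
Qed.

Lemma gdelta_ffun N (a b : ix N) :
  gdelta [tuple a t | t < N] [tuple b t | t < N] = kdet a b :> R.
Proof.
rewrite /gdelta /kdet /gram; congr (\det _); apply/matrixP => i j.
by rewrite !mxE !tnth_mktuple.
Qed.

Definition widen_slot {k} (u : 'I_k.*2) : 'I_(k.+1).*2 :=
  widen_ord (leq_trans (leqnSn _) (leqnSn _)) u.

Lemma widen_odd_ix k (s : 'I_k) :
  widen_slot (odd_ix s) = odd_ix (widen_ord (leqnSn k) s).
Proof. exact: val_inj. Qed.

Lemma widen_even_ix k (s : 'I_k) :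
  widen_slot (even_ix s) = even_ix (widen_ord (leqnSn k) s).
Proof. exact: val_inj. Qed.

Local Notation slast k := (even_ix (ord_max : 'I_k.+1)).
Local Notation sprev k := (odd_ix (ord_max : 'I_k.+1)).

Lemma slotP k (u : 'I_(k.+1).*2) :
  [\/ exists w : 'I_k.*2, u = widen_slot w, u = sprev k | u = slast k].
Proof.
have h : (nat_of_ord u < k.*2.+2)%N := ltn_ord u.
move: h; rewrite ltnS leq_eqVlt => /predU1P[e|].
  by apply: Or33; exact: val_inj.
rewrite ltnS leq_eqVlt => /predU1P[e|h]; first by apply: Or32; exact: val_inj.
by apply: Or31; exists (Ordinal h); exact: val_inj.
Qed.

(** [gb_tensor] and [newton] keep their last pair of indices apart from the tuple; here that pair
    becomes the last two slots, on the same footing as the others. *)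
Lemma sum_tuple_split k (F : (k.*2).-tuple 'I_n -> 'I_n -> 'I_n -> R) :
  \sum_a \sum_i \sum_j F a i j =
  \sum_(A : ix (k.+1).*2)
     F [tuple A (widen_slot u) | u < k.*2] (A (sprev k)) (A (slast k)).
Proof.
under eq_bigr do rewrite pair_bigA.
rewrite pair_bigA /=.
pose h (A : ix (k.+1).*2) : (k.*2).-tuple 'I_n * ('I_n * 'I_n) :=
  ([tuple A (widen_slot u) | u < k.*2], (A (sprev k), A (slast k))).
rewrite (reindex h) //=.
have hi : injective h.
  move=> A B e; apply/ffunP => u.
  have [e2 e3] : A (sprev k) = B (sprev k) /\ A (slast k) = B (slast k).
    by case: e.
  case: (slotP u) => [[w ->]|->|->] //.
  have {}e := congr1 fst e.
  by have := congr1 (fun t => tnth t w) e; rewrite !tnth_mktuple.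
apply/onW_bij/inj_card_bij => //.
rewrite card_ffun !card_prod card_tuple !card_ord doubleS !expnS.
by rewrite mulnC mulnA.
Qed.

Lemma gdelta_split k (A B : ix (k.+1).*2) :
  gdelta [tuple of [tuple A (widen_slot u) | u < k.*2] ++ [:: A (sprev k); A (slast k)]]
         [tuple of [tuple B (widen_slot u) | u < k.*2] ++ [:: B (sprev k); B (slast k)]]
  = kdet A B :> R.
Proof.
have nthE (C : ix (k.+1).*2) (u : 'I_(k.+1).*2) x0 :
    nth x0 ([tuple C (widen_slot u) | u < k.*2] ++ [:: C (sprev k); C (slast k)]) u
    = C u.
  rewrite nth_cat size_tuple; case: (slotP u) => [[w ->]|->|->].
  - have := tnth_mktuple (fun u => C (widen_slot u)) w.
    by rewrite (tnth_nth x0) /= ltn_ord.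
  - by rewrite /= ltnn subnn.
  - by rewrite /= ltnNge leqnSn /= subSnn.
pose x0 := A (sprev k).
set a := [tuple of _ ++ _]; set b := [tuple of _ ++ _].
have gE : gdelta a b = \det (\matrix_(i < k.*2 + 2, j < k.*2 + 2)
    (nth x0 a i == nth x0 b j)%:R) :> R.
  by rewrite /gdelta; congr (\det _); apply/matrixP => i j; rewrite !mxE !(tnth_nth x0).
(* The sizes [k.*2 + 2] and [(k.+1).*2] are equal but not convertible. With entries given by
   functions of natural numbers the size can be rewritten. *)
have castE N1 N2 (F : nat -> nat -> R) : N1 = N2 ->
   \det (\matrix_(i < N1, j < N1) F i j) = \det (\matrix_(i < N2, j < N2) F i j).
  by move=> ->.
rewrite gE (castE _ (k.+1).*2 (fun i j => (nth x0 a i == nth x0 b j)%:R)); last first.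
  by rewrite addn2.
rewrite /kdet /gram; congr (\det _); apply/matrixP => i j.
by rewrite !mxE /a /b /= !nthE.
Qed.

(* The two terms of the Gauss equation contribute equally once antisymmetrized. *)
Lemma sum_gauss_pairs K (W : 'I_K -> 'I_n -> 'I_n -> 'I_n -> 'I_n -> R)
    (Phi : ix K.*2 -> ix K.*2 -> R) (r : seq 'I_K) :
  uniq r ->
  (forall s, s \in r -> forall a b, Phi a (swapf b (odd_ix s) (even_ix s)) = Phi a b) ->
  \sum_(a : ix K.*2) \sum_(b : ix K.*2) kdet a b * (\prod_(s <- r)
     (W s (a (odd_ix s)) (b (odd_ix s)) (a (even_ix s)) (b (even_ix s)) -
      W s (a (odd_ix s)) (b (even_ix s)) (a (even_ix s)) (b (odd_ix s))) * Phi a b) =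
  2 ^+ size r * \sum_(a : ix K.*2) \sum_(b : ix K.*2) kdet a b * (\prod_(s <- r)
     W s (a (odd_ix s)) (b (odd_ix s)) (a (even_ix s)) (b (even_ix s)) * Phi a b).
Proof.
elim: r Phi => [|s r IH] Phi /=.
  by move=> _ _; rewrite mul1r; apply: eq_bigr => a _; apply: eq_bigr => b _; rewrite !big_nil.
move=> /andP[sr ur] PhiE.
have swE (c : ix K.*2) t u v w : t != v -> t != w -> u != v -> u != w ->
    swapf c v w t = c t /\ swapf c v w u = c u.
  by move=> *; rewrite !ffunE !tpermD// eq_sym.
pose W1 (a b : ix K.*2) := W s (a (odd_ix s)) (b (odd_ix s)) (a (even_ix s)) (b (even_ix s)).
pose W2 (a b : ix K.*2) := W s (a (odd_ix s)) (b (even_ix s)) (a (even_ix s)) (b (odd_ix s)).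
(* The factor of the head pair joins the spectator [Phi]: swaps inside the other pairs do not touch
   it, so the induction hypothesis applies. *)
pose Phi' a b := (W1 a b - W2 a b) * Phi a b.
transitivity (\sum_(a : ix K.*2) \sum_(b : ix K.*2) kdet a b * (\prod_(s <- r)
     (W s (a (odd_ix s)) (b (odd_ix s)) (a (even_ix s)) (b (even_ix s)) -
      W s (a (odd_ix s)) (b (even_ix s)) (a (even_ix s)) (b (odd_ix s))) * Phi' a b)).
  apply: eq_bigr => a _; apply: eq_bigr => b _; rewrite big_cons /Phi' -/(W1 a b) -/(W2 a b).
  by ring.
rewrite IH//; last first.
  move=> t tr a b; rewrite /Phi' PhiE ?inE ?tr ?orbT//; congr (_ * _).
  have ts : s != t by apply: contraNneq sr => ->.
  have ts1 : odd_ix s != odd_ix t by rewrite (inj_eq odd_ix_inj).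
  have ts2 : even_ix s != even_ix t by rewrite (inj_eq even_ix_inj).
  have [e1 e2] := swE b (odd_ix s) (even_ix s) (odd_ix t) (even_ix t) ts1
    (odd_even_neq _ _) (even_odd_neq _ _) ts2.
  by rewrite /W1 /W2 e1 e2.
rewrite exprSr -mulrA; congr (_ * _).
pose Z (V : ix K.*2 -> ix K.*2 -> R) := \sum_(a : ix K.*2) \sum_(b : ix K.*2) kdet a b * (\prod_(s <- r)
     W s (a (odd_ix s)) (b (odd_ix s)) (a (even_ix s)) (b (even_ix s)) * (V a b * Phi a b)).
have ZE : Z W2 = - Z W1.
  rewrite /Z -sumrN; apply: eq_bigr => a _.
  rewrite (reindex_inj (inv_inj (swapfK (odd_ix s) (even_ix s)))) /= -sumrN.
  apply: eq_bigr => b _; rewrite {1}/kdet gram_swapr ?odd_even_neq// mulNr; congr (- (_ * (_ * _))).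
    rewrite big_seq_cond [RHS]big_seq_cond; apply: eq_bigr => t /andP[tr _].
    have ts : t != s by apply: contraNneq sr => <-.
    have ts1 : odd_ix t != odd_ix s by rewrite (inj_eq odd_ix_inj).
    have ts2 : even_ix t != even_ix s by rewrite (inj_eq even_ix_inj).
    have [-> ->] // := swE b (odd_ix t) (even_ix t) (odd_ix s) (even_ix s) ts1
      (odd_even_neq _ _) (even_odd_neq _ _) ts2.
  by rewrite PhiE ?inE ?eqxx// /W1 /W2 !ffunE tpermL tpermR.
transitivity (Z W1 - Z W2).
  rewrite /Z -sumrB; apply: eq_bigr => a _; rewrite -sumrB; apply: eq_bigr => b _.
  by rewrite /Phi'; ring.
rewrite ZE opprK -mulr2n -[LHS]mulr_natl; congr (_ * _).
by apply: eq_bigr => a _; apply: eq_bigr => b _; rewrite big_cons /W1; ring.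
Qed.

End MultiIndexSums.

(** * The induced metric and the Gauss equation *)

Lemma det_1_rank1 (R : comNzRingType) p (u : 'cV[R]_p) (v : 'rV[R]_p) :
  \det (1%:M + u *m v) = 1 + (v *m u) 0 0.
Proof.
have E : block_mx 1%:M 0 v (1%:M : 'M[R]_1) *m block_mx (1%:M + u *m v) u 0 1%:M *m
    block_mx 1%:M 0 (- v) 1%:M = block_mx 1%:M u 0 (1%:M + v *m u).
  rewrite !mulmx_block !mulmx0 !mul0mx !mul1mx !mulmx1 !addr0 ?add0r.
  congr block_mx; first by rewrite mulmxN addrK.
    by rewrite mulmxN mulmxDl mulmxDr mul1mx mulmx1 mulmxA [_ + v]addrC subrr.
  by rewrite addrC.
have := congr1 (fun M => \det M) E.
rewrite !det_mulmx !det_lblock !det_ublock !det1 !mul1r !mulr1 => ->.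
by rewrite det_mx11 !mxE eqxx.
Qed.

Lemma dotvE (R : realType) p (u v : 'rV[R]_p) : dotv u v = (u *m v^T) 0 0.
Proof. by rewrite mxE; apply: eq_bigr => k _; rewrite mxE. Qed.

Lemma dotv_ge0 (R : realType) p (u : 'rV[R]_p) : 0 <= dotv u u.
Proof. by apply: sumr_ge0 => k _; rewrite -expr2 sqr_ge0. Qed.

Lemma dotvC (R : realType) p (u v : 'rV[R]_p) : dotv u v = dotv v u.
Proof. by apply: eq_bigr => k _; rewrite mulrC. Qed.

Section GraphMetric.
Context {R : realType} {n : nat} {I : Type}.
Variable d : I -> 'rV[R]_n.

(** The metric of a graph with gradients [d al]. The sum runs over a list so that the gradients can
    be added one at a time, as rank-one updates. *)
Definition gmx (r : seq I) : 'M[R]_n := 1%:M + \sum_(al <- r) (d al)^T *m d al.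

Lemma gmx_sym r : (gmx r)^T = gmx r.
Proof.
rewrite /gmx linearD /= trmx1 linear_sum /=; congr (_ + _).
by apply: eq_bigr => al _; rewrite trmx_mul trmxK.
Qed.

Lemma gmx_quad r (v : 'rV[R]_n) :
  (v *m gmx r *m v^T) 0 0 = dotv v v + \sum_(al <- r) dotv v (d al) ^+ 2.
Proof.
rewrite /gmx mulmxDr mulmxDl mulmx1 mxE -dotvE; congr (_ + _).
rewrite mulmx_sumr mulmx_suml summxE; apply: eq_bigr => al _.
rewrite mulmxA -mulmxA mxE big_ord1 -dotvE expr2; congr (_ * _).
by rewrite -dotvE dotvC.
Qed.

Lemma gmx_quad_ge r (v : 'rV[R]_n) : dotv v v <= (v *m gmx r *m v^T) 0 0.
Proof. by rewrite gmx_quad lerDl sumr_ge0// => al _; rewrite sqr_ge0. Qed.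

(** Each rank-one update multiplies the determinant by 1 + d g^-1 d^T, and d g^-1 d^T = w g w^T >= 0
    for w = d g^-1. *)
Lemma det_gmx_ge1 r : 1 <= \det (gmx r).
Proof.
elim: r => [|al r IH]; first by rewrite /gmx big_nil addr0 det1.
have u : gmx r \in unitmx.
  by rewrite unitmxE unitfE gt_eqF// (lt_le_trans ltr01 IH).
have -> : gmx (al :: r) = gmx r *m (1%:M + (invmx (gmx r) *m (d al)^T) *m d al).
  rewrite mulmxDr mulmx1 !mulmxA mulmxV// mul1mx /gmx big_cons.
  by rewrite addrA addrAC.
rewrite det_mulmx det_1_rank1 mulmxA.
set w := d al *m invmx (gmx r).
have -> : w *m (d al)^T = w *m gmx r *m w^T.
  by rewrite -[in RHS]mulmxA /w trmx_mul trmx_inv gmx_sym mulKVmx.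
rewrite (le_trans IH)// ler_peMr ?(le_trans ler01 IH)// lerDl.
by rewrite (le_trans (dotv_ge0 w))// gmx_quad_ge.
Qed.

Lemma gmx_unit r : gmx r \in unitmx.
Proof.
by rewrite unitmxE unitfE gt_eqF// (lt_le_trans ltr01 (det_gmx_ge1 r)).
Qed.

(** Since g >= 1, the row [v] of index [i] of g^-1 satisfies |v|^2 <= v g v^T = v_i. Hence 0 <= v_i
    <= 1, and every entry has v_j^2 <= |v|^2 <= 1. This bounds the inverse metric everywhere,
    without recourse to asymptotics. *)
Lemma gmx_inv_le1 r i j : `|invmx (gmx r) i j| <= 1.
Proof.
set G := invmx _; pose v := row i G.
have q : (v *m gmx r *m v^T) 0 0 = v 0 i.
  rewrite /v -row_mul mulVmx ?gmx_unit// mxE.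
  rewrite (bigD1 i) //= !mxE eqxx mul1r big1 ?addr0// => k ki.
  by rewrite !mxE eq_sym (negPf ki) mul0r.
have h1 : dotv v v <= v 0 i by rewrite -q gmx_quad_ge.
have h2 k : v 0 k ^+ 2 <= dotv v v.
  rewrite /dotv (bigD1 k) //= -expr2 lerDl sumr_ge0// => l _.
  by rewrite -expr2 sqr_ge0.
have v0 : 0 <= v 0 i by rewrite (le_trans _ h1)// dotv_ge0.
have v1 : v 0 i <= 1.
  have := le_trans (h2 i) h1; rewrite expr2; move: v0; rewrite le_eqVlt => /predU1P[<-//|vp].
  by rewrite ger_pMl.
have : v 0 j ^+ 2 <= 1 by rewrite (le_trans (h2 j))// (le_trans h1).
by rewrite -[v 0 j ^+ 2]real_normK ?num_real// expr_le1// /v mxE.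
Qed.

End GraphMetric.

Section SmoothGraph.
Context {R : realType} {n m : nat}.
Variable f : 'rV[R]_n -> 'rV[R]_m.
Hypothesis f_smooth : smooth f.
Implicit Types (x : 'rV[R]_n) (i j k l a b c d e : 'I_n) (al be ga mu nu : 'I_m).

Local Notation f1 al i := (pd i (fcomp f al)).
Local Notation f2 al i j := (pd i (pd j (fcomp f al))).
Local Notation f3 al i j k := (pd i (pd j (pd k (fcomp f al)))).

Lemma foldr_pd_fcomp al s :
  foldr pd (fcomp f al) s = fun x => foldr pd f s x 0 al.
Proof.
elim: s => [//|i s IH] /=; rewrite IH; apply/funext => x.
rewrite /pd derive_mx; first by rewrite mxE.
by have [_ ds] := f_smooth s; exact: ds.
Qed.

Lemma fcomp_smooth al : smooth (fcomp f al).
Proof.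
move=> s; rewrite foldr_pd_fcomp; have [cs ds] := f_smooth s; split.
  move=> x; exact: (@continuous_comp _ _ _ (foldr pd f s) (fun M : 'rV[R]_m => M 0 al) x (cs x) (@coord_continuous R 1 m 0 al _)).
by move=> i x; move/derivable_mxP : (ds i x) => /(_ 0 al).
Qed.

Lemma f0_C1 al : C1 (fcomp f al).
Proof. exact/smooth_C1/fcomp_smooth. Qed.

Lemma f1_C1 al i : C1 (f1 al i).
Proof. exact/smooth_C1/smooth_pd/fcomp_smooth. Qed.

Lemma f2_C1 al i j : C1 (f2 al i j).
Proof. exact/smooth_C1/smooth_pd/smooth_pd/fcomp_smooth. Qed.

Lemma f2_sym al i j x : f2 al i j x = f2 al j i x.
Proof. by apply: pd_comm => [|k]; [exact: f0_C1|exact: f1_C1]. Qed.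

Lemma f3_sym12 al i j k x : f3 al i j k x = f3 al j i k x.
Proof. by apply: pd_comm => [|l]; [exact: f1_C1|exact: f2_C1]. Qed.

Local Opaque pd.

Definition grad al x : 'rV[R]_n := \row_i f1 al i x.
Definition hess al x : 'M[R]_n := \matrix_(i, j) f2 al i j x.

Lemma hess_sym al x : (hess al x)^T = hess al x.
Proof. by apply/matrixP => i j; rewrite !mxE f2_sym. Qed.

Lemma metricE x : metric f x = gmx (grad ^~ x) (index_enum 'I_m).
Proof.
apply/matrixP => i j; rewrite !mxE summxE; congr (_ + _).
by apply: eq_bigr => al _; rewrite mxE big_ord1 !mxE.
Qed.

Lemma metric_unit x : metric f x \in unitmx.
Proof. by rewrite metricE gmx_unit. Qed.

Lemma metric_sym x : (metric f x)^T = metric f x.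
Proof. by rewrite metricE gmx_sym. Qed.

Lemma imetric_sym x : (imetric f x)^T = imetric f x.
Proof. by rewrite /imetric trmx_inv metric_sym. Qed.

Lemma imetric_le1 x i j : `|imetric f x i j| <= 1.
Proof. by rewrite /imetric metricE gmx_inv_le1. Qed.

Lemma Gdet_ge1 x : 1 <= Gdet f x.
Proof. by rewrite /Gdet metricE det_gmx_ge1. Qed.

Lemma metric_C1 i j : C1 (fun x => metric f x i j).
Proof.
have -> : (fun x => metric f x i j) =
    fun x => (i == j)%:R + \sum_al f1 al i x * f1 al j x.
  by apply/funext => x; rewrite mxE.
apply: C1D; first exact: C1_cst.
by apply: C1_sum => al; apply: C1M; exact: f1_C1.
Qed.

Lemma imetric_C1 i j : C1 (fun x => imetric f x i j).
Proof. exact: C1_invmx metric_unit metric_C1 i j. Qed.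

Lemma dmetricE i j k x :
  dmetric f i j k x = \sum_al (f2 al k i x * f1 al j x + f1 al i x * f2 al k j x).
Proof.
rewrite /dmetric.
have -> : (fun y => metric f y i j) =
    fun x => (i == j)%:R + \sum_al f1 al i x * f1 al j x.
  by apply/funext => y; rewrite mxE.
have C al : C1 (fun x => f1 al i x * f1 al j x) by apply: C1M; exact: f1_C1.
rewrite pdD; [|exact: C1_cst|exact: C1_sum].
rewrite pd_cst add0r pd_sum//; apply: eq_bigr => al _.
by rewrite pdM//; exact: f1_C1.
Qed.

Definition Yv al x : 'rV[R]_n := grad al x *m imetric f x.
Definition hm al x : 'M[R]_n := hess al x *m imetric f x.
(** The Gram matrix of the normal parts of the e_al ([nvec_nvec]), a frame dual to eta; hence [km]
    is [hm] with its normal index raised. *)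
Definition Um al be x : R := (al == be)%:R - \sum_c f1 al c x * Yv be x 0 c.
Definition km al x : 'M[R]_n := \sum_be Um al be x *: hm be x.
(** The coefficients of the normal connection in the frame eta: the normal part of d_i eta_mu is the
    sum over [al] of [vv i mu al] eta_al. *)
Definition vv i mu al x : R := \sum_l f2 mu i l x * Yv al x 0 l.

Lemma Um_sym al be x : Um al be x = Um be al x.
Proof.
rewrite /Um eq_sym; congr (_ - _).
have E ga nu : \sum_c f1 ga c x * Yv nu x 0 c =
    (grad ga x *m imetric f x *m (grad nu x)^T) 0 0.
  rewrite -mulmxA mxE; apply: eq_bigr => c _; rewrite !mxE; congr (_ * _).
  by apply: eq_bigr => k _; rewrite !mxE mulrC -[in LHS]imetric_sym mxE.
have T (M : 'M[R]_1) : M 0 0 = M^T 0 0 by rewrite mxE.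
by rewrite !E [LHS]T !trmx_mul trmxK imetric_sym mulmxA.
Qed.

Lemma lower_raise (u : 'rV[R]_n) x :
  (u *m imetric f x) *m metric f x = u.
Proof. by rewrite -mulmxA mulVmx ?metric_unit// mulmx1. Qed.

Lemma raise_lower (u : 'rV[R]_n) x :
  (u *m metric f x) *m imetric f x = u.
Proof. by rewrite -mulmxA mulmxV ?metric_unit// mulmx1. Qed.

Lemma raise_C1 (u : 'I_n -> 'rV[R]_n -> R) c : (forall e, C1 (u e)) ->
  C1 (fun y => \sum_e u e y * imetric f y e c).
Proof. by move=> Cu; apply: C1_sum => e; apply: C1M => //; exact: imetric_C1. Qed.

(* Differentiate [A_c g_cd = u_d] rather than the inverse metric. *)
Lemma pd_raise (u : 'I_n -> 'rV[R]_n -> R) i c x : (forall e, C1 (u e)) ->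
  let A c y := \sum_e u e y * imetric f y e c in
  pd i (A c) x = \sum_d (pd i (u d) x - \sum_b A b x * dmetric f b d i x)
     * imetric f x d c.
Proof.
move=> Cu A.
have CA b : C1 (A b) by exact: raise_C1.
have AE y d : u d y = \sum_b A b y * metric f y b d.
  have := lower_raise (\row_e u e y) y.
  move/(congr1 (fun M : 'rV[R]_n => M 0 d)); rewrite !mxE => <-.
  apply: eq_bigr => b _; congr (_ * _); rewrite mxE; apply: eq_bigr => e _.
  by rewrite mxE.
have E d : pd i (u d) x = \sum_b (pd i (A b) x * metric f x b d + A b x * dmetric f b d i x).
  rewrite (_ : u d = fun y => \sum_b A b y * metric f y b d); last first.
    by apply/funext => y; exact: AE.
  rewrite pd_sum => [|b]; last by apply: C1M => //; exact: metric_C1.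
  by apply: eq_bigr => b _; rewrite pdM//; exact: metric_C1.
have := raise_lower (\row_b pd i (A b) x) x.
move/(congr1 (fun M : 'rV[R]_n => M 0 c)); rewrite [RHS]mxE => <-.
rewrite mxE; apply: eq_bigr => d _; congr (_ * _).
rewrite E -sumrB mxE; apply: eq_bigr => b _.
by rewrite mxE addrK.
Qed.

Lemma Yv_sumE al c x : Yv al x 0 c = \sum_e f1 al e x * imetric f x e c.
Proof. by rewrite mxE; apply: eq_bigr => e _; rewrite mxE. Qed.

Lemma hm_sumE al a c x : hm al x a c = \sum_e f2 al a e x * imetric f x e c.
Proof. by rewrite mxE; apply: eq_bigr => e _; rewrite mxE. Qed.

Lemma Yv_C1 al c : C1 (fun x => Yv al x 0 c).
Proof.
under eq_fun do rewrite Yv_sumE.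
by apply: raise_C1 => e; exact: f1_C1.
Qed.

Lemma hm_C1 al a c : C1 (fun x => hm al x a c).
Proof.
under eq_fun do rewrite hm_sumE.
by apply: raise_C1 => e; exact: f2_C1.
Qed.

Lemma km_sumE al a c x : km al x a c = \sum_be Um al be x * hm be x a c.
Proof. by rewrite summxE; apply: eq_bigr => be _; rewrite mxE. Qed.

Lemma Um_C1 al be : C1 (Um al be).
Proof.
apply: C1B; first exact: C1_cst.
by apply: C1_sum => c; apply: C1M; [exact: f1_C1|exact: Yv_C1].
Qed.

Lemma km_C1 al a c : C1 (fun x => km al x a c).
Proof.
under eq_fun do rewrite km_sumE.
by apply: C1_sum => be; apply: C1M; [exact: Um_C1|exact: hm_C1].
Qed.

(* The correction term of [pd_raise] when [A] is contracted with the
   derivative of the metric. *)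
Lemma contract_dmetric (A : 'I_n -> R) i c x :
  \sum_d (\sum_b A b * dmetric f b d i x) * imetric f x d c =
  \sum_mu ((\sum_b A b * f2 mu i b x) * Yv mu x 0 c +
           (\sum_b A b * f1 mu b x) * hm mu x i c).
Proof.
transitivity (\sum_d \sum_mu ((\sum_b A b * f2 mu i b x) * f1 mu d x +
   (\sum_b A b * f1 mu b x) * f2 mu i d x) * imetric f x d c).
  apply: eq_bigr => d _; rewrite -big_distrl; congr (_ * _) => /=.
  transitivity (\sum_b \sum_mu (A b * f2 mu i b x * f1 mu d x + A b * f1 mu b x * f2 mu i d x)).
    apply: eq_bigr => b _; rewrite dmetricE big_distrr; apply: eq_bigr => mu _ /=.
    by rewrite mulrDr !mulrA.
  rewrite exchange_big; apply: eq_bigr => mu _ /=.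
  by rewrite big_split !big_distrl.
rewrite exchange_big; apply: eq_bigr => mu _ /=.
rewrite Yv_sumE hm_sumE !big_distrr /= -big_split; apply: eq_bigr => d _ /=.
by ring.
Qed.

Lemma YvU al mu x : \sum_b Yv al x 0 b * f1 mu b x = (al == mu)%:R - Um al mu x.
Proof.
rewrite Um_sym /Um eq_sym opprB addrC subrK.
by apply: eq_bigr => b _; rewrite mulrC.
Qed.

(** Differentiating f^al_e leaves h_al; the derivative of the metric subtracts the sum of (delta -
    U) h by [YvU], which turns h_al into k_al. *)
Lemma pd_Yv i al c x :
  pd i (fun y => Yv al y 0 c) x = km al x i c - \sum_mu vv i mu al x * Yv mu x 0 c.
Proof.
rewrite (_ : (fun y => _) = fun y => \sum_e f1 al e y * imetric f y e c); last first.
  by apply/funext => y; rewrite Yv_sumE.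
rewrite (@pd_raise (fun e => f1 al e)) => [|e]; last exact: f1_C1.
under eq_bigr do rewrite mulrBl.
rewrite sumrB contract_dmetric -hm_sumE big_split /=.
have -> : \sum_mu (\sum_b (\sum_e f1 al e x * imetric f x e b) * f2 mu i b x) * Yv mu x 0 c
   = \sum_mu vv i mu al x * Yv mu x 0 c.
  apply: eq_bigr => mu _; congr (_ * _); apply: eq_bigr => b _.
  by rewrite -Yv_sumE mulrC.
rewrite opprD addrCA addrC; congr (_ + _).
transitivity (hm al x i c - \sum_mu ((al == mu)%:R - Um al mu x) * hm mu x i c).
  congr (_ - _); apply: eq_bigr => mu _; congr (_ * _); rewrite -YvU.
  by apply: eq_bigr => b _; rewrite -Yv_sumE.
rewrite km_sumE; under eq_bigr do rewrite mulrBl.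
rewrite sumrB (bigD1 al) //= eqxx mul1r big1 ?addr0; first by rewrite opprB addrC subrK.
by move=> mu mal; rewrite eq_sym (negPf mal) mul0r.
Qed.

Lemma pd_fcomp_Yv al mu i x :
  \sum_c f1 al c x * km mu x i c = \sum_ga Um mu ga x * vv i ga al x.
Proof.
under eq_bigr do rewrite km_sumE big_distrr /=.
rewrite exchange_big; apply: eq_bigr => ga _ /=.
transitivity (Um mu ga x * \sum_c hm ga x i c * f1 al c x).
  rewrite big_distrr; apply: eq_bigr => c _ /=.
  by rewrite mulrC mulrA.
congr (_ * _); rewrite /vv.
under eq_bigr do rewrite hm_sumE big_distrl /=.
rewrite exchange_big; apply: eq_bigr => l _ /=.
rewrite Yv_sumE big_distrr; apply: eq_bigr => c _ /=.
rewrite -mulrA; congr (_ * _); rewrite mulrC; congr (_ * _).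
by rewrite -[in RHS]imetric_sym mxE.
Qed.

(** Compatibility of the normal connection with the Gram matrix of the dual frame. *)
Lemma pd_Um i al be x :
  pd i (Um al be) x = - \sum_ga (Um be ga x * vv i ga al x + Um al ga x * vv i ga be x).
Proof.
have C c : C1 (fun y => f1 al c y * Yv be y 0 c).
  by apply: C1M; [exact: f1_C1|exact: Yv_C1].
have -> : Um al be = fun y => (al == be)%:R - \sum_c f1 al c y * Yv be y 0 c by [].
rewrite pdB; [|exact: C1_cst|exact: C1_sum].
rewrite pd_cst sub0r pd_sum//; congr (- _).
transitivity (\sum_c (f2 al i c x * Yv be x 0 c + f1 al c x *
    (km be x i c - \sum_mu vv i mu be x * Yv mu x 0 c))).
  apply: eq_bigr => c _; rewrite pdM; [|exact: f1_C1|exact: Yv_C1].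
  by rewrite pd_Yv.
rewrite big_split /= -/(vv i al be x).
under eq_bigr do rewrite mulrBr.
rewrite sumrB pd_fcomp_Yv.
have -> : \sum_c f1 al c x * (\sum_mu vv i mu be x * Yv mu x 0 c) =
    vv i al be x - \sum_mu Um al mu x * vv i mu be x.
  under eq_bigr do rewrite big_distrr /=.
  rewrite exchange_big /=.
  transitivity (\sum_mu ((mu == al)%:R - Um al mu x) * vv i mu be x).
    apply: eq_bigr => mu _; rewrite Um_sym -YvU big_distrl; apply: eq_bigr => c _ /=.
    by rewrite mulrCA mulrC; congr (_ * _); exact: mulrC.
  under [LHS]eq_bigr do rewrite mulrBl.
  rewrite sumrB (bigD1 al) //= eqxx mul1r big1 ?addr0// => mu /negPf ->.
  by rewrite mul0r.
by rewrite big_split /=; set A := \sum_(_ | _) _; set B := \sum_(_ | _) _; ring.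
Qed.

Lemma contract_hm al a mu x : \sum_b hm al x a b * f1 mu b x = vv a al mu x.
Proof.
rewrite /vv; under eq_bigr do rewrite hm_sumE big_distrl /=.
rewrite exchange_big; apply: eq_bigr => l _ /=.
rewrite Yv_sumE big_distrr; apply: eq_bigr => c _ /=.
rewrite -mulrA; congr (_ * _); rewrite mulrC; congr (_ * _).
by rewrite -[in RHS]imetric_sym mxE.
Qed.

(* The part of [pd i (hm be _ a c)] that is symmetric in [i] and [a]. *)
Definition hsym be i a c x : R :=
  \sum_e f3 be i a e x * imetric f x e c -
  \sum_mu (vv i be mu x * hm mu x a c + vv a be mu x * hm mu x i c).

Lemma hsymC be i a c x : hsym be i a c x = hsym be a i c x.
Proof.
apply: (congr2 (fun u v => u - v)); last by apply: eq_bigr => mu _; rewrite addrC.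
by apply: eq_bigr => e _; rewrite f3_sym12.
Qed.

(** By [christoffelE] this is the sum over b of h_a^b Gamma^c_{ib}, the correction for the upper
    index that separates a partial from a covariant derivative. It is symmetric in [i] and [a] as
    soon as the Hessians commute with respect to g. *)
Definition hleftover be i a c x : R :=
  \sum_mu (hm be x *m hess mu x) a i * Yv mu x 0 c.

Definition kleftover be i a c x : R :=
  \sum_mu (km be x *m hess mu x) a i * Yv mu x 0 c.

Lemma pd_hm i be a c x :
  pd i (fun y => hm be y a c) x =
  hsym be i a c x + \sum_mu vv i be mu x * hm mu x a c - hleftover be i a c x.
Proof.
rewrite (_ : (fun y => _) = fun y => \sum_e f2 be a e y * imetric f y e c); last first.
  by apply/funext => y; rewrite hm_sumE.
rewrite (@pd_raise (fun e => f2 be a e)) => [|e]; last exact: f2_C1.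
under eq_bigr do rewrite mulrBl.
rewrite sumrB contract_dmetric big_split /= /hsym big_split /=.
have -> : \sum_mu (\sum_b (\sum_e f2 be a e x * imetric f x e b) * f2 mu i b x) * Yv mu x 0 c
   = hleftover be i a c x.
  apply: eq_bigr => mu _; congr (_ * _); rewrite mxE; apply: eq_bigr => b _.
  by apply: (congr2 *%R); [rewrite hm_sumE|rewrite [RHS]mxE f2_sym].
have -> : \sum_mu (\sum_b (\sum_e f2 be a e x * imetric f x e b) * f1 mu b x) * hm mu x i c
   = \sum_mu vv a be mu x * hm mu x i c.
  apply: eq_bigr => mu _; congr (_ * _); rewrite -contract_hm.
  by apply: eq_bigr => b _; rewrite -hm_sumE.
set A := \sum_(_ < _) _; set B := \sum_(_ | _) _; set C := \sum_(_ | _) _.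
by move: A B C (hleftover _ _ _ _ _) => A B C D; ring.
Qed.

Lemma km_hess_sum be mu a i x :
  (km be x *m hess mu x) a i = \sum_ga Um be ga x * (hm ga x *m hess mu x) a i.
Proof.
rewrite /km mulmx_suml summxE; apply: eq_bigr => ga _.
by rewrite -scalemxAl mxE.
Qed.

Lemma kleftoverE be i a c x : kleftover be i a c x = \sum_ga Um be ga x * hleftover ga i a c x.
Proof.
rewrite /kleftover; under eq_bigr do rewrite km_hess_sum big_distrl /=.
rewrite exchange_big; apply: eq_bigr => ga _ /=.
by rewrite big_distrr; apply: eq_bigr => mu _ /=; rewrite mulrA.
Qed.

Definition ksym be i a c x : R := \sum_ga Um be ga x * hsym ga i a c x.

Lemma ksymC be i a c x : ksym be i a c x = ksym be a i c x.
Proof. by apply: eq_bigr => ga _; rewrite hsymC. Qed.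

Lemma pd_km i be a c x :
  pd i (fun y => km be y a c) x =
  ksym be i a c x - \sum_nu vv i nu be x * km nu x a c - kleftover be i a c x.
Proof.
rewrite (_ : (fun y => _) = fun y => \sum_ga Um be ga y * hm ga y a c); last first.
  by apply/funext => y; rewrite km_sumE.
have C ga : C1 (fun y => Um be ga y * hm ga y a c).
  by apply: C1M; [exact: Um_C1|exact: hm_C1].
rewrite pd_sum//.
transitivity (\sum_ga (- (\sum_nu Um ga nu x * vv i nu be x) * hm ga x a c
     - (\sum_nu Um be nu x * vv i nu ga x) * hm ga x a c
     + Um be ga x * hsym ga i a c x + Um be ga x * (\sum_mu vv i ga mu x * hm mu x a c)
     - Um be ga x * hleftover ga i a c x)).
  apply: eq_bigr => ga _; rewrite pdM; [|exact: Um_C1|exact: hm_C1].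
  rewrite pd_Um pd_hm big_split /=.
  set A := \sum_(_ | _) _; set B := \sum_(_ | _) _; set D := \sum_(_ | _) _.
  by move: A B D (hsym _ _ _ _ _) (hleftover _ _ _ _ _) (hm _ _ _ _) (Um _ _ _) => *; ring.
rewrite !big_split /= -/(ksym be i a c x) [X in _ + X = _]sumrN -kleftoverE.
have -> : \sum_ga - (\sum_nu Um ga nu x * vv i nu be x) * hm ga x a c =
    - \sum_nu vv i nu be x * km nu x a c.
  rewrite -sumrN.
  transitivity (- \sum_ga \sum_nu vv i nu be x * (Um nu ga x * hm ga x a c)).
    rewrite -sumrN; apply: eq_bigr => ga _; rewrite mulNr; congr (- _).
    rewrite big_distrl; apply: eq_bigr => nu _ /=.
    by rewrite (Um_sym ga) -mulrA mulrCA.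
  rewrite exchange_big -sumrN; apply: eq_bigr => nu _ /=.
  by rewrite km_sumE big_distrr.
have -> : \sum_ga - ((\sum_nu Um be nu x * vv i nu ga x) * hm ga x a c) =
    - \sum_ga Um be ga x * (\sum_mu vv i ga mu x * hm mu x a c).
  rewrite -sumrN.
  transitivity (- \sum_ga \sum_nu Um be nu x * (vv i nu ga x * hm ga x a c)).
    rewrite -sumrN; apply: eq_bigr => ga _; congr (- _).
    by rewrite big_distrl; apply: eq_bigr => nu _ /=; rewrite mulrA.
  rewrite exchange_big -sumrN; apply: eq_bigr => nu _ /=.
  by rewrite big_distrr.
set A := \sum_(_ | _) _; set B := \sum_(_ | _) _.
by move: A B (ksym _ _ _ _ _) (kleftover _ _ _ _ _) => *; ring.
Qed.

(** The scalar product of B_a^b and B_a'^b', see [sff_mixed_pair]. *)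
Definition pairP x a b a' b' : R := \sum_be hm be x a b * km be x a' b'.

Definition lastpair x a b b' : R := \sum_al hm al x a b * Yv al x 0 b'.

Lemma pairP_C1 a b a' b' : C1 (fun x => pairP x a b a' b').
Proof. by apply: C1_sum => be; apply: C1M; [exact: hm_C1|exact: km_C1]. Qed.

Lemma lastpair_C1 a b b' : C1 (fun x => lastpair x a b b').
Proof. by apply: C1_sum => be; apply: C1M; [exact: hm_C1|exact: Yv_C1]. Qed.

(** The normal connection preserves the scalar product: the [vv] terms of [pd_hm] and [pd_km] cancel
    after summation over the normal index ([W] below). *)
Lemma pd_pairP i a b a' b' x :
  pd i (fun y => pairP y a b a' b') x =
  (\sum_be hsym be i a b x * km be x a' b' + \sum_be hm be x a b * ksym be i a' b' x)
  - (\sum_be hleftover be i a b x * km be x a' b' + \sum_be hm be x a b * kleftover be i a' b' x).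
Proof.
have C be : C1 (fun y => hm be y a b * km be y a' b').
  by apply: C1M; [exact: hm_C1|exact: km_C1].
rewrite pd_sum//.
transitivity (\sum_be (hsym be i a b x * km be x a' b' + hm be x a b * ksym be i a' b' x
   - (hleftover be i a b x * km be x a' b' + hm be x a b * kleftover be i a' b' x)
   + (\sum_mu vv i be mu x * hm mu x a b) * km be x a' b'
   - hm be x a b * (\sum_nu vv i nu be x * km nu x a' b'))).
  apply: eq_bigr => be _; rewrite pdM; [|exact: hm_C1|exact: km_C1].
  rewrite pd_hm pd_km; set A := \sum_(_ | _) _; set B := \sum_(_ | _) _.
  move: A B (hsym _ _ _ _ _) (hleftover _ _ _ _ _) (ksym _ _ _ _ _) (kleftover _ _ _ _ _).
  by move: (hm _ _ _ _) (km _ _ _ _) => *; ring.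
have W : \sum_be (\sum_mu vv i be mu x * hm mu x a b) * km be x a' b' =
    \sum_be hm be x a b * (\sum_nu vv i nu be x * km nu x a' b').
  transitivity (\sum_be \sum_mu vv i be mu x * hm mu x a b * km be x a' b').
    by apply: eq_bigr => be _; rewrite big_distrl.
  rewrite exchange_big; apply: eq_bigr => mu _ /=; rewrite big_distrr.
  by apply: eq_bigr => be _ /=; rewrite mulrAC mulrC.
by rewrite !big_split /= !sumrN big_split /= W addrK.
Qed.

(** The derivative of Y_al produces k_al, hence a full curvature pair; this is the term from which
    L_(q) arises. The [vv] terms cancel as in [pd_pairP]. *)
Lemma pd_lastpair i a b b' x :
  pd i (fun y => lastpair y a b b') x =
  pairP x a b i b' + \sum_al hsym al i a b x * Yv al x 0 b'
  - \sum_al hleftover al i a b x * Yv al x 0 b'.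
Proof.
have C be : C1 (fun y => hm be y a b * Yv be y 0 b').
  by apply: C1M; [exact: hm_C1|exact: Yv_C1].
rewrite pd_sum//.
transitivity (\sum_be (hm be x a b * km be x i b' + hsym be i a b x * Yv be x 0 b'
   - hleftover be i a b x * Yv be x 0 b'
   + (\sum_mu vv i be mu x * hm mu x a b) * Yv be x 0 b'
   - hm be x a b * (\sum_nu vv i nu be x * Yv nu x 0 b'))).
  apply: eq_bigr => be _; rewrite pdM; [|exact: hm_C1|exact: Yv_C1].
  rewrite pd_hm pd_Yv; set A := \sum_(_ | _) _; set B := \sum_(_ | _) _.
  move: A B (hsym _ _ _ _ _) (hleftover _ _ _ _ _) (Yv be x 0 b').
  by move: (hm _ _ _ _) (km _ _ _ _) => *; ring.
have W : \sum_be (\sum_mu vv i be mu x * hm mu x a b) * Yv be x 0 b' =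
    \sum_be hm be x a b * (\sum_nu vv i nu be x * Yv nu x 0 b').
  transitivity (\sum_be \sum_mu vv i be mu x * hm mu x a b * Yv be x 0 b').
    by apply: eq_bigr => be _; rewrite big_distrl.
  rewrite exchange_big; apply: eq_bigr => mu _ /=; rewrite big_distrr.
  by apply: eq_bigr => be _ /=; rewrite mulrAC mulrC.
by rewrite !big_split /= !sumrN W addrK.
Qed.

Lemma christoffelE p i j x :
  christoffel f p i j x = \sum_al Yv al x 0 p * f2 al i j x.
Proof.
transitivity (\sum_l imetric f x p l * \sum_al f1 al l x * f2 al i j x).
  rewrite /christoffel big_distrr; apply: eq_bigr => l _ /=.
  rewrite mulrCA; congr (_ * _); rewrite !dmetricE -big_split -sumrB big_distrr.
  apply: eq_bigr => al _ /=.
  rewrite (f2_sym al j i) (f2_sym al l i) (f2_sym al l j).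
  move: (f1 al i x) (f1 al j x) (f1 al l x) (f2 al i j x) (f2 al i l x) (f2 al j l x) => *.
  by field.
under eq_bigr do rewrite big_distrr /=.
rewrite exchange_big; apply: eq_bigr => al _ /=.
rewrite Yv_sumE big_distrl; apply: eq_bigr => l _ /=.
by rewrite mulrA [imetric f x p l * _]mulrC -[in LHS]imetric_sym mxE.
Qed.

Lemma pd_christoffel k p i j x :
  pd k (christoffel f p i j) x =
  \sum_al ((km al x k p - \sum_mu vv k mu al x * Yv mu x 0 p) * f2 al i j x +
           Yv al x 0 p * f3 al k i j x).
Proof.
rewrite (_ : christoffel f p i j = fun y => \sum_al Yv al y 0 p * f2 al i j y); last first.
  by apply/funext => y; exact: christoffelE.
have C al : C1 (fun y => Yv al y 0 p * f2 al i j y).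
  by apply: C1M; [exact: Yv_C1|exact: f2_C1].
rewrite pd_sum//; apply: eq_bigr => al _.
rewrite pdM; [|exact: Yv_C1|exact: f2_C1].
by rewrite pd_Yv.
Qed.

(** Third derivatives cancel by symmetry, and the quadratic Christoffel terms cancel the [vv]
    corrections in the derivative of Y_al. *)
Lemma riemannE i j k l x :
  riemann f i j k l x = \sum_p metric f x k p *
    \sum_al (km al x i p * f2 al j l x - km al x j p * f2 al i l x).
Proof.
apply: eq_bigr => p _; congr (_ * _).
have GG i1 j1 : \sum_s christoffel f p i1 s x * christoffel f s j1 l x =
    \sum_al (\sum_mu vv i1 mu al x * Yv mu x 0 p) * f2 al j1 l x.
  transitivity (\sum_s \sum_al (\sum_mu Yv mu x 0 p * f2 mu i1 s x) * (Yv al x 0 s * f2 al j1 l x)).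
    by apply: eq_bigr => s _; rewrite !christoffelE big_distrr.
  rewrite exchange_big; apply: eq_bigr => al _ /=.
  transitivity (\sum_s \sum_mu (Yv mu x 0 p * f2 mu i1 s x * Yv al x 0 s * f2 al j1 l x)).
    apply: eq_bigr => s _; rewrite big_distrl; apply: eq_bigr => mu _ /=.
    by rewrite !mulrA.
  rewrite exchange_big big_distrl; apply: eq_bigr => mu _ /=.
  rewrite /vv !big_distrl; apply: eq_bigr => s _ /=.
  by congr (_ * _); rewrite -mulrA mulrC.
rewrite sumrB !GG !pd_christoffel -!sumrB -big_split; apply: eq_bigr => al _ /=.
rewrite (f3_sym12 al i j).
have RG (k1 k2 A B u v y t : R) :
   (k1 - A) * u + y * t - ((k2 - B) * v + y * t) + (A * u - B * v) = k1 * u - k2 * v.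
  by ring.
exact: RG.
Qed.

Lemma gauss_equation a b c d x :
  riemann_up f a b c d x = pairP x a c b d - pairP x a d b c.
Proof.
have E1 l : \sum_k imetric f x c k * riemann f a b k l x =
    \sum_al (km al x a c * f2 al b l x - km al x b c * f2 al a l x).
  pose w := \row_p \sum_al (km al x a p * f2 al b l x - km al x b p * f2 al a l x).
  have := raise_lower w x; move/(congr1 (fun M : 'rV[R]_n => M 0 c)).
  rewrite [RHS]mxE => <-; rewrite mxE; apply: eq_bigr => k _.
  rewrite mulrC; congr (_ * _); last by rewrite -[in LHS]imetric_sym mxE.
  rewrite riemannE mxE; apply: eq_bigr => p _.
  by rewrite [X in _ = X * _]mxE mulrC -[in LHS]metric_sym [X in _ * X]mxE.
transitivity (\sum_l imetric f x d l * \sum_k imetric f x c k * riemann f a b k l x).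
  rewrite /riemann_up exchange_big; apply: eq_bigr => l _ /=.
  by rewrite big_distrr; apply: eq_bigr => k _ /=; rewrite mulrCA mulrA.
under eq_bigr do rewrite E1 big_distrr /=.
rewrite exchange_big /=.
transitivity (\sum_al (km al x a c * hm al x b d - km al x b c * hm al x a d)).
  apply: eq_bigr => al _; rewrite !hm_sumE !big_distrr -sumrB; apply: eq_bigr => l _ /=.
  have -> : imetric f x d l = imetric f x l d by rewrite -[in LHS]imetric_sym mxE.
  by move: (f2 _ _ _ _) (f2 _ _ _ _) => *; ring.
rewrite sumrB; congr (_ - _); last by apply: eq_bigr => al _; rewrite mulrC.
transitivity (\sum_al \sum_be Um al be x * hm be x a c * hm al x b d).
  by apply: eq_bigr => al _; rewrite km_sumE big_distrl.
rewrite exchange_big; apply: eq_bigr => be _ /=.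
rewrite km_sumE big_distrr; apply: eq_bigr => al _ /=.
by rewrite Um_sym mulrAC mulrC mulrA.
Qed.
End SmoothGraph.

(** * Extrinsic geometry of the graph *)

Section DotProduct.
Context {R : realType}.

Lemma dotvDl p (u v w : 'rV[R]_p) : dotv (u + v) w = dotv u w + dotv v w.
Proof. by rewrite /dotv -big_split; apply: eq_bigr => k _; rewrite mxE mulrDl. Qed.

Lemma dotvZl p (c : R) (u w : 'rV[R]_p) : dotv (c *: u) w = c * dotv u w.
Proof. by rewrite /dotv big_distrr; apply: eq_bigr => k _ /=; rewrite mxE mulrA. Qed.

Lemma dotv0l p (w : 'rV[R]_p) : dotv 0 w = 0.
Proof. by rewrite /dotv big1// => k _; rewrite mxE mul0r. Qed.

Lemma dotvNl p (u w : 'rV[R]_p) : dotv (- u) w = - dotv u w.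
Proof. by rewrite -scaleN1r dotvZl mulN1r. Qed.

Lemma dotvBl p (u v w : 'rV[R]_p) : dotv (u - v) w = dotv u w - dotv v w.
Proof. by rewrite dotvDl dotvNl. Qed.

Lemma dotv_suml p I (r : seq I) (P : pred I) (F : I -> 'rV[R]_p) w :
  dotv (\sum_(i <- r | P i) F i) w = \sum_(i <- r | P i) dotv (F i) w.
Proof.
elim/big_rec2: _ => [|i y1 y2 _ <-]; first exact: dotv0l.
exact: dotvDl.
Qed.

Lemma dotv_sumr p I (r : seq I) (P : pred I) (F : I -> 'rV[R]_p) w :
  dotv w (\sum_(i <- r | P i) F i) = \sum_(i <- r | P i) dotv w (F i).
Proof. by rewrite dotvC dotv_suml; apply: eq_bigr => i _; rewrite dotvC. Qed.

Lemma dotvZr p (c : R) (u w : 'rV[R]_p) : dotv w (c *: u) = c * dotv w u.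
Proof. by rewrite dotvC dotvZl dotvC. Qed.

Lemma dotvBr p (u v w : 'rV[R]_p) : dotv w (u - v) = dotv w u - dotv w v.
Proof. by rewrite dotvC dotvBl !(dotvC w). Qed.

Lemma dotv_delta p (u : 'rV[R]_p) i : dotv u (delta_mx 0 i) = u 0 i.
Proof.
rewrite /dotv (bigD1 i) //= mxE !eqxx mulr1 big1 ?addr0// => k ki.
by rewrite mxE (negPf ki) andbF mulr0.
Qed.

Lemma dotv_row_mx p p' (u w : 'rV[R]_p) (u' w' : 'rV[R]_p') :
  dotv (row_mx u u') (row_mx w w') = dotv u w + dotv u' w'.
Proof.
rewrite /dotv big_split_ord /=; congr (_ + _); apply: eq_bigr => k _.
  by rewrite !row_mxEl.
by rewrite !row_mxEr.
Qed.

End DotProduct.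

Section Extrinsic.
Context {R : realType} {n m : nat}.
Variable f : 'rV[R]_n -> 'rV[R]_m.
Hypothesis f_smooth : smooth f.
Implicit Types (x : 'rV[R]_n) (i j k l a b c d e : 'I_n) (al be ga mu nu : 'I_m).

Local Notation f1 al i := (pd i (fcomp f al)).
Local Notation f2 al i j := (pd i (pd j (fcomp f al))).
Local Notation Y := (Yv f).
Local Notation h := (hm f).
Local Notation U := (Um f).
Local Notation g1 := (grad f).

Lemma tangent_tangent i j x : dotv (tangent f i x) (tangent f j x) = metric f x i j.
Proof.
rewrite /tangent dotv_row_mx dotv_delta !mxE eqxx; congr (_ + _).
  by rewrite eq_sym.
by apply: eq_bigr => al _; rewrite !mxE.
Qed.

Lemma evec_tangent al j x : dotv (evec al) (tangent f j x) = f1 al j x.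
Proof. by rewrite /evec /tangent dotv_row_mx dotv0l add0r dotvC dotv_delta mxE. Qed.

Lemma eta_tangent al j x : dotv (Defs.eta f al x) (tangent f j x) = 0.
Proof.
rewrite /Defs.eta /tangent dotv_row_mx dotv_delta dotvC dotv_delta !mxE.
by rewrite addrC subrr.
Qed.

Lemma evec_eta al be x : dotv (@evec R n m al) (Defs.eta f be x) = (al == be)%:R.
Proof. by rewrite /evec /Defs.eta dotv_row_mx dotv0l add0r dotv_delta mxE eqxx eq_sym. Qed.

Lemma evec_evec al be : dotv (@evec R n m al) (evec be) = (al == be)%:R.
Proof. by rewrite /evec dotv_row_mx dotv0l add0r dotv_delta mxE eqxx eq_sym. Qed.

Lemma tan_coordE x v :
  tan_coord f x v = (\row_j dotv v (tangent f j x)) *m imetric f x.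
Proof.
apply/rowP => i; rewrite !mxE; apply: eq_bigr => j _.
by rewrite mxE mulrC -[in LHS]imetric_sym// mxE.
Qed.

Lemma tan_coord_evec al x : tan_coord f x (evec al) = Y al x.
Proof.
rewrite tan_coordE; congr (_ *m _); apply/rowP => j.
by rewrite !mxE evec_tangent.
Qed.

Lemma of_coord_tangent (X : 'rV[R]_n) j x :
  dotv (of_coord f x X) (tangent f j x) = (X *m metric f x) 0 j.
Proof.
rewrite dotv_suml mxE; apply: eq_bigr => i _.
by rewrite dotvZl tangent_tangent.
Qed.

Lemma of_coord_eta (X : 'rV[R]_n) al x : dotv (of_coord f x X) (Defs.eta f al x) = 0.
Proof. by rewrite dotv_suml big1// => i _; rewrite dotvZl dotvC eta_tangent mulr0. Qed.

Lemma normal_part_tangent v j x : dotv (normal_part f x v) (tangent f j x) = 0.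
Proof.
rewrite dotvBl of_coord_tangent tan_coordE lower_raise// mxE.
by rewrite subrr.
Qed.

Lemma normal_part_of_coord v X x : dotv (normal_part f x v) (of_coord f x X) = 0.
Proof.
by rewrite dotv_sumr big1// => i _; rewrite dotvZr normal_part_tangent mulr0.
Qed.

Lemma normal_part_eta v al x : dotv (normal_part f x v) (Defs.eta f al x) = dotv v (Defs.eta f al x).
Proof. by rewrite dotvBl of_coord_eta subr0. Qed.

(** The normal frame dual to eta, see [nvec_eta]. It is the frame in which the components of B are
    the Hessians of the f^al. *)
Definition nvec al x : 'rV[R]_(n + m) := normal_part f x (evec al).

Lemma nvec_nvec al be x : dotv (nvec al x) (nvec be x) = U al be x.
Proof.
rewrite {2}/nvec /normal_part dotvBr normal_part_of_coord subr0.
rewrite /nvec /normal_part dotvBl evec_evec tan_coord_evec dotv_suml.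
have -> : \sum_i dotv (Y al x 0 i *: tangent f i x) (evec be) =
    \sum_i Y al x 0 i * f1 be i x.
  by apply: eq_bigr => i _; rewrite dotvZl dotvC evec_tangent.
by rewrite YvU// opprB addrC subrK.
Qed.

Lemma nvec_eta al be x : dotv (nvec al x) (Defs.eta f be x) = (al == be)%:R.
Proof. by rewrite normal_part_eta evec_eta. Qed.

Lemma normal_part_sum (c : 'I_m -> R) (v : 'I_m -> 'rV[R]_(n + m)) x :
  normal_part f x (\sum_al c al *: v al) = \sum_al c al *: normal_part f x (v al).
Proof.
rewrite /normal_part; under [RHS]eq_bigr do rewrite scalerBr.
rewrite sumrB; congr (_ - _).
have -> : tan_coord f x (\sum_al c al *: v al) = \sum_al c al *: tan_coord f x (v al).
  rewrite tan_coordE; under [RHS]eq_bigr do rewrite tan_coordE scalemxAl.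
  rewrite -mulmx_suml; congr (_ *m _); apply/rowP => j; rewrite mxE summxE dotv_suml.
  by apply: eq_bigr => al _; rewrite dotvZl !mxE.
rewrite /of_coord; under [RHS]eq_bigr do rewrite scaler_sumr.
rewrite exchange_big; apply: eq_bigr => i _ /=.
rewrite summxE scaler_suml; apply: eq_bigr => al _.
by rewrite mxE scalerA.
Qed.

Lemma pd_tangent i j x :
  pd i (tangent f j) x = \sum_al f2 al i j x *: evec al.
Proof.
have E (a : 'I_1) (b : 'I_(n + m)) : (fun y => tangent f j y a b) =
    match fintype.split b with
    | inl u => fun=> (delta_mx 0 j : 'rV[R]_n) a u
    | inr v => f1 v j
    end.
  apply/funext => y; rewrite /tangent mxE; case: fintype.split => // v.
  by rewrite mxE.
have D : derivable (tangent f j) x (delta_mx 0 i).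
  apply/derivable_mxP => a b; rewrite E; case: fintype.split => u.
    exact: derivable_cst.
  exact/C1_derivable/f1_C1.
rewrite /pd derive_mx//; apply/rowP => b; rewrite mxE E summxE.
rewrite (eq_bigr (fun al => f2 al i j x * (evec al) 0 b)); last first.
  by move=> al _; rewrite mxE.
case: (fintype.splitP b) => u e.
  rewrite derive_cst big1// => al _; rewrite /evec.
  have -> : b = lshift m u by exact: val_inj.
  by rewrite row_mxEl mxE mulr0.
have -> : b = rshift n u by exact: val_inj.
have ev al : (@evec R n m al) 0 (rshift n u) = (u == al)%:R.
  by rewrite /evec row_mxEr mxE eqxx.
have sumE (F : 'I_m -> R) : \sum_al F al * (u == al)%:R = F u.
  rewrite (bigD1 u) //= eqxx mulr1 big1 ?addr0// => al au.
  by rewrite eq_sym (negPf au) mulr0.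
apply: etrans (etrans (esym (sumE (fun al => f2 al i j x))) _); first by [].
by apply: eq_bigr => al _; congr (_ * _); rewrite ev.
Qed.

Lemma sffE i j x : sff f i j x = \sum_al f2 al i j x *: nvec al x.
Proof. by rewrite /sff pd_tangent normal_part_sum. Qed.

Lemma sff_mixedE a b x : sff_mixed f a b x = \sum_al h al x a b *: nvec al x.
Proof.
rewrite /sff_mixed; under eq_bigr do rewrite sffE scaler_sumr.
rewrite exchange_big; apply: eq_bigr => al _ /=.
rewrite hm_sumE// scaler_suml; apply: eq_bigr => c _.
by rewrite scalerA mulrC -[in LHS]imetric_sym// mxE.
Qed.

Lemma sff_mixed_pair a b c d x :
  dotv (sff_mixed f a b x) (sff_mixed f c d x) = pairP f x a b c d.
Proof.
rewrite !sff_mixedE dotv_suml; apply: eq_bigr => al _.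
rewrite dotvZl dotv_sumr km_sumE//; congr (_ * _); apply: eq_bigr => be _.
by rewrite dotvZr nvec_nvec mulrC.
Qed.

Lemma sff_mixed_eta a b al x : dotv (sff_mixed f a b x) (Defs.eta f al x) = h al x a b.
Proof.
rewrite sff_mixedE dotv_suml (bigD1 al) //= dotvZl nvec_eta eqxx mulr1.
by rewrite big1 ?addr0// => be ba; rewrite dotvZl nvec_eta (negPf ba) mulr0.
Qed.

Lemma sff_eta i j al x : dotv (sff f i j x) (Defs.eta f al x) = f2 al i j x.
Proof.
rewrite sffE dotv_suml (bigD1 al) //= dotvZl nvec_eta eqxx mulr1.
by rewrite big1 ?addr0// => be ba; rewrite dotvZl nvec_eta (negPf ba) mulr0.
Qed.

Lemma shapeE al x : Defs.shape f al x = h al x.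
Proof.
apply/matrixP => i j; rewrite mxE hm_sumE//; apply: eq_bigr => k _.
by rewrite sff_eta.
Qed.

Lemma of_coord_Yv (X : 'rV[R]_n) be x :
  dotv (of_coord f x X) (of_coord f x (Y be x)) = (X *m (g1 be x)^T) 0 0.
Proof.
rewrite dotv_sumr; under eq_bigr do rewrite dotvZr of_coord_tangent.
transitivity ((X *m metric f x *m (Y be x)^T) 0 0).
  by rewrite [RHS]mxE; apply: eq_bigr => i _; rewrite !mxE mulrC.
by rewrite /Yv trmx_mul imetric_sym// -mulmxA mulKVmx// metric_unit.
Qed.

End Extrinsic.

(** * Divergence of the Gauss-Bonnet vector field *)

Section Divergence.
Context {R : realType} {n m k0 : nat}.
Variable f : 'rV[R]_n -> 'rV[R]_m.
Hypothesis f_smooth : smooth f.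
Implicit Types (x : 'rV[R]_n) (i j k l : 'I_n) (al be ga mu nu : 'I_m).

Local Notation f1 al i := (pd i (fcomp f al)).
Local Notation f2 al i j := (pd i (pd j (fcomp f al))).
Local Notation Y := (Yv f).
Local Notation h := (hm f).
Local Notation kk := (km f).
Local Notation q := k0.+1.
Local Notation ix := {ffun 'I_(k0.+1).*2 -> 'I_n}.
Local Notation L := (even_ix (ord_max : 'I_k0.+1)).
Local Notation P := (odd_ix (ord_max : 'I_k0.+1)).
Local Opaque pd imetric.
Implicit Types (a b : ix) (s : 'I_k0.+1) (t u w : 'I_(k0.+1).*2) (F : ix -> ix -> R).

Definition fpair x s a b : R :=
  pairP f x (a (odd_ix s)) (b (odd_ix s)) (a (even_ix s)) (b (even_ix s)).

(** The row index [a L] is left free: it carries the component of the vector field, later the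
    direction of differentiation. *)
Definition flast x a b : R := lastpair f x (a P) (b P) (b L).

Definition fslot x s a b : R := if s == ord_max then flast x a b else fpair x s a b.

Definition ksum (F : ix -> ix -> R) : R :=
  \sum_(a : ix) \sum_(b : ix) kdet a b * F a b.

Lemma eq_ksum F1 F2 : (forall a b, F1 a b = F2 a b) -> ksum F1 = ksum F2.
Proof. by move=> E; apply: eq_bigr => a _; apply: eq_bigr => b _; rewrite E. Qed.

Lemma ksumD F1 F2 : ksum (fun a b => F1 a b + F2 a b) = ksum F1 + ksum F2.
Proof.
rewrite /ksum -big_split; apply: eq_bigr => a _ /=.
by rewrite -big_split; apply: eq_bigr => b _ /=; rewrite mulrDr.
Qed.

Lemma ksumN F : ksum (fun a b => - F a b) = - ksum F.
Proof.
rewrite /ksum -sumrN; apply: eq_bigr => a _.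
by rewrite -sumrN; apply: eq_bigr => b _; rewrite mulrN.
Qed.

Lemma ksumB F1 F2 : ksum (fun a b => F1 a b - F2 a b) = ksum F1 - ksum F2.
Proof. by rewrite ksumD ksumN. Qed.

Lemma ksum_sum I (r : seq I) (Q : pred I) (F : I -> ix -> ix -> R) :
  ksum (fun a b => \sum_(i <- r | Q i) F i a b) = \sum_(i <- r | Q i) ksum (F i).
Proof.
elim: r => [|i r IH].
  rewrite big_nil; rewrite /ksum big1// => a _; rewrite big1// => b _.
  by rewrite big_nil mulr0.
rewrite big_cons -IH; case: (boolP (Q i)) => Qi.
  by rewrite -ksumD; apply: eq_ksum => a b; rewrite big_cons Qi.
by apply: eq_ksum => a b; rewrite big_cons (negPf Qi).
Qed.

Lemma ksum_antisym F t u : t != u ->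
  (forall a b, F (swapf a t u) b = F a b) -> ksum F = 0.
Proof. exact: sum_gram_antisym. Qed.

Lemma ksum_antisymr F t u : t != u ->
  (forall a b, F a (swapf b t u) = F a b) -> ksum F = 0.
Proof. exact: sum_gram_antisymr. Qed.

Lemma ksum_swap2 F t u : t != u ->
  ksum F = ksum (fun a b => F (swapf a t u) (swapf b t u)).
Proof.
move=> tu; rewrite /ksum (reindex_inj (inv_inj (swapfK t u))) /=.
apply: eq_bigr => a _; rewrite (reindex_inj (inv_inj (swapfK t u))) /=.
by apply: eq_bigr => b _; rewrite {1}/kdet gram_swapl// gram_swapr// opprK.
Qed.

Lemma swapf_other a t u w : w != t -> w != u -> swapf a t u w = a w.
Proof. by move=> wt wu; rewrite ffunE tpermD// eq_sym. Qed.

Lemma swapf_l a t u : swapf a t u t = a u.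
Proof. by rewrite ffunE tpermL. Qed.

Lemma swapf_r a t u : swapf a t u u = a t.
Proof. by rewrite ffunE tpermR. Qed.

Lemma gauss_bonnetE x :
  gauss_bonnet f q x = ksum (fun a b => \prod_s fpair x s a b).
Proof.
rewrite /gauss_bonnet sum_tuple_ffun.
have -> : \sum_(a : ix) \sum_(b : q.*2.-tuple 'I_n) gdelta [tuple a t | t < q.*2] b *
      riemann_prod f [tuple a t | t < q.*2] b x =
    ksum (fun a b => \prod_(s <- index_enum 'I_q)
     (pairP f x (a (odd_ix s)) (b (odd_ix s)) (a (even_ix s)) (b (even_ix s)) -
      pairP f x (a (odd_ix s)) (b (even_ix s)) (a (even_ix s)) (b (odd_ix s))) * 1).
  apply: eq_bigr => a _; rewrite sum_tuple_ffun; apply: eq_bigr => b _.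
  rewrite gdelta_ffun mulr1; congr (_ * _); apply: eq_bigr => s _.
  by rewrite !tnth_mktuple gauss_equation.
rewrite /ksum (@sum_gauss_pairs R n q (fun _ => pairP f x) (fun _ _ => 1)) ?index_enum_uniq//.
have -> : size (index_enum 'I_q) = q.
  by rewrite -[RHS]card_ord cardT enumT.
rewrite mulrA mulVf ?mul1r; last by rewrite expf_neq0// pnatr_eq0.
by apply: eq_ksum => a b; rewrite mulr1.
Qed.

Definition gb_field i x : R :=
  \sum_j \sum_k \sum_l gb_tensor f q i j k l x * dmetric f j k l x.

Definition gb_contract x j c d : R :=
  \sum_k \sum_l imetric f x c k * imetric f x d l * dmetric f j k l x.

(** The first summand is the last pair of the vector field. The second is symmetric in [c] and [d],
    two columns of the delta, and will drop out. *)
Lemma gb_contractE x j c d :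
  gb_contract x j c d = \sum_al (h al x j d * Y al x 0 c +
    f1 al j x * \sum_k \sum_l imetric f x c k * imetric f x d l * f2 al l k x).
Proof.
have Gs i' j' : imetric f x i' j' = imetric f x j' i'.
  by rewrite -[in LHS]imetric_sym// mxE.
rewrite /gb_contract.
transitivity (\sum_k \sum_l \sum_al (f2 al j l x * imetric f x l d * (f1 al k x * imetric f x k c)
   + f1 al j x * (imetric f x c k * imetric f x d l * f2 al l k x))).
  apply: eq_bigr => k _; apply: eq_bigr => l _; rewrite dmetricE// big_distrr.
  apply: eq_bigr => al _ /=; rewrite (f2_sym f_smooth al l j) (Gs l) (Gs k).
  move: (f2 _ _ _ _) (f2 _ _ _ _) (f1 _ _ _) (f1 _ _ _) => *; ring.
under eq_bigr do rewrite exchange_big /=.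
rewrite exchange_big; apply: eq_bigr => al _ /=.
under eq_bigr do rewrite big_split /=.
rewrite big_split /=; congr (_ + _).
  rewrite exchange_big hm_sumE// big_distrl; apply: eq_bigr => l _ /=.
  by rewrite Yv_sumE// big_distrr.
by rewrite big_distrr; apply: eq_bigr => k _ /=; rewrite big_distrr.
Qed.

Lemma big_ord_max_split (F : 'I_k0.+1 -> R) :
  \prod_(s | s != ord_max) F s = \prod_(s < k0) F (widen_ord (leqnSn k0) s).
Proof.
rewrite big_mkcond big_ord_recr /= eqxx mulr1; apply: eq_bigr => s _.
case: eqP => // /(congr1 val) /= e; have := ltn_ord s.
by rewrite e ltnn.
Qed.

Lemma riemann_prod_split a b x :
  riemann_prod f [tuple a (widen_slot u) | u < k0.*2] [tuple b (widen_slot u) | u < k0.*2] x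
  = \prod_(s | s != ord_max)
     (pairP f x (a (odd_ix s)) (b (odd_ix s)) (a (even_ix s)) (b (even_ix s)) -
      pairP f x (a (odd_ix s)) (b (even_ix s)) (a (even_ix s)) (b (odd_ix s))).
Proof.
rewrite (big_ord_max_split (fun s => _ - _)); apply: eq_bigr => s _.
by rewrite !tnth_mktuple !widen_odd_ix !widen_even_ix gauss_equation.
Qed.

Lemma fpair_swap_last x s a b : s != ord_max ->
  (fpair x s (swapf a P L) b = fpair x s a b) * (fpair x s a (swapf b P L) = fpair x s a b).
Proof.
move=> sm; rewrite /fpair.
have [e1 e2] : odd_ix s != P /\ even_ix s != L.
  by rewrite (inj_eq (@odd_ix_inj _)) (inj_eq (@even_ix_inj _)).
by split; rewrite !swapf_other// ?odd_even_neq// even_odd_neq.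
Qed.

(** Of the factor 2^-q, the q - 1 Gauss pairs absorb 2^(q-1), each because its two terms contribute
    equally; 1/2 remains. *)
Lemma gb_fieldE i x :
  gb_field i x = 2^-1 * ksum (fun a b => (a L == i)%:R * \prod_s fslot x s a b).
Proof.
pose Rp a b := \prod_(s | s != ord_max)
     (pairP f x (a (odd_ix s)) (b (odd_ix s)) (a (even_ix s)) (b (even_ix s)) -
      pairP f x (a (odd_ix s)) (b (even_ix s)) (a (even_ix s)) (b (odd_ix s))).
have E1 : gb_field i x = (2 ^+ q)^-1 *
    ksum (fun a b => (a P == i)%:R * (Rp a b * gb_contract x (a L) (b P) (b L))).
  pose T (a : k0.*2.-tuple 'I_n) i' j (b : k0.*2.-tuple 'I_n) c d : R :=
    gdelta [tuple of a ++ [:: i'; j]] [tuple of b ++ [:: c; d]] * riemann_prod f a b x.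
  (* The fixed index [i] is made a summation index [i'] with a delta, so that [sum_tuple_split] can
     absorb the last pair. *)
  transitivity ((2 ^+ q)^-1 * \sum_(a : k0.*2.-tuple 'I_n) \sum_i' \sum_j
    \sum_(b : k0.*2.-tuple 'I_n) \sum_c \sum_d
      (i' == i)%:R * (T a i' j b c d * gb_contract x j c d)).
    rewrite /gb_field.
    transitivity (\sum_j (2 ^+ q)^-1 * \sum_(a : k0.*2.-tuple 'I_n) \sum_(b : k0.*2.-tuple 'I_n) \sum_c \sum_d
       T a i j b c d * gb_contract x j c d).
      apply: eq_bigr => j _.
      transitivity (\sum_k \sum_l (2 ^+ q)^-1 * \sum_(a : k0.*2.-tuple 'I_n) \sum_(b : k0.*2.-tuple 'I_n) \sum_c \sum_d
         T a i j b c d * (imetric f x c k * imetric f x d l * dmetric f j k l x)).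
        apply: eq_bigr => k _; apply: eq_bigr => l _.
        rewrite /gb_tensor -mulrA; congr (_ * _); rewrite big_distrl; apply: eq_bigr => a _ /=.
        rewrite big_distrl; apply: eq_bigr => b _ /=.
        rewrite big_distrl; apply: eq_bigr => c _ /=.
        rewrite big_distrl; apply: eq_bigr => d _ /=.
        by rewrite /T !mulrA.
      under eq_bigr do rewrite -big_distrr /=.
      rewrite -big_distrr /=; congr (_ * _).
      under eq_bigr do rewrite exchange_big /=.
      rewrite exchange_big /=; apply: eq_bigr => a _.
      under eq_bigr do rewrite exchange_big /=.
      rewrite exchange_big /=; apply: eq_bigr => b _.
      under eq_bigr do rewrite exchange_big /=.
      rewrite exchange_big /=; apply: eq_bigr => c _.
      under eq_bigr do rewrite exchange_big /=.
      rewrite exchange_big /=; apply: eq_bigr => d _.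
      rewrite /gb_contract big_distrr; apply: eq_bigr => k _ /=.
      by rewrite big_distrr.
    rewrite -big_distrr /=; congr (_ * _).
    rewrite exchange_big; apply: eq_bigr => a _ /=.
    rewrite [RHS](bigD1 i) //= [X in _ = _ + X]big1 ?addr0; last first.
      move=> i' /negPf i'i; rewrite big1// => j _; rewrite big1// => b _.
      by rewrite big1// => c _; rewrite big1// => d _; rewrite i'i mul0r.
    apply: eq_bigr => j _; apply: eq_bigr => b _; apply: eq_bigr => c _.
    by apply: eq_bigr => d _; rewrite eqxx mul1r.
  congr (_ * _); rewrite sum_tuple_split; apply: eq_bigr => a _.
  rewrite sum_tuple_split; apply: eq_bigr => b _.
  rewrite /T gdelta_split riemann_prod_split.
  by rewrite mulrCA -mulrA; congr (_ * _); rewrite mulrCA mulrA.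
have PL : P != L by rewrite odd_even_neq.
have RpS : (forall a b, Rp (swapf a P L) b = Rp a b) *
           (forall a b, Rp a (swapf b P L) = Rp a b).
  split=> a b; apply: eq_bigr => s sm.
    have [e1 e2] : odd_ix s != P /\ even_ix s != L.
      by rewrite (inj_eq (@odd_ix_inj _)) (inj_eq (@even_ix_inj _)).
    by rewrite !swapf_other// ?odd_even_neq// even_odd_neq.
  have [e1 e2] : odd_ix s != P /\ even_ix s != L.
    by rewrite (inj_eq (@odd_ix_inj _)) (inj_eq (@even_ix_inj _)).
  by rewrite !swapf_other// ?odd_even_neq// even_odd_neq.
(* In P_(q) the index i comes before j. Exchanging rows and columns of the last pair together costs
   no sign and moves i to row [L]. *)
rewrite E1 (ksum_swap2 _ PL).
under eq_ksum => a b do rewrite RpS.1 RpS.2 !swapf_l !swapf_r.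
have -> : ksum (fun a b => (a L == i)%:R * (Rp a b * gb_contract x (a P) (b L) (b P))) =
    ksum (fun a b => Rp a b * ((a L == i)%:R * flast x a b)).
  (* The part of [gb_contractE] that is symmetric in the columns [P] and [L]. *)
  pose S a b := (a L == i)%:R * Rp a b * \sum_al f1 al (a P) x *
     \sum_k \sum_l imetric f x (b L) k * imetric f x (b P) l * f2 al l k x.
  have S0 : ksum S = 0.
    apply: (ksum_antisymr PL) => a b; rewrite /S RpS.2 swapf_l swapf_r; congr (_ * _).
    apply: eq_bigr => al _; congr (_ * _); rewrite exchange_big.
    apply: eq_bigr => k _; apply: eq_bigr => l _ /=.
    by rewrite (mulrC (imetric _ _ _ _)) f2_sym.
  rewrite -[RHS]addr0 -S0 -ksumD; apply: eq_ksum => a b.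
  rewrite /S gb_contractE big_split /= mulrDr mulrDr mulrA.
  by apply: (congr2 +%R); [rewrite -mulrA mulrCA | rewrite mulrA].
have E2 : ksum (fun a b => Rp a b * ((a L == i)%:R * flast x a b)) =
   2 ^+ k0 * ksum (fun a b => (\prod_(s | s != ord_max) fpair x s a b) *
                              ((a L == i)%:R * flast x a b)).
  pose r := [seq s <- index_enum 'I_k0.+1 | s != ord_max].
  have rs : size r = k0.
    rewrite /r size_filter.
    have := count_predC (pred1 (ord_max : 'I_k0.+1)) (index_enum 'I_k0.+1).
    rewrite (count_uniq_mem _ (index_enum_uniq _)) mem_index_enum.
    have -> : size (index_enum 'I_k0.+1) = k0.+1.
      by rewrite -[RHS]card_ord cardT enumT.
    by rewrite add1n => -[].
  have := @sum_gauss_pairs R n q (fun _ => pairP f x)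
     (fun a b => (a L == i)%:R * flast x a b) r.
  rewrite rs => E.
  transitivity (ksum (fun a b => \prod_(s <- r) (pairP f x (a (odd_ix s)) (b (odd_ix s)) (a (even_ix s)) (b (even_ix s)) -
      pairP f x (a (odd_ix s)) (b (even_ix s)) (a (even_ix s)) (b (odd_ix s))) * ((a L == i)%:R * flast x a b))).
    by apply: eq_ksum => a b; rewrite /r big_filter.
  rewrite /ksum E.
  - by congr (_ * _); apply: eq_ksum => a b; rewrite /r big_filter.
  - by rewrite /r filter_uniq// index_enum_uniq.
  - move=> s; rewrite /r mem_filter => /andP[sm _] a b; rewrite /flast.
    have [e1 e2] : P != odd_ix s /\ L != even_ix s.
      by split; rewrite eq_sym ?(inj_eq (@odd_ix_inj _)) ?(inj_eq (@even_ix_inj _)).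
    by rewrite !swapf_other// ?odd_even_neq// even_odd_neq.
rewrite E2 mulrA exprS invfM divfK; last by rewrite expf_neq0// pnatr_eq0.
congr (_ * _); apply: eq_ksum => a b.
rewrite [in RHS](bigD1 ord_max) //= {1}/fslot eqxx.
have -> : \prod_(s | s != ord_max) fslot x s a b =
          \prod_(s | s != ord_max) fpair x s a b.
  by apply: eq_bigr => s sm; rewrite /fslot (negPf sm).
by rewrite mulrC mulrA.
Qed.

Lemma fslot_C1 s a b : C1 (fun x => fslot x s a b).
Proof.
rewrite /fslot; case: (s == ord_max).
  exact: lastpair_C1.
exact: pairP_C1.
Qed.

Lemma prod_fslot_C1 a b : C1 (fun x => \prod_s fslot x s a b).
Proof. by apply: C1_prod => s; exact: fslot_C1. Qed.

Lemma gb_field_C1 i : C1 (gb_field i).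
Proof.
have -> : gb_field i = fun x => 2^-1 * \sum_(a : ix) \sum_(b : ix)
    kdet a b * ((a L == i)%:R * \prod_s fslot x s a b).
  by apply/funext => x; exact: gb_fieldE.
apply: C1M; first exact: C1_cst.
apply: C1_sum => a; apply: C1_sum => b; apply: C1M; first exact: C1_cst.
by apply: C1M; [exact: C1_cst|exact: prod_fslot_C1].
Qed.

Definition leftover_pair x s a b : R :=
  \sum_be hleftover f be (a L) (a (odd_ix s)) (b (odd_ix s)) x *
          kk be x (a (even_ix s)) (b (even_ix s)) +
  \sum_be h be x (a (odd_ix s)) (b (odd_ix s)) *
          kleftover f be (a L) (a (even_ix s)) (b (even_ix s)) x.

Definition leftover_last x a b : R :=
  \sum_al hleftover f al (a L) (a P) (b P) x * Y al x 0 (b L).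

Definition leftover x s a b : R :=
  if s == ord_max then leftover_last x a b else leftover_pair x s a b.

Definition other_slots x s a b : R := \prod_(l | l != s) fslot x l a b.

Lemma other_slots_swap x s a b t : half_ix t = s -> s != ord_max ->
  other_slots x s (swapf a t L) b = other_slots x s a b.
Proof.
move=> ts sm; apply: eq_bigr => l ls; rewrite /fslot.
have lt (l' : 'I_k0.+1) : l' != s -> (odd_ix l' != t) /\ (even_ix l' != t).
  move=> l's; split; apply: contraNneq l's => /(congr1 half_ix);
    by rewrite ts ?half_odd_ix ?half_even_ix => ->.
case: eqP => [lm|/eqP lm].
  rewrite /flast swapf_other ?odd_even_neq//.
  by have [] := lt ord_max; rewrite // eq_sym.
have [l1 l2] := lt _ ls.
rewrite /fpair !swapf_other// ?odd_even_neq//.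
by rewrite (inj_eq (@even_ix_inj _)).
Qed.

Lemma other_slots_max_swap x a b : other_slots x ord_max (swapf a P L) b = other_slots x ord_max a b.
Proof.
apply: eq_bigr => l lm; rewrite /fslot (negPf lm).
by rewrite (fpair_swap_last x a b lm).1.
Qed.

(** The derivative is taken in the direction of row [a L]. Its [hsym] and [ksym] parts are symmetric
    in that row and the row of the differentiated factor, so the delta kills them. Only the last
    slot contains Y, whose derivative completes the product of curvature pairs. *)
Lemma ksum_pd_slot x s :
  ksum (fun a b => pd (a L) (fun y => fslot y s a b) x * other_slots x s a b) =
  (if s == ord_max then gauss_bonnet f q x else 0) -
  ksum (fun a b => leftover x s a b * other_slots x s a b).
Proof.
rewrite /leftover /fslot; case: (eqVneq s ord_max) => [->|sm].
  rewrite gauss_bonnetE.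
  pose S a b := (\sum_al hsym f al (a L) (a P) (b P) x * Y al x 0 (b L)) * other_slots x ord_max a b.
  have S0 : ksum S = 0.
    apply: (@ksum_antisym _ P L) => [|a b]; first by rewrite odd_even_neq.
    rewrite /S other_slots_max_swap swapf_l swapf_r; congr (_ * _).
    by apply: eq_bigr => al _; rewrite hsymC.
  rewrite -[in RHS](addr0 (ksum (fun a b => \prod_s _))) -S0 -ksumD -ksumB.
  apply: eq_ksum => a b; rewrite pd_lastpair//.
  rewrite [in RHS](bigD1 ord_max) //= -/(fpair x ord_max a b).
  have -> : \prod_(s' | s' != ord_max) fpair x s' a b = other_slots x ord_max a b.
    by apply: eq_bigr => l lm; rewrite /fslot (negPf lm).
  by rewrite mulrBl mulrDl.
rewrite sub0r.
pose S1 a b := (\sum_be hsym f be (a L) (a (odd_ix s)) (b (odd_ix s)) x *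
          kk be x (a (even_ix s)) (b (even_ix s))) * other_slots x s a b.
pose S2 a b := (\sum_be h be x (a (odd_ix s)) (b (odd_ix s)) *
          ksym f be (a L) (a (even_ix s)) (b (even_ix s)) x) * other_slots x s a b.
have eL : even_ix s != L by rewrite (inj_eq (@even_ix_inj _)).
have S10 : ksum S1 = 0.
  apply: (@ksum_antisym _ (odd_ix s) L) => [|a b]; first by rewrite odd_even_neq.
  rewrite /S1 other_slots_swap ?half_odd_ix// swapf_l swapf_r; congr (_ * _).
  apply: eq_bigr => be _; rewrite hsymC// swapf_other// even_odd_neq//.
have S20 : ksum S2 = 0.
  apply: (@ksum_antisym _ (even_ix s) L) => [//|a b].
  rewrite /S2 other_slots_swap ?half_even_ix// swapf_l swapf_r; congr (_ * _).
  apply: eq_bigr => be _; rewrite ksymC// swapf_other// odd_even_neq//.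
rewrite -[RHS]add0r -S20 -[X in X + _]add0r -{1}S10 -ksumN -!ksumD.
apply: eq_ksum => a b; rewrite /fpair pd_pairP//.
by rewrite /S1 /S2 mulrBl mulrDl -/(leftover_pair x s a b).
Qed.

Lemma gb_field_divergence x :
  \sum_i pd i (gb_field i) x = 2^-1 * (gauss_bonnet f q x -
    \sum_s ksum (fun a b => leftover x s a b * other_slots x s a b)).
Proof.
transitivity (2^-1 * ksum (fun a b => pd (a L) (fun y => \prod_s fslot y s a b) x)).
  have C a b i : C1 (fun y => kdet a b * ((a L == i)%:R * \prod_s fslot y s a b)).
    apply: C1M; first exact: C1_cst.
    by apply: C1M; [exact: C1_cst|exact: prod_fslot_C1].
  transitivity (\sum_i 2^-1 * \sum_(a : ix) \sum_(b : ix) kdet a b *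
      ((a L == i)%:R * pd i (fun y => \prod_s fslot y s a b) x)).
    apply: eq_bigr => i _.
    have -> : gb_field i = fun x => 2^-1 * \sum_(a : ix) \sum_(b : ix)
        kdet a b * ((a L == i)%:R * \prod_s fslot x s a b).
      by apply/funext => y; exact: gb_fieldE.
    rewrite pdZ; last by apply: C1_sum => a; exact: C1_sum.
    congr (_ * _); rewrite pd_sum => [|a]; last exact: C1_sum.
    apply: eq_bigr => a _; rewrite pd_sum//; apply: eq_bigr => b _.
    rewrite pdZ; last by apply: C1M; [exact: C1_cst|exact: prod_fslot_C1].
    by rewrite pdZ//; exact: prod_fslot_C1.
  rewrite -big_distrr /=; congr (_ * _).
  rewrite exchange_big; apply: eq_bigr => a _ /=.
  rewrite exchange_big; apply: eq_bigr => b _ /=.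
  rewrite -big_distrr /=; congr (_ * _).
  rewrite (bigD1 (a L)) //= eqxx mul1r big1 ?addr0// => i ia.
  by rewrite eq_sym (negPf ia) mul0r.
congr (_ * _).
transitivity (\sum_s ksum (fun a b => pd (a L) (fun y => fslot y s a b) x * other_slots x s a b)).
  rewrite -ksum_sum; apply: eq_ksum => a b.
  by rewrite pd_prod => [|s]; last exact: fslot_C1.
under eq_bigr do rewrite ksum_pd_slot.
rewrite sumrB; congr (_ - _).
rewrite (bigD1 ord_max) //= eqxx big1 ?addr0// => s sm.
by rewrite (negPf sm).
Qed.

End Divergence.

(** * The commutator term *)

Section Commutator.
Context {R : realType} {n m k0 : nat}.
Variable f : 'rV[R]_n -> 'rV[R]_m.
Hypothesis f_smooth : smooth f.
Implicit Types (x : 'rV[R]_n) (i j k l : 'I_n) (al be ga mu nu : 'I_m).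

Local Notation f1 al i := (pd i (fcomp f al)).
Local Notation f2 al i j := (pd i (pd j (fcomp f al))).
Local Notation Y := (Yv f).
Local Notation h := (hm f).
Local Notation kk := (km f).
Local Notation g1 := (grad f).
Local Notation H := (hess f).
Local Notation q := k0.+1.
Local Notation ix := {ffun 'I_(k0.+1).*2 -> 'I_n}.
Local Notation L := (even_ix (ord_max : 'I_k0.+1)).
Local Notation P := (odd_ix (ord_max : 'I_k0.+1)).
Local Notation lab := {ffun 'I_k0.+1 -> 'I_m}.
Local Opaque pd imetric.
Implicit Types (a b : ix) (s : 'I_k0.+1) (t u w : 'I_(k0.+1).*2) (F : ix -> ix -> R).

Definition fpairs x a b : R := \prod_(s | s != ord_max) fpair f x s a b.

Lemma newton_compE al x i j :
  ((q.*2.-1)`!)%:R * newton_comp f q al x i j =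
  ksum (fun a b => (a L == j)%:R * ((b L == i)%:R * (fpairs x a b * h al x (a P) (b P)))).
Proof.
have f0 : ((q.*2.-1)`!)%:R != 0 :> R by rewrite pnatr_eq0 -lt0n fact_gt0.
rewrite mxE /newton -[q.-1]/k0 dotvZl mulrA mulfV// mul1r.
pose T (a : k0.*2.-tuple 'I_n) c j' (b : k0.*2.-tuple 'I_n) d i' : R :=
  gdelta [tuple of a ++ [:: c; j']] [tuple of b ++ [:: d; i']] *
  \prod_(s < k0) dotv
    (sff_mixed f (tnth a (odd_ix s)) (tnth b (odd_ix s)) x)
    (sff_mixed f (tnth a (even_ix s)) (tnth b (even_ix s)) x) * h al x c d.
transitivity (\sum_(a : k0.*2.-tuple 'I_n) \sum_c \sum_j' \sum_(b : k0.*2.-tuple 'I_n) \sum_d \sum_i'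
   (j' == j)%:R * ((i' == i)%:R * T a c j' b d i')).
  rewrite dotv_suml; apply: eq_bigr => a _; rewrite dotv_suml.
  transitivity (\sum_c \sum_(b : k0.*2.-tuple 'I_n) \sum_d T a c j b d i).
    rewrite [RHS]exchange_big; apply: eq_bigr => b _ /=.
    rewrite dotv_suml; apply: eq_bigr => c _; rewrite dotv_suml; apply: eq_bigr => d _.
    rewrite dotvZl.
    exact: (congr1 (fun z => _ * z) (sff_mixed_eta f_smooth c d al x)).
  apply: eq_bigr => c _; rewrite [RHS](bigD1 j) //= [X in _ = _ + X]big1 ?addr0; last first.
    move=> j' /negPf jj; rewrite big1// => b _; rewrite big1// => d _; rewrite big1// => i' _.
    by rewrite jj mul0r.
  apply: eq_bigr => b _; apply: eq_bigr => d _.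
  rewrite [RHS](bigD1 i) //= [X in _ = _ + X]big1 ?addr0; last first.
    by move=> i' /negPf ii; rewrite ii mul0r mulr0.
  by rewrite !eqxx !mul1r.
rewrite sum_tuple_split; apply: eq_bigr => a _.
rewrite sum_tuple_split; apply: eq_bigr => b _.
rewrite /T gdelta_split.
have -> : \prod_(s < k0) dotv
    (sff_mixed f (tnth [tuple a (widen_slot u) | u < k0.*2] (odd_ix s))
       (tnth [tuple b (widen_slot u) | u < k0.*2] (odd_ix s)) x)
    (sff_mixed f (tnth [tuple a (widen_slot u) | u < k0.*2] (even_ix s))
       (tnth [tuple b (widen_slot u) | u < k0.*2] (even_ix s)) x) = fpairs x a b.
  rewrite /fpairs big_ord_max_split; apply: eq_bigr => s _.
  by rewrite !tnth_mktuple !widen_odd_ix !widen_even_ix sff_mixed_pair.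
move: (kdet a b) (fpairs x a b) (h al x _ _) (_ == j) (_ == i) => A B C d e.
by ring.
Qed.

(** The two free indices of the Newton tensor amount to one more slot of the delta, [L], filled with
    a rank-one matrix. *)
Lemma newton_bilinear al x (u v : 'rV[R]_n) :
  ((q.*2.-1)`!)%:R * (u *m newton_comp f q al x *m v^T) 0 0 =
  ksum (fun a b => fpairs x a b * (h al x (a P) (b P) * (v^T *m u) (a L) (b L))).
Proof.
rewrite mxE big_distrr /=.
transitivity (\sum_j \sum_i u 0 i * v 0 j *
   ksum (fun a b => (a L == j)%:R * ((b L == i)%:R * (fpairs x a b * h al x (a P) (b P))))).
  apply: eq_bigr => j _; rewrite mxE big_distrl big_distrr; apply: eq_bigr => i _ /=.
  rewrite -newton_compE [v^T _ _]mxE.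
  by move: (newton_comp f q al x i j) => T; ring.
transitivity (\sum_j \sum_i ksum (fun a b => u 0 i * v 0 j * ((a L == j)%:R *
   ((b L == i)%:R * (fpairs x a b * h al x (a P) (b P)))))).
  apply: eq_bigr => j _; apply: eq_bigr => i _.
  rewrite /ksum big_distrr; apply: eq_bigr => a _ /=.
  by rewrite big_distrr; apply: eq_bigr => b _ /=; rewrite mulrCA.
under eq_bigr do rewrite -ksum_sum.
rewrite -ksum_sum; apply: eq_ksum => a b.
rewrite (bigD1 (a L)) //= [X in _ + X]big1 ?addr0; last first.
  move=> j /negPf ja; rewrite big1// => i _.
  by rewrite eq_sym ja mul0r mulr0.
rewrite (bigD1 (b L)) //= [X in _ + X]big1 ?addr0; last first.
  by move=> i /negPf ib; rewrite eq_sym ib mul0r !mulr0.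
rewrite !eqxx !mul1r [(v^T *m u) _ _]mxE big_ord1 [v^T _ _]mxE.
by move: (fpairs _ _ _) (h _ _ _ _) => *; ring.
Qed.

(** A labelling [be] selects one normal index per pair, so that every slot holds a single symmetric
    matrix. Positions count from 0: [odd u] marks the second member of a pair, an [even_ix], which
    carries the dual Hessian. *)
Definition lslot x (be : lab) u : 'M[R]_n :=
  if odd u then \sum_ga Um f (be (half_ix u)) ga x *: H ga x
  else H (be (half_ix u)) x.

Lemma lslot_sym x (be : lab) u : (lslot x be u)^T = lslot x be u.
Proof.
rewrite /lslot; case: (odd u); last by rewrite hess_sym.
rewrite linear_sum /=; apply: eq_bigr => ga _.
by rewrite linearZ /= hess_sym.
Qed.

Definition hslot x (be : lab) u : 'M[R]_n := lslot x be u *m imetric f x.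

Lemma hslot_odd x (be : lab) s : hslot x be (odd_ix s) = h (be s) x.
Proof. by rewrite /hslot /lslot odd_odd_ix half_odd_ix. Qed.

Lemma hslot_even x (be : lab) s : hslot x be (even_ix s) = kk (be s) x.
Proof.
rewrite /hslot /lslot odd_even_ix half_even_ix mulmx_suml.
by apply: eq_bigr => ga _; rewrite -scalemxAl.
Qed.

Lemma sum_labels (G : 'I_k0.+1 -> 'I_m -> R) :
  \sum_(be : lab) \prod_s G s (be s) = \prod_s \sum_mu G s mu.
Proof. by rewrite bigA_distr_bigA. Qed.

(** By distributivity the sum over labellings factors over the pairs and restores the scalar
    products; the label of the last pair is shared by [h] in slot [P] and [M] in slot [L]. *)
Lemma sum_mixdisc_last x (M : 'I_m -> 'M[R]_n) :
  \sum_(be : lab) mixdisc (updS (hslot x be) L (M (be ord_max))) =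
  ksum (fun a b => fpairs x a b * \sum_al (h al x (a P) (b P) * M al (a L) (b L))).
Proof.
rewrite exchange_big; apply: eq_bigr => a _ /=.
rewrite exchange_big; apply: eq_bigr => b _ /=.
rewrite -big_distrr /=; congr (_ * _).
pose G s mu := h mu x (a (odd_ix s)) (b (odd_ix s)) *
  (if s == ord_max then M mu (a L) (b L) else kk mu x (a (even_ix s)) (b (even_ix s))).
transitivity (\sum_(be : lab) \prod_s G s (be s)).
  apply: eq_bigr => be _; rewrite prod_pairs; apply: eq_bigr => s _.
  rewrite /updS (negPf (odd_even_neq _ _)) hslot_odd (inj_eq (@even_ix_inj _)) /G.
  by case: eqP => [->|_]; rewrite ?hslot_even.
rewrite sum_labels (bigD1 ord_max) //= mulrC; congr (_ * _).
  apply: eq_bigr => s sm; apply: eq_bigr => be _.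
  by rewrite /G (negPf sm).
by apply: eq_bigr => al _; rewrite /G eqxx.
Qed.

Definition wslot x mu u (c : 'I_n) a : R :=
  if odd u then kleftover f mu (a L) (a u) c x else hleftover f mu (a L) (a u) c x.

Lemma wslotE x (be : lab) u a c :
  \sum_mu (hslot x be u *m H mu x) (a u) (a L) * Y mu x 0 c = wslot x (be (half_ix u)) u c a.
Proof.
rewrite /wslot; case: (boolP (odd u)) => ou.
  have -> : u = even_ix (half_ix u).
    by apply: val_inj; rewrite /= -[LHS]odd_double_half ou.
  by rewrite hslot_even half_even_ix.
have -> : u = odd_ix (half_ix u).
  by apply: val_inj; rewrite /= -[LHS]odd_double_half (negPf ou).
by rewrite hslot_odd half_odd_ix.
Qed.

Lemma sum_slot x t a b : t != L ->
  \sum_(be : lab) slot_rest (hslot x be) t L a b *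
     (wslot x (be (half_ix t)) t (b t) a * Y (be ord_max) x 0 (b L)) =
  \prod_s \sum_mu
     ((if odd_ix s == t then wslot x mu t (b t) a else h mu x (a (odd_ix s)) (b (odd_ix s))) *
      (if s == ord_max then Y mu x 0 (b L) else
       if even_ix s == t then wslot x mu t (b t) a else kk mu x (a (even_ix s)) (b (even_ix s)))).
Proof.
move=> tL; rewrite -sum_labels; apply: eq_bigr => be _.
pose om u := if u == t then wslot x (be (half_ix t)) t (b t) a else
  if u == L then Y (be ord_max) x 0 (b L) else hslot x be u (a u) (b u).
transitivity (\prod_u om u).
  rewrite [RHS](bigD1 t) //= [X in _ = _ * X](bigD1 L) 1?eq_sym //= mulrC -mulrA.
  rewrite {1 2}/om !eqxx [L == t]eq_sym (negPf tL); congr (_ * (_ * _)).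
  by apply: eq_bigr => u /andP[ut uL]; rewrite /om (negPf ut) (negPf uL).
rewrite prod_pairs; apply: eq_bigr => s _; rewrite /om.
rewrite (negPf (odd_even_neq _ _)) (inj_eq (@even_ix_inj _)) hslot_odd hslot_even.
apply: (congr2 *%R).
  by case: (eqVneq (odd_ix s) t) => [<-|_]; rewrite ?half_odd_ix.
case: (eqVneq s ord_max) => [->|sm].
  by rewrite [_ == t]eq_sym (negPf tL).
by case: (eqVneq (even_ix s) t) => [<-|_]; rewrite ?half_even_ix.
Qed.

(** Matches the slots of the commutator formula with the product rule of the divergence. Slot [t] of
    a pair before the last gives one of the two terms of [leftover_pair], slot [P] gives
    [leftover_last], and [L] is excluded, being the slot of the commutator itself. *)
Lemma sum_slots x :
  \sum_(be : lab) \sum_mu \sum_(t | t != L) \sum_(a : ix) \sum_(b : ix) kdet a b *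
    (slot_rest (hslot x be) t L a b *
     ((hslot x be t *m H mu x) (a t) (a L) * Y mu x 0 (b t) * Y (be ord_max) x 0 (b L)))
  = \sum_s ksum (fun a b => leftover f x s a b * other_slots f x s a b).
Proof.
pose Z t := ksum (fun a b => \sum_(be : lab) slot_rest (hslot x be) t L a b *
     (wslot x (be (half_ix t)) t (b t) a * Y (be ord_max) x 0 (b L))).
transitivity (\sum_(t | t != L) Z t).
  under eq_bigr do rewrite exchange_big /=.
  rewrite exchange_big; apply: eq_bigr => t tL /=.
  rewrite /Z ksum_sum; apply: eq_bigr => be _.
  rewrite exchange_big; apply: eq_bigr => a _ /=.
  rewrite exchange_big; apply: eq_bigr => b _ /=.
  rewrite -big_distrr /=; congr (_ * _).
  by rewrite -big_distrr -big_distrl /= wslotE.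
rewrite big_pairs_cond; apply: eq_bigr => s _.
rewrite odd_even_neq (inj_eq (@even_ix_inj _)) /leftover.
case: (eqVneq s ord_max) => [->|sm] /=.
  rewrite addr0; apply: eq_ksum => a b.
  rewrite sum_slot ?odd_even_neq// (bigD1 ord_max) //= eqxx; congr (_ * _).
    by apply: eq_bigr => mu _; rewrite eqxx /wslot odd_odd_ix.
  apply: eq_bigr => l lm; rewrite /fslot (negPf lm).
  apply: eq_bigr => mu _; rewrite (inj_eq (@odd_ix_inj _)) (negPf lm).
  by rewrite (negPf (even_odd_neq _ _)).
rewrite -ksumD; apply: eq_ksum => a b.
rewrite !sum_slot ?odd_even_neq ?(inj_eq (@even_ix_inj _))//.
have E (t : 'I_(k0.+1).*2) : half_ix t = s ->
   \prod_(l | l != s) \sum_mu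
     ((if odd_ix l == t then wslot x mu t (b t) a else h mu x (a (odd_ix l)) (b (odd_ix l))) *
      (if l == ord_max then Y mu x 0 (b L) else
       if even_ix l == t then wslot x mu t (b t) a else kk mu x (a (even_ix l)) (b (even_ix l))))
   = other_slots f x s a b.
  move=> ts; apply: eq_bigr => l ls.
  have ot : (odd_ix l == t) = false.
    by apply/negbTE; apply: contraNneq ls => e; rewrite -ts -e half_odd_ix.
  have et : (even_ix l == t) = false.
    by apply/negbTE; apply: contraNneq ls => e; rewrite -ts -e half_even_ix.
  rewrite /fslot; case: (eqVneq l ord_max) => [lm|lm].
    by apply: eq_bigr => mu _; rewrite ot lm.
  by apply: eq_bigr => mu _; rewrite ot et.
rewrite (bigD1 s) //= E ?half_odd_ix// [X in _ + X](bigD1 s) //= E ?half_even_ix//.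
rewrite -mulrDl; congr (_ * _); congr (_ + _); apply: eq_bigr => mu _.
  by rewrite eqxx (negPf sm) (negPf (even_odd_neq _ _)) /wslot odd_odd_ix.
by rewrite (negPf (odd_even_neq _ _)) (negPf sm) eqxx /wslot odd_even_ix.
Qed.

(** For fixed [al] and [be], the two halves of the commutator are two fillings of slot [L]: they
    multiply the rank-one matrix (Df^be)^T Y_al by h_be on the right and on the left. Labelling the
    last pair by [al] makes this [mixdisc_commutator] with m = Hess f^be, y = Df^be and z =
    Df^al. *)
Lemma commutator_termE x :
  ((q.*2.-1)`!)%:R * commutator_term f q x =
  - \sum_s ksum (fun a b => leftover f x s a b * other_slots f x s a b).
Proof.
transitivity (\sum_al \sum_be
   (((q.*2.-1)`!)%:R * (Y al x *m h be x *m newton_comp f q al x *m (g1 be x)^T) 0 0 -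
    ((q.*2.-1)`!)%:R * (Y al x *m newton_comp f q al x *m (g1 be x *m (h be x)^T)^T) 0 0)).
  rewrite /commutator_term big_distrr; apply: eq_bigr => al _ /=.
  rewrite big_distrr; apply: eq_bigr => be _ /=.
  rewrite !tan_coord_evec// of_coord_Yv// /commutator shapeE// -mulrBr; congr (_ * _).
  rewrite mulmxBl mxE [X in _ + X]mxE; congr (_ - fun_of_matrix _ 0 0).
  by rewrite trmx_mul trmxK !mulmxA.
rewrite exchange_big /=.
transitivity (\sum_be \sum_(la : lab)
   (mixdisc (updS (hslot x la) L ((g1 be x)^T *m (Y (la ord_max) x *m h be x))) -
    mixdisc (updS (hslot x la) L (h be x *m (g1 be x)^T *m Y (la ord_max) x)))).
  apply: eq_bigr => be _; rewrite !sumrB; congr (_ - _).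
    rewrite (sum_mixdisc_last x (fun al => (g1 be x)^T *m (Y al x *m h be x))).
    under [RHS]eq_ksum => a b do rewrite big_distrr /=.
    rewrite ksum_sum; apply: eq_bigr => al _; rewrite newton_bilinear.
    by apply: eq_ksum => a b.
  rewrite (sum_mixdisc_last x (fun al => h be x *m (g1 be x)^T *m Y al x)).
  under [RHS]eq_ksum => a b do rewrite big_distrr /=.
  rewrite ksum_sum; apply: eq_bigr => al _; rewrite newton_bilinear.
  by apply: eq_ksum => a b; rewrite trmx_mul trmxK.
rewrite exchange_big -sum_slots -[RHS]sumrN; apply: eq_bigr => la _ /=.
rewrite -[RHS]sumrN; apply: eq_bigr => be _.
exact: (mixdisc_commutator (g1 be x) (g1 (la ord_max) x) L
  (imetric_sym f x) (hess_sym f_smooth be x) (lslot_sym x la)).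
Qed.

Lemma divergence_identity x :
  \sum_i pd i (gb_field (k0 := k0) f i) x =
  2^-1 * (gauss_bonnet f q x + ((q.*2.-1)`!)%:R * commutator_term f q x).
Proof. by rewrite gb_field_divergence// commutator_termE. Qed.

(** * Flat normal bundle and the Ricci equation *)

Section Flat.
Hypothesis flat : flat_normal_bundle f.

Lemma eta_entry_smooth al e : smooth (fun x => Defs.eta f al x 0 e).
Proof.
case: (fintype.split_ordP e) => u ->.
  have -> : (fun x => Defs.eta f al x 0 (lshift m u)) = fun x => - f1 al u x.
    by apply/funext => x; rewrite /Defs.eta row_mxEl !mxE.
  exact/smoothN/smooth_pd/fcomp_smooth.
have -> : (fun x => Defs.eta f al x 0 (rshift n u)) =
    fun x => (delta_mx 0 al : 'rV[R]_m) 0 u.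
  by apply/funext => x; rewrite /Defs.eta row_mxEr.
exact: smooth_cst.
Qed.

Lemma eta_smooth al : smooth (Defs.eta f al).
Proof. by apply: smooth_row => e; exact: eta_entry_smooth. Qed.

Lemma tangent_entry_C1 l e : C1 (fun x => tangent f l x 0 e).
Proof.
case: (fintype.split_ordP e) => u ->.
  have -> : (fun x => tangent f l x 0 (lshift m u)) = fun x => (delta_mx 0 l : 'rV[R]_n) 0 u.
    by apply/funext => x; rewrite /tangent row_mxEl.
  exact: C1_cst.
have -> : (fun x => tangent f l x 0 (rshift n u)) = f1 u l.
  by apply/funext => x; rewrite /tangent row_mxEr mxE.
exact: f1_C1.
Qed.

Lemma pd_eta_tangent al j l x :
  dotv (pd j (Defs.eta f al) x) (tangent f l x) = - f2 al j l x.
Proof.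
have Ce e : C1 (fun x => Defs.eta f al x 0 e) by exact/smooth_C1/eta_entry_smooth.
rewrite pd_row// /dotv big_split_ord /= [X in _ + X]big1 ?addr0; last first.
  move=> u _; rewrite mxE.
  have -> : (fun x => Defs.eta f al x 0 (rshift n u)) =
      fun x => (delta_mx 0 al : 'rV[R]_m) 0 u.
    by apply/funext => y; rewrite /Defs.eta row_mxEr.
  by rewrite pd_cst mul0r.
rewrite (bigD1 l) //= [X in _ + X]big1 ?addr0; last first.
  by move=> u /negPf ul; rewrite /tangent row_mxEl [X in _ * X]mxE ul andbF mulr0.
rewrite /tangent row_mxEl [X in _ * X]mxE !eqxx mulr1 mxE.
have -> : (fun x => Defs.eta f al x 0 (lshift m l)) = fun x => - f1 al l x.
  by apply/funext => y; rewrite /Defs.eta row_mxEl !mxE.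
by rewrite pdN//; exact: f1_C1.
Qed.

Lemma normal_connection_eta al j y :
  normal_connection f j (Defs.eta f al) y =
  pd j (Defs.eta f al) y + \sum_l h al y j l *: tangent f l y.
Proof.
rewrite /normal_connection /normal_part; congr (_ + _).
rewrite /of_coord -sumrN; apply: eq_bigr => l _; rewrite -scaleNr; congr (_ *: _).
rewrite tan_coordE// mxE hm_sumE// -sumrN; apply: eq_bigr => e _.
by rewrite mxE pd_eta_tangent mulNr opprK.
Qed.

(** The tangential correction of the inner normal derivative is differentiated once more; paired
    with eta_be, only the derivative of the tangent frame survives, and it is a Hessian of f^be. *)
Lemma normal_connection2_eta al be i j x :
  dotv (normal_connection f i (normal_connection f j (Defs.eta f al)) x) (Defs.eta f be x) =
  dotv (pd i (pd j (Defs.eta f al)) x) (Defs.eta f be x) + (h al x *m H be x) j i.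
Proof.
rewrite {1}/normal_connection normal_part_eta//.
have Ce e : C1 (fun x => pd j (Defs.eta f al) x 0 e).
  have -> : (fun x => pd j (Defs.eta f al) x 0 e) = pd j (fun y => Defs.eta f al y 0 e).
    apply/funext => y; rewrite pd_row ?mxE// => e'.
    exact/smooth_C1/eta_entry_smooth.
  exact/smooth_C1/smooth_pd/eta_entry_smooth.
have Ct l e : C1 (fun y => h al y j l * tangent f l y 0 e).
  by apply: C1M; [exact: hm_C1|exact: tangent_entry_C1].
have E e : (fun y => normal_connection f j (Defs.eta f al) y 0 e) =
    fun y => pd j (Defs.eta f al) y 0 e + \sum_l h al y j l * tangent f l y 0 e.
  apply/funext => y; rewrite normal_connection_eta mxE summxE; congr (_ + _).
  by apply: eq_bigr => l _; rewrite mxE.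
have CV e : C1 (fun y => normal_connection f j (Defs.eta f al) y 0 e).
  by rewrite E; apply: C1D => //; exact: C1_sum.
have -> : pd i (normal_connection f j (Defs.eta f al)) x =
   pd i (pd j (Defs.eta f al)) x +
   \sum_l (pd i (fun y => h al y j l) x *: tangent f l x + h al x j l *: pd i (tangent f l) x).
  rewrite pd_row// [pd i (pd j _) x]pd_row//; apply/rowP => e; rewrite !mxE summxE E.
  rewrite pdD//; last exact: C1_sum.
  congr (_ + _); rewrite pd_sum//; apply: eq_bigr => l _.
  rewrite pdM; [|exact: hm_C1|exact: tangent_entry_C1].
  rewrite !mxE; congr (_ + _ * _).
  by rewrite pd_row ?mxE// => e'; exact: tangent_entry_C1.
rewrite dotvDl; congr (_ + _); rewrite dotv_suml mxE; apply: eq_bigr => l _.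
rewrite dotvDl !dotvZl (dotvC (tangent _ _ _)) eta_tangent mulr0 add0r; congr (_ * _).
rewrite pd_tangent// dotv_suml (bigD1 be) //= dotvZl evec_eta eqxx mulr1 big1 ?addr0; last first.
  by move=> ga /negPf gb; rewrite dotvZl evec_eta gb mulr0.
by rewrite mxE f2_sym.
Qed.

(** The Ricci equation for the frame eta: the second derivatives of eta_al cancel by symmetry, and
    the remainder is the curvature paired with eta_be. *)
Lemma flat_symmetric al be i j x : (h al x *m H be x) j i = (h al x *m H be x) i j.
Proof.
have nf : normal_field f (Defs.eta f al) by move=> y l; exact: eta_tangent.
have E := flat (eta_smooth al) nf i j x.
have E2 : dotv (normal_connection f i (normal_connection f j (Defs.eta f al)) x) (Defs.eta f be x)
  - dotv (normal_connection f j (normal_connection f i (Defs.eta f al)) x) (Defs.eta f be x) = 0.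
  apply: etrans (esym (dotvBl _ _ _)) _.
  exact: etrans (congr1 (fun v => dotv v (Defs.eta f be x)) E) (dotv0l _).
have E3 := etrans (esym (congr2 (fun c d : R => c - d)
  (normal_connection2_eta al be i j x) (normal_connection2_eta al be j i x))) E2.
have EA : pd i (pd j (Defs.eta f al)) x = pd j (pd i (Defs.eta f al)) x.
  have Ce e : C1 (fun x => Defs.eta f al x 0 e) by exact/smooth_C1/eta_entry_smooth.
  have Ee l e : (fun x => pd l (Defs.eta f al) x 0 e) = pd l (fun y => Defs.eta f al y 0 e).
    by apply/funext => y; rewrite pd_row ?mxE.
  have Ce' l e : C1 (fun x => pd l (Defs.eta f al) x 0 e).
    by rewrite Ee; exact/smooth_C1/smooth_pd/eta_entry_smooth.
  apply: etrans (pd_row i x (Ce' j)) _; apply: etrans _ (esym (pd_row j x (Ce' i))).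
  apply/rowP => e; apply: etrans (mxE _ _ _ _) _; apply: etrans _ (esym (mxE _ _ _ _)).
  apply: etrans (congr1 (fun g => pd i g x) (Ee j e)) _.
  apply: etrans _ (esym (congr1 (fun g => pd j g x) (Ee i e))).
  by apply: pd_comm => [|l]; [exact: Ce|exact/smooth_C1/smooth_pd/eta_entry_smooth].
have cancel (A B u v : R) : A = B -> (A + u) - (B + v) = 0 -> u = v.
  by move=> -> E0; apply/eqP; rewrite -subr_eq0 -E0; apply/eqP; ring.
exact: cancel (congr1 (fun v => dotv v (Defs.eta f be x)) EA) E3.
Qed.

Lemma hleftover_sym be i l c x : hleftover f be i l c x = hleftover f be l i c x.
Proof. by apply: eq_bigr => mu _; rewrite flat_symmetric. Qed.

Lemma kleftover_sym be i l c x : kleftover f be i l c x = kleftover f be l i c x.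
Proof. by rewrite !kleftoverE//; apply: eq_bigr => mu _; rewrite hleftover_sym. Qed.

Lemma flat_leftover x s : ksum (fun a b => leftover f x s a b * other_slots f x s a b) = 0.
Proof.
rewrite /leftover; case: (eqVneq s ord_max) => [->|sm].
  apply: (@ksum_antisym _ _ _ _ P L) => [|a b]; first by rewrite odd_even_neq.
  rewrite other_slots_max_swap; congr (_ * _); apply: eq_bigr => al _.
  by rewrite swapf_l swapf_r hleftover_sym.
have eL : even_ix s != L by rewrite (inj_eq (@even_ix_inj _)).
under eq_ksum => a b do rewrite mulrDl.
rewrite ksumD (@ksum_antisym _ _ _ _ (odd_ix s) L) ?odd_even_neq//; last first.
  move=> a b; rewrite other_slots_swap ?half_odd_ix//; congr (_ * _); apply: eq_bigr => be _.
  by rewrite swapf_l swapf_r swapf_other ?even_odd_neq// hleftover_sym.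
rewrite (@ksum_antisym _ _ _ _ (even_ix s) L) ?addr0//.
move=> a b; rewrite other_slots_swap ?half_even_ix//; congr (_ * _); apply: eq_bigr => be _.
by rewrite swapf_l swapf_r swapf_other ?odd_even_neq// kleftover_sym.
Qed.

Lemma flat_commutator_term x : ((q.*2.-1)`!)%:R * commutator_term f q x = 0.
Proof. by rewrite commutator_termE big1 ?oppr0// => s _; exact: flat_leftover. Qed.

End Flat.

End Commutator.

(** * Lebesgue measure with a chosen coordinate singled out *)

Section Insertion.
Context {R : realType}.
Local Notation mu := (@lebesgue_measure R).
Local Notation T := (measurableTypeR R).

Definition ins {n} (i : 'I_n.+1) (p : T * n.-tuple T) : n.+1.-tuple T :=
  [tuple if unlift i j is Some j' then tnth p.2 j' else p.1 | j < n.+1].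

Definition insr {n} (i : 'I_n.+1) (x : R) (w : 'rV[R]_n) : 'rV[R]_n.+1 :=
  \row_j (if unlift i j is Some j' then w 0 j' else x).

Lemma rv_ins n (i : 'I_n.+1) p : rv (ins i p) = insr i p.1 (rv p.2).
Proof.
apply/rowP => j; rewrite !mxE tnth_mktuple.
by case: unlift => // j'; rewrite mxE.
Qed.

Lemma measurable_ins n (i : 'I_n.+1) : measurable_fun setT (@ins n i).
Proof.
apply: (proj2 (measurable_fun_tnthP _)) => j.
rewrite (_ : (_ \o _) = fun p : T * n.-tuple T =>
    if unlift i j is Some j' then tnth p.2 j' else p.1); last first.
  by apply/funext => p /=; rewrite tnth_mktuple.
case: (unlift i j) => [j'|]; last exact: measurable_fst.
exact: (measurableT_comp (measurable_tnth j') measurable_snd).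
Qed.

Lemma ins0 n p : ins (ord0 : 'I_n.+1) p = Defs.cons_tuple p.
Proof.
apply: eq_from_tnth => j; rewrite tnth_mktuple.
case: unliftP => [j'|] ->; last by rewrite (tnth_nth 0).
by rewrite !(tnth_nth 0).
Qed.

Lemma insS n (j : 'I_n.+1) (x0 x : T) (z : n.-tuple T) :
  ins (lift ord0 j) (x, Defs.cons_tuple (x0, z)) = Defs.cons_tuple (x0, ins j (x, z)).
Proof.
apply: eq_from_tnth => l; rewrite tnth_mktuple.
case: (unliftP ord0 l) => [l'|] ->.
  rewrite [RHS](_ : _ = tnth (ins j (x, z)) l'); last by rewrite !(tnth_nth 0).
  rewrite tnth_mktuple; case: (unliftP j l') => [l''|] ->.
    have -> : lift ord0 (lift j l'') = lift (lift ord0 j) (lift ord0 l'').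
      by apply: val_inj; rewrite /= /bump /= !add1n ltnS addnS.
    by rewrite liftK !(tnth_nth 0).
  by rewrite unlift_none.
have -> : (ord0 : 'I_n.+2) = lift (lift ord0 j) ord0 by exact: val_inj.
by rewrite liftK !(tnth_nth 0).
Qed.

Local Open Scope ereal_scope.

Lemma leb_cons n (h : n.+1.-tuple T -> \bar R) :
  measurable_fun setT h -> (forall t, 0 <= h t) ->
  \int[leb R n.+1]_t h t = \int[(mu \x leb R n)%E]_p h (Defs.cons_tuple p).
Proof.
move=> mh h0; rewrite /leb /=.
rewrite [LHS](@ge0_integral_pushforward _ _ _ _ R (@Defs.cons_tuple _ _ n)
  (@measurable_cons_tuple _ _ n) (mu \x power_measure mu n)%E)//.
Qed.

(** [leb] is built from the front, so its symmetry in the coordinates comes from Tonelli: split off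
    coordinate 0, single out the coordinate in the remaining tuple by induction, move the integral
    over it inside, and reassemble. *)
Lemma leb_ins n (i : 'I_n.+1) (h : n.+1.-tuple T -> \bar R) :
  measurable_fun setT h -> (forall t, 0 <= h t) ->
  \int[leb R n.+1]_t h t = \int[(mu \x leb R n)%E]_p h (ins i p).
Proof.
elim: n i h => [|n IH] i h mh h0.
  rewrite ord1 leb_cons//; apply: eq_integral => p _.
  by rewrite ins0.
case: (unliftP ord0 i) => [j|] ->; last first.
  by rewrite leb_cons//; apply: eq_integral => p _; rewrite ins0.
rewrite leb_cons//.
have mhc : measurable_fun setT (fun p => h (Defs.cons_tuple p)).
  exact: (measurableT_comp mh (@measurable_cons_tuple _ _ _)).
have mhi k : measurable_fun setT (fun p => h (ins k p)).
  exact: (measurableT_comp mh (measurable_ins k)).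
rewrite (fubini_tonelli1 (fun p => h (Defs.cons_tuple p)))//.
pose K w := \int[mu]_x h (ins (lift ord0 j) (x, w)).
have mK : measurable_fun setT K.
  apply: (measurable_fun_fubini_tonelli_G (m1 := mu) (fun p => h (ins (lift ord0 j) p))); [exact: mhi|by move=> p; exact: h0].
have K0 w : 0 <= K w by apply: integral_ge0.
transitivity (\int[mu]_x0 \int[leb R n]_z K (Defs.cons_tuple (x0, z))).
  apply: eq_integral => x0 _; rewrite /fubini_F.
  have mh0 : measurable_fun setT (fun t : n.+1.-tuple T => h (Defs.cons_tuple (x0, t))).
    apply: (measurableT_comp mh).
    apply: (measurableT_comp (@measurable_cons_tuple _ _ _)).
    exact: measurable_pair1.
  rewrite (IH j)//.
  have mh1 : measurable_fun setT (fun p : T * n.-tuple T => h (Defs.cons_tuple (x0, ins j p))).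
    exact: (measurableT_comp mh0 (measurable_ins j)).
  rewrite (fubini_tonelli2 (fun p => h (Defs.cons_tuple (x0, ins j p))))//.
  apply: eq_integral => z _; apply: eq_integral => x _.
  by rewrite insS.
have mKc : measurable_fun setT (fun p => K (Defs.cons_tuple p)).
  exact: (measurableT_comp mK (@measurable_cons_tuple _ _ _)).
rewrite -(fubini_tonelli1 (fun p => K (Defs.cons_tuple p)))// -leb_cons//.
by rewrite (fubini_tonelli2 (fun p => h (ins (lift ord0 j) p))).
Qed.

Lemma leb_insE n (i : 'I_n.+1) (h : n.+1.-tuple T -> \bar R) :
  measurable_fun setT h ->
  \int[leb R n.+1]_t h t = \int[(mu \x leb R n)%E]_p h (ins i p).
Proof.
move=> mh; rewrite integralE [RHS]integralE.
rewrite (@leb_ins n i (h ^\+))//; last exact: measurable_funepos.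
rewrite (@leb_ins n i (h ^\-))//; last exact: measurable_funeneg.
by congr (_ - _); apply: eq_integral => p _;
  rewrite ?(funepos_comp h (ins i)) ?(funeneg_comp h (ins i)).
Qed.

Lemma leb_ins_integrable n (i : 'I_n.+1) (h : n.+1.-tuple T -> \bar R) :
  measurable_fun setT h ->
  (leb R n.+1).-integrable setT h <->
  (mu \x leb R n)%E.-integrable setT (fun p => h (ins i p)).
Proof.
move=> mh.
have mhi : measurable_fun setT (fun p => h (ins i p)).
  exact: (measurableT_comp mh (measurable_ins i)).
have E : \int[leb R n.+1]_t `|h t| = \int[(mu \x leb R n)%E]_p `|h (ins i p)|.
  by rewrite (@leb_ins n i (fun t => `|h t|))//; exact: measurableT_comp.
by split=> /integrableP[_ hoo]; apply/integrableP; split => //;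
  [rewrite -E|rewrite E].
Qed.

Lemma leb_ins_fubini n (i : 'I_n.+1) (h : n.+1.-tuple T -> \bar R) :
  (leb R n.+1).-integrable setT h ->
  \int[leb R n.+1]_t h t = \int[leb R n]_z \int[mu]_x h (ins i (x, z)).
Proof.
move=> ih; have mh := measurable_int _ ih.
rewrite (leb_insE i)//.
rewrite -(integral21_prod_meas1 (f := fun p => h (ins i p)))//.
exact/(leb_ins_integrable i mh).
Qed.

Lemma leb_ins_tonelli n (i : 'I_n.+1) (h : n.+1.-tuple T -> \bar R) :
  measurable_fun setT h -> (forall t, 0 <= h t) ->
  \int[leb R n.+1]_t h t = \int[leb R n]_z \int[mu]_x h (ins i (x, z)).
Proof.
move=> mh h0; rewrite (leb_insE i)//.
have mhi : measurable_fun setT (fun p => h (ins i p)).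
  exact: (measurableT_comp mh (measurable_ins i)).
by rewrite (fubini_tonelli2 (fun p => h (ins i p))).
Qed.

End Insertion.

(** * Measurability of continuous functions on tuples *)

Section ContinuousMeasurable.
Context {R : realType} {n : nat}.
Local Notation T := (measurableTypeR R).

(** The tuples carry the product sigma-algebra; an open set belongs to it as the countable union of
    the rational boxes that it contains. *)
Lemma open_rv_measurable (U : set 'rV[R]_n) : open U ->
  measurable [set t : n.-tuple T | U (rv t)].
Proof.
move=> oU.
pose box (ab : 'rV[rat]_n * 'rV[rat]_n) : set (n.-tuple T) :=
  \bigcap_(i in [set: 'I_n])
     [set t | tnth t i \in `]ratr (ab.1 0 i), ratr (ab.2 0 i)[].
pose F ab := if `[< box ab `<=` [set t : n.-tuple T | U (rv t)] >] then box ab else set0.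
have mF ab : measurable (F ab).
  rewrite /F; case: ifP => // _.
  apply: fin_bigcap_measurable => // i _.
  have := @measurable_tnth _ T n i measurableT _
    (measurable_itv `]ratr (ab.1 0 i), ratr (ab.2 0 i)[).
  by rewrite setTI.
rewrite (_ : [set _ | _] = \bigcup_ab F ab); last first.
  apply/seteqP; split => t; last first.
    by case=> ab _; rewrite /F; case: asboolP => // h; exact: h.
  move=> /= Ut; have /nbhs_ballP[e /= e0 eU] := open_nbhs_nbhs (conj oU Ut).
  have ex1 i : exists q : rat, (ratr q : R) \in `]tnth t i - e, tnth t i[.
    by have [|q] := @rat_in_itvoo R (tnth t i - e) (tnth t i);
      [rewrite ltrBlDr ltrDl|exists q].
  have ex2 i : exists q : rat, (ratr q : R) \in `]tnth t i, tnth t i + e[.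
    by have [|q] := @rat_in_itvoo R (tnth t i) (tnth t i + e);
      [rewrite ltrDl|exists q].
  have [a ha] := fin_all_exists ex1; have [b hb] := fin_all_exists ex2.
  exists (\row_i a i, \row_i b i) => //.
  have boxP s : box (\row_i a i, \row_i b i) s <->
      forall i, ratr (a i) < tnth s i < ratr (b i).
    split=> [h i|h i _]; last by rewrite /= !mxE in_itv /= h.
    by have := h i I; rewrite /= !mxE in_itv.
  have tb : box (\row_i a i, \row_i b i) t.
    apply/boxP => i; have := ha i; have := hb i; rewrite !in_itv /=.
    by move=> /andP[-> _] /andP[_ ->].
  rewrite /F; case: asboolP => // nsub; exfalso; apply: nsub => s /boxP bs.
  apply: eU; split=> // o i; rewrite ord1 /ball /= !mxE.
  have /andP[s1 s2] := bs i; have := ha i; have := hb i; rewrite !in_itv /=.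
  move=> /andP[b1 b2] /andP[a1 a2].
  rewrite ltr_norml; apply/andP; split; lra.
apply: countable_bigcupT_measurable => //.
Qed.

Lemma continuous_rv_measurable (h : 'rV[R]_n -> R) : continuous h ->
  measurable_fun setT (fun t : n.-tuple T => h (rv t)).
Proof.
move=> /continuousP ch; apply: (measurability _ (RGenOpens.measurableE R)).
move=> _ [_ [a [b ->] <-]]; rewrite setTI.
exact: (open_rv_measurable (ch _ (interval_open _ _))).
Qed.

End ContinuousMeasurable.

(** * A substitution along circles *)

Section HalfLine.
Context {R : realType}.
Local Notation mu := (@lebesgue_measure R).

Lemma integral_opp (h : R -> R) : measurable_fun setT h ->
  (\int[mu]_x (h (- x)%R)%:E = \int[mu]_x (h x)%:E)%E.
Proof.
have ge0E (k : R -> \bar R) : measurable_fun setT k -> (forall x, 0 <= k x)%E ->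
    (\int[mu]_x (k (- x)%R) = \int[mu]_x (k x))%E.
  move=> mk k0.
  have mo : measurable_fun setT (-%R : measurableTypeR R -> measurableTypeR R).
    exact: oppr_measurable.
  have hk := ge0_integral_pushforward mo mu (D := setT) (f := k) measurableT mk
    (fun x _ => k0 x).
  rewrite preimage_setT in hk; rewrite -[LHS]hk.
  by apply: eq_measure_integral => A mA _; exact: lebesgue_measureN.
move=> mh; have mhe : measurable_fun setT (EFin \o h) by exact/measurable_EFinP.
rewrite integralE [RHS]integralE; congr (_ - _)%E.
  rewrite -(ge0E ((EFin \o h)^\+)%E)//; last exact: measurable_funepos.
  by apply: eq_integral => x _; rewrite !funeposE.
rewrite -(ge0E ((EFin \o h)^\-)%E)//; last exact: measurable_funeneg.
by apply: eq_integral => x _; rewrite !funenegE.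
Qed.

Lemma integral_half (p : R -> R) : measurable_fun setT p ->
  (\int[mu]_x (p x)%:E = \int[mu]_(x in `]0%R, +oo[) (p x)%:E +
                         \int[mu]_(x in `]0%R, +oo[) (p (- x))%:E)%E.
Proof.
move=> mp.
have mpN : measurable_fun setT (fun x : R => p (- x)).
  exact: (measurableT_comp mp (@oppr_measurable R setT)).
have -> : [set: R] = [set` `]-oo, 0%R[] `|` [set` `[0%R, +oo[].
  by apply/seteqP; split => // x _ /=; rewrite !in_itv /= andbT; case: ltP; [left|right].
rewrite (@integral_setU _ _ _ mu)//=; first last.
- apply/disj_set2P; apply/seteqP; split => // x /=; rewrite !in_itv /= andbT.
  by move=> [] h1 h2; move: (lt_le_trans h1 h2); rewrite ltxx.
- by apply: measurable_funTS; exact/measurable_EFinP.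
rewrite addrC -integral_itv_obnd_cbnd; last first.
  by apply: measurable_funTS; exact/measurable_EFinP.
congr (_ + _)%E; rewrite integral_mkcond [RHS]integral_mkcond.
pose h x := if x < 0 then p x else 0.
have mh : measurable_fun setT h.
  apply: measurable_fun_ifT => //; exact: measurable_fun_ltr.
transitivity (\int[mu]_x (h x)%:E)%E.
  by apply: eq_integral => x _; rewrite patchE mem_setE in_itv /= /h; case: ifP.
rewrite -integral_opp//; apply: eq_integral => x _.
by rewrite patchE mem_setE in_itv /= andbT /h oppr_lt0; case: ifP.
Qed.

End HalfLine.

(** * The circle of radius [rho] and its two graph charts *)

Section CircleSubstitution.
Context {R : realType}.
Local Notation mu := (@lebesgue_measure R).
Variable rho : R.
Hypothesis rho0 : 0 < rho.

(** The second leg of the right triangle with hypotenuse [rho] and leg [v]; an involution of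
    [0, rho], and 0 when [v] exceeds the hypotenuse. *)
Definition leg (v : R) : R := Num.sqrt (rho ^+ 2 - v ^+ 2).

Lemma leg_continuous : continuous leg.
Proof.
have c : continuous (fun v : R => rho ^+ 2 - v ^+ 2).
  apply: continuous_add; first exact: cst_continuous.
  apply: continuous_neg; exact: exprn_continuous.
by move=> v; exact: (continuous_comp (c v) (@sqrt_continuous R _)).
Qed.

Lemma leg_gt0 v : 0 <= v < rho -> 0 < leg v.
Proof.
move=> /andP[v0 vr]; rewrite sqrtr_gt0 subr_gt0.
by rewrite ltr_pXn2r// nnegrE// ltW.
Qed.

Lemma leg_dom_gt0 v : - rho < v < rho -> 0 < rho ^+ 2 - v ^+ 2.
Proof. by move=> /andP[h1 h2]; rewrite subr_gt0 !expr2; nra. Qed.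

Lemma legK v : 0 <= v <= rho -> leg (leg v) = v.
Proof.
move=> /andP[v0 vr].
have d : 0 <= rho ^+ 2 - v ^+ 2 by rewrite subr_ge0 lerXn2r// nnegrE// ltW.
by rewrite /leg sqr_sqrtr// opprB addrC subrK sqrtr_sqr ger0_norm.
Qed.

Lemma leg_ge0 v : 0 <= leg v. Proof. exact: sqrtr_ge0. Qed.

Lemma leg_anti u v : 0 <= u -> u < v -> v <= rho -> leg v < leg u.
Proof.
move=> u0 uv vr; rewrite /leg ltr_sqrt.
  by rewrite ltrD2l ltrN2 ltr_pXn2r// nnegrE// (le_trans u0)// ltW.
by rewrite subr_gt0 ltr_pXn2r// ?nnegrE//; [exact: lt_le_trans uv vr|exact: ltW].
Qed.

Lemma leg_le u v : 0 <= u -> u <= v -> v <= rho -> leg v <= leg u.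
Proof.
move=> u0; rewrite le_eqVlt => /predU1P[->//|uv] vr.
by apply: ltW; exact: leg_anti.
Qed.

Lemma leg_le_rho v : leg v <= rho.
Proof.
rewrite /leg -[leRHS](gtr0_norm rho0) -sqrtr_sqr ler_wsqrtr//.
by rewrite gerBl sqr_ge0.
Qed.

Lemma leg0 : leg 0 = rho.
Proof. by rewrite /leg expr0n subr0 sqrtr_sqr gtr0_norm. Qed.

Lemma is_derive_leg v : - rho < v < rho -> is_derive v 1 leg (- (v / leg v)).
Proof.
move=> hv; have d := leg_dom_gt0 hv.
have i1 : is_derive v (1 : R) (fun v : R => rho ^+ 2 - v ^+ 2) (- (2 * v)).
  apply: is_derive_eq.
  by rewrite add0r mul1r [v%:A]mulr1; ring.
have i2 := is_derive1_sqrt d.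
have s0 : Num.sqrt (rho ^+ 2 - v ^+ 2) != 0 by rewrite gt_eqF// sqrtr_gt0.
have -> : - (v / leg v) = (2 * Num.sqrt (rho ^+ 2 - v ^+ 2))^-1 * (- (2 * v)).
  by rewrite /leg; field.
exact: (@is_derive1_comp R Num.sqrt (fun v : R => rho ^+ 2 - v ^+ 2) v _ _ i2 i1).
Qed.

(** The decreasing substitution u = leg v, with derivative - v / leg v; [b < rho] keeps away from
    the singularity at v = rho. *)
Lemma circle_substitution_seg (g : R -> R) b : continuous g -> 0 < b < rho ->
  (\int[mu]_(u in `[leg b, rho]) (g u)%:E =
   \int[mu]_(v in `[0%R, b]) (g (leg v) * (v / leg v))%:E)%E.
Proof.
move=> cg /andP[b0 br].
have der v : v \in `]-rho, rho[ -> (derive1 leg) v = - (v / leg v).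
  rewrite in_itv /= => hv; rewrite derive1E.
  by apply: derive_val; exact: is_derive_leg.
have inn v : 0 <= v <= b -> - rho < v < rho.
  by move=> /andP[v0 vb]; rewrite (lt_le_trans _ v0) ?oppr_lt0//= (le_lt_trans vb).
have cder : {in `]-rho, rho[, continuous (derive1 leg)}.
  move=> v hv.
  have cf : {for v, continuous (fun v : R => - (v / leg v))}.
    apply: cvgN; apply: cvgM; first exact: cvg_id.
    apply: cvgV; last exact: leg_continuous.
    by rewrite gt_eqF// sqrtr_gt0 leg_dom_gt0//; move: hv; rewrite in_itv.
  rewrite /prop_for /continuous_at der//.
  apply: cvg_trans cf; apply: near_eq_cvg.
  have := near_in_itvoo hv; apply: filterS => w hw.
  by rewrite der.
rewrite -[X in `[leg b, X]]leg0.
apply: (etrans (@integration_by_substitution_decreasing _ leg g 0 b _ _ _ _ _ _ _)).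
- exact: ltW.
- move=> u v; rewrite !in_itv /= => /andP[u0 ub] /andP[v0 vb] uv.
  by rewrite leg_anti// (le_trans _ (ltW br)).
- move=> v; rewrite in_itv /= => /andP[v0 vb]; apply: cder.
  by rewrite in_itv /= inn// !ltW.
- apply: cvgP; apply: cvg_at_right_filter; apply: cder.
  by rewrite in_itv /= inn// lexx ltW.
- apply: cvgP; apply: cvg_at_left_filter; apply: cder.
  by rewrite in_itv /= inn// lexx ltW.
- split.
  + move=> v; rewrite in_itv /= => /andP[v0 vb].
    have := @is_derive_leg v; rewrite inn ?ltW// => /(_ isT) h.
    exact: ex_derive.
  + by apply: cvg_at_right_filter; exact: leg_continuous.
  + by apply: cvg_at_left_filter; exact: leg_continuous.
- exact: continuous_subspaceT.
- apply: eq_integral => v; rewrite inE /= in_itv /= => hv.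
  rewrite -[X in X%:E = _]/(g (leg v) * - (derive1 leg v)) der ?opprK//.
  by rewrite in_itv /= inn.
Qed.


Definition leg_weight (v : R) : R := if v ^+ 2 < rho ^+ 2 then v / leg v else 0.

Lemma measurable_leg : measurable_fun setT leg.
Proof. exact: continuous_measurable_fun leg_continuous. Qed.

Lemma measurable_leg_weight : measurable_fun setT leg_weight.
Proof.
apply: measurable_fun_ifT.
- apply: measurable_fun_ltr; last exact: measurable_cst.
  exact: exprn_measurable.
- apply: measurable_funM; first exact: measurable_id.
  rewrite (_ : (fun v => (leg v)^-1) = (fun v => leg v `^ (-1))); last first.
    by apply/funext => v; rewrite powR_inv1// leg_ge0.
  exact: (measurableT_comp (measurable_powR _) measurable_leg).
- exact: measurable_cst.
Qed.

Lemma leg_weightE v : v \in `[0, rho[ -> leg_weight v = v / leg v.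
Proof.
rewrite in_itv /= => /andP[v0 vr]; rewrite /leg_weight ifT//.
by rewrite ltr_pXn2r// nnegrE// ltW.
Qed.

(** The segments [0, b_k] exhaust [0, rho[ and their images exhaust ]0, rho]. For nonnegative [g],
    monotone convergence carries the substitution past the unbounded weight. *)
Lemma circle_substitution_ge0 (g : R -> R) : continuous g -> (forall u, 0 <= g u) ->
  (\int[mu]_(u in `]0%R, rho]) (g u)%:E =
   \int[mu]_(v in `[0%R, rho[) (g (leg v) * leg_weight v)%:E)%E.
Proof.
move=> cg g0.
(* Increases to [rho]; starting at [k.+2] keeps [b 0] positive. *)
pose b k : R := rho * (1 - (k.+2%:R)^-1).
have bb k : 0 < b k < rho.
  have k2 : (k.+2%:R : R)^-1 < 1 by rewrite invf_lt1 ?ltr1n ?ltr0n.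
  have k1 : 0 < (k.+2%:R : R)^-1 by rewrite invr_gt0 ltr0n.
  rewrite /b mulr_gt0 ?subr_gt0//= mulrBr mulr1 gtrBl.
  exact: mulr_gt0.
have bmono j k : (j <= k)%N -> b j <= b k.
  move=> jk; rewrite /b ler_pM2l// lerD2l lerN2 lef_pV2 ?posrE ?ltr0n//.
  by rewrite ler_nat !ltnS.
have blim v : 0 <= v < rho -> exists k, v <= b k.
  move=> /andP[v0 vr].
  have d0 : 0 < (rho - v) / rho by rewrite divr_gt0// subr_gt0.
  pose k := Num.trunc ((rho - v) / rho)^-1; exists k.
  have := Num.Theory.truncnS_gt ((rho - v) / rho)^-1.
  rewrite -/k => kh.
  have hk : (k.+2%:R : R)^-1 <= (rho - v) / rho.
    rewrite invf_ple ?posrE ?ltr0n//.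
    by apply: (le_trans (ltW kh)); rewrite ler_nat.
  by move: hk; rewrite ler_pdivlMr// /b; move: (_^-1) => y hk; rewrite mulrC; nra.
pose U k : set R := [set` `[leg (b k), rho]].
pose V k : set R := [set` `[0%R, b k]].
have legin w : 0 <= w <= rho -> 0 <= leg w <= rho by rewrite leg_ge0 leg_le_rho.
have UE : \bigcup_k U k = [set` `]0%R, rho]].
  apply/seteqP; split => u /=; rewrite in_itv /=.
    case=> k _; rewrite /U /= in_itv /= => /andP[h ->]; rewrite andbT.
    have /andP[b0 br] := bb k.
    by apply: lt_le_trans h; apply: leg_gt0; rewrite br ltW.
  move=> /andP[u0 ur].
  have [|k hk] := blim (leg u).
    by rewrite leg_ge0 -leg0 leg_anti.
  have /andP[b0 br] := bb k.
  have uK : leg (leg u) = u by rewrite legK// ur ltW.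
  exists k => //; rewrite /U /= in_itv /= ur andbT -[X in _ <= X]uK.
  by apply: leg_le => //; [exact: leg_ge0|exact: ltW].
have VE : \bigcup_k V k = [set` `[0%R, rho[].
  apply/seteqP; split => v /=; rewrite in_itv /=.
    case=> k _; rewrite /V /= in_itv /= => /andP[-> h].
    by have /andP[b0 br] := bb k; exact: le_lt_trans h br.
  move=> h; have [k hk] := blim _ h; exists k => //.
  by rewrite /V /= in_itv /= hk; case/andP: h => ->.
have cU : (fun k => \int[mu]_(u in U k) (g u)%:E)%E @ \oo -->
    (\int[mu]_(u in `]0%R, rho]) (g u)%:E)%E.
  rewrite -UE; apply: ge0_nondecreasing_set_cvg_integral.
  - move=> j k jk; apply/subsetPset => u; rewrite /U /= !in_itv /=.
    move=> /andP[h ->]; rewrite andbT; apply: le_trans h.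
    have /andP[b0 br] := bb j; have /andP[_ br'] := bb k.
    by apply: leg_le; [exact: ltW|exact: bmono|exact: ltW].
  - by move=> k; exact: measurable_itv.
  - move=> k; apply: measurable_funTS; apply/measurable_EFinP.
    exact: continuous_measurable_fun.
  - by move=> k v _; rewrite lee_fin.
have cV : (fun k => \int[mu]_(u in V k) (g (leg u) * leg_weight u)%:E)%E @ \oo -->
    (\int[mu]_(v in `[0%R, rho[) (g (leg v) * leg_weight v)%:E)%E.
  rewrite -VE; apply: ge0_nondecreasing_set_cvg_integral.
  - move=> j k jk; apply/subsetPset => u; rewrite /V /= !in_itv /=.
    by move=> /andP[-> h]; exact: le_trans h (bmono _ _ jk).
  - by move=> k; exact: measurable_itv.
  - move=> k; apply: measurable_funTS; apply/measurable_EFinP.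
    apply: measurable_funM; last exact: measurable_leg_weight.
    apply: (measurableT_comp _ measurable_leg).
    exact: continuous_measurable_fun.
  - move=> k v; rewrite /V /= in_itv /= => /andP[v0 _].
    rewrite lee_fin mulr_ge0// /leg_weight; case: ifP => // _.
    by rewrite divr_ge0 ?leg_ge0.
have E : (fun k => \int[mu]_(u in U k) (g u)%:E)%E =
  (fun k => \int[mu]_(u in V k) (g (leg u) * leg_weight u)%:E)%E.
  apply/funext => k; rewrite /U (circle_substitution_seg cg (bb k)).
  apply: eq_integral => v; rewrite inE /= in_itv /= => /andP[v0 vb].
  have /andP[b0 br] := bb k.
  by rewrite leg_weightE// in_itv /= v0 (le_lt_trans vb br).
rewrite E in cU.
exact: (cvg_unique _ cU cV).
Qed.

Lemma leg_weight_ge0 v : 0 <= v -> 0 <= leg_weight v.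
Proof.
by move=> v0; rewrite /leg_weight; case: ifP => // _; rewrite divr_ge0 ?leg_ge0.
Qed.

Lemma circle_substitution (g : R -> R) : continuous g ->
  (\int[mu]_(u in `]0%R, rho[) (g u)%:E =
   \int[mu]_(v in `]0%R, rho[) (g (leg v) * leg_weight v)%:E)%E.
Proof.
move=> cg.
have mg (h : R -> R) : continuous h ->
    measurable_fun setT (fun v => (h (leg v) * leg_weight v)%:E).
  move=> ch; apply/measurable_EFinP.
  apply: measurable_funM; last exact: measurable_leg_weight.
  apply: (measurableT_comp _ measurable_leg).
  exact: continuous_measurable_fun.
rewrite -(integral_itv_bndoo false false); last first.
  by apply: measurable_funTS; apply/measurable_EFinP; exact: continuous_measurable_fun.
rewrite -[RHS](integral_itv_bndoo true true); last first.
  exact: measurable_funTS (mg _ cg).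
have c0 : continuous (fun _ : R => 0 : R) by exact: cst_continuous.
have key (h : R -> R) : continuous h ->
  (\int[mu]_(u in `]0%R, rho]) (Num.max (h u) 0)%:E =
   \int[mu]_(v in `[0%R, rho[) (Num.max (h (leg v) * leg_weight v)%R 0)%:E)%E.
  move=> ch; rewrite (@circle_substitution_ge0 (fun u => Num.max (h u) 0)).
  - apply: eq_integral => v; rewrite inE /= in_itv /= => /andP[v0 _].
    by rewrite maxr_pMl ?mul0r// leg_weight_ge0.
  - by move=> u; exact: (continuous_max (ch u) (c0 u)).
  - by move=> u; rewrite le_max lexx orbT.
rewrite integralE [RHS]integralE; congr (_ - _)%E.
  etransitivity; last etransitivity; last 2 first.
  - exact: (key g cg).
  - by apply: eq_integral => v _; rewrite funeposE EFin_max.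
  - by apply: eq_integral => v _; rewrite funeposE EFin_max.
etransitivity; last etransitivity; last 2 first.
- exact: (key _ (continuous_neg cg)).
- by apply: eq_integral => v _; rewrite funenegE EFin_max mulNr.
- by apply: eq_integral => v _; rewrite funenegE EFin_max.
Qed.

Lemma integral_fold (p : R -> R) : measurable_fun setT p ->
  (forall x, rho ^+ 2 <= x ^+ 2 -> p x = 0) ->
  (\int[mu]_x (p x)%:E = \int[mu]_(x in `]0%R, rho[) (p x)%:E +
                         \int[mu]_(x in `]0%R, rho[) (p (- x))%:E)%E.
Proof.
move=> mp p0.
have restr (h : R -> R) :
    (forall x, rho ^+ 2 <= x ^+ 2 -> h x = 0) ->
    (\int[mu]_(x in `]0%R, +oo[) (h x)%:E = \int[mu]_(x in `]0%R, rho[) (h x)%:E)%E.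
  move=> h0; rewrite integral_mkcond [RHS]integral_mkcond; apply: eq_integral => x _.
  rewrite !patchE !mem_setE !in_itv /= andbT.
  have [x0|//] := ltP 0 x; have [//|xr] := ltP x rho.
  by rewrite h0// ler_pXn2r// nnegrE// ltW.
rewrite integral_half// restr// (restr (fun x => p (- x)))// => x.
by rewrite -[x ^+ 2]sqrrN; exact: p0.
Qed.

Lemma integral_leg_weight :
  (\int[mu]_(v in `]0%R, rho[) (leg_weight v)%:E = rho%:E)%E.
Proof.
transitivity (\int[mu]_(v in `]0%R, rho[) (1 * leg_weight v)%:E)%E.
  by apply: eq_integral => v _; rewrite mul1r.
rewrite -(@circle_substitution (fun=> 1)); last exact: cst_continuous.
rewrite integral_cst//= mul1e lebesgue_measure_itv /= lte_fin rho0.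
by rewrite oppr0 adde0.
Qed.

Lemma legN v : leg (- v) = leg v. Proof. by rewrite /leg sqrrN. Qed.

Lemma leg_weightN v : leg_weight (- v) = - leg_weight v.
Proof. by rewrite /leg_weight sqrrN legN mulNr; case: ifP => // _; rewrite oppr0. Qed.

Lemma leg_weight_eq0 v : rho ^+ 2 <= v ^+ 2 -> leg_weight v = 0.
Proof. by rewrite /leg_weight; case: ltP. Qed.

Lemma integral_abs_leg_weight :
  (\int[mu]_v (`|leg_weight v|)%:E = (rho *+ 2)%:E)%E.
Proof.
have E : (\int[mu]_(v in `]0%R, rho[) (`|leg_weight v|)%:E = rho%:E)%E.
  rewrite -integral_leg_weight; apply: eq_integral => v.
  rewrite inE /= in_itv /= => /andP[v0 _].
  by rewrite ger0_norm// leg_weight_ge0// ltW.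
rewrite integral_fold.
- rewrite [X in (_ + X)%E](_ : _ = \int[mu]_(v in `]0%R, rho[) (`|leg_weight v|)%:E)%E.
    by rewrite E -EFinD mulr2n.
  by apply: eq_integral => v _; rewrite leg_weightN normrN.
- exact: measurableT_comp measurable_leg_weight.
- by move=> x h; rewrite leg_weight_eq0// normr0.
Qed.

Lemma leg_sq v : v ^+ 2 <= rho ^+ 2 -> leg v ^+ 2 = rho ^+ 2 - v ^+ 2.
Proof. by move=> h; rewrite sqr_sqrtr// subr_ge0. Qed.

(** The flux of [G] in the direction v through a circle, first over the chart u = +-leg v, then over
    v = +-leg u. Folded onto ]0, rho[, either side is an integral of the signed sum of [G] over the
    four points (+-u, +-leg u), since the weight is odd; the substitution matches them. The bound
    [C] provides the integrability required to split the integrals. *)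
Lemma circle_flux (G : R -> R -> R) (C : R) :
  (forall a b : R -> R, continuous a -> continuous b ->
     continuous (fun t => G (a t) (b t))) ->
  (forall u v, u ^+ 2 + v ^+ 2 <= rho ^+ 2 -> `|G u v| <= C) ->
  (\int[mu]_v ((G (leg v) v + G (- leg v) v) * leg_weight v)%:E =
   \int[mu]_u (if u ^+ 2 < rho ^+ 2 then G u (leg u) - G u (- leg u) else 0)%:E)%E.
Proof.
move=> cG bG.
pose g u := G u (leg u) + G (- u) (leg u) - G u (- leg u) - G (- u) (- leg u).
have ci : continuous (fun u : R => u) by move=> u; exact: cvg_id.
have cl := leg_continuous; have cN (a : R -> R) := @continuous_neg _ _ a.
have cg : continuous g.
  by apply: continuous_add; [apply: continuous_add; [apply: continuous_add|]|];
    try (apply: (continuous_neg)); apply: cG => //; exact: continuous_neg.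
have mG (a b : R -> R) : continuous a -> continuous b ->
    measurable_fun setT (fun t => G (a t) (b t)).
  by move=> ca cb; exact: continuous_measurable_fun (cG _ _ ca cb).
have cNi := continuous_neg ci; have cNl := continuous_neg cl.
have inD u : 0 < u -> u < rho -> u ^+ 2 < rho ^+ 2.
  by move=> u0 ur; rewrite ltr_pXn2r// nnegrE// ltW.
have C0 : 0 <= C.
  by apply: (le_trans (normr_ge0 (G 0 0))); apply: bG; rewrite expr0n/= addr0 sqr_ge0.
pose w v := (G (leg v) v + G (- leg v) v) * leg_weight v.
have mw : measurable_fun setT w.
  by apply: measurable_funM measurable_leg_weight; apply: measurable_funD; exact: mG.
have wb v : `|w v| <= (C *+ 2) * `|leg_weight v|.
  rewrite /w normrM; have [h|h] := ltP (v ^+ 2) (rho ^+ 2); last first.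
    by rewrite leg_weight_eq0// normr0 !mulr0.
  rewrite ler_wpM2r// (le_trans (ler_normD _ _))// mulr2n lerD// bG//;
    by rewrite ?sqrrN leg_sq ?subrK// ltW.
pose p u := if u ^+ 2 < rho ^+ 2 then G u (leg u) - G u (- leg u) else 0.
have mp : measurable_fun setT p.
  apply: measurable_fun_ifT => //.
    by apply: measurable_fun_ltr => //; exact: exprn_measurable.
  by apply: measurable_funB; exact: mG.
have pb u : `|p u| <= C *+ 2.
  rewrite /p; case: ifP => [h|_]; last by rewrite normr0 mulrn_wge0.
  rewrite (le_trans (ler_normB _ _))// mulr2n lerD// bG//;
    by rewrite ?sqrrN leg_sq ?[_ + (_ - _)]addrC ?subrK// ltW.
have mN (h : R -> R) : measurable_fun setT h -> measurable_fun setT (fun x : R => h (- x)).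
  by move=> mh; exact: (measurableT_comp mh (@oppr_measurable R setT)).
have iw (h : R -> R) : measurable_fun setT h ->
    (forall v, `|h v| <= C *+ 2 * `|leg_weight v|) ->
    mu.-integrable `]0%R, rho[ (EFin \o h).
  move=> mh hb.
  apply: (@le_integrable _ _ _ mu _ _ _ (fun v => (C *+ 2 * leg_weight v)%:E)) => //.
  - by apply: measurable_funTS; exact/measurable_EFinP.
  - move=> v /= hv; rewrite lee_fin (le_trans (hb v))// normrM ler_wpM2r//.
    by rewrite ler_norm.
  apply/integrableP; split.
    apply: measurable_funTS; apply/measurable_EFinP.
    by apply: measurable_funM => //; exact: measurable_leg_weight.
  rewrite (_ : (\int[mu]_(x in _) _ = (C *+ 2)%:E * rho%:E)%E) ?ltry//.
  rewrite -integral_leg_weight -ge0_integralZl//.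
  - apply: eq_integral => v; rewrite inE /= in_itv /= => /andP[v0 _].
    by rewrite ger0_norm ?EFinM// mulr_ge0 ?mulrn_wge0 ?leg_weight_ge0// ltW.
  - by apply: measurable_funTS; apply/measurable_EFinP; exact: measurable_leg_weight.
  - by move=> v; rewrite /= in_itv /= => /andP[v0 _]; rewrite lee_fin leg_weight_ge0// ltW.
  - by rewrite lee_fin mulrn_wge0.
have ip (h : R -> R) : measurable_fun setT h -> (forall v, `|h v| <= C *+ 2) ->
    mu.-integrable `]0%R, rho[ (EFin \o h).
  move=> mh hb.
  apply: (@le_integrable _ _ _ mu _ _ _ (fun v => (C *+ 2)%:E)) => //.
  - by apply: measurable_funTS; exact/measurable_EFinP.
  - move=> v _ /=; rewrite lee_fin (le_trans (hb v))//; exact: ler_norm.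
  apply/integrableP; split; first exact: measurable_cst.
  rewrite integral_cst//= lebesgue_measure_itv /= lte_fin rho0.
  by rewrite oppr0 adde0 -EFinM ltry.
transitivity (\int[mu]_(u in `]0%R, rho[) (g u)%:E)%E; last first.
  rewrite [RHS](integral_fold mp); last first.
    by move=> x; rewrite /p; case: ltP.
  rewrite -integralD//=; first last.
  - by apply: (ip (fun x => p (- x))) => //; exact: mN.
  - exact: ip.
  apply: eq_integral => u; rewrite inE /= in_itv /= => /andP[u0 ur].
  by rewrite /p sqrrN (inD u)// legN /g -EFinD; congr (_%:E); ring.
rewrite (circle_substitution cg) (integral_fold mw); last first.
  by move=> x h; rewrite /w leg_weight_eq0// mulr0.
rewrite -integralD//=; first last.
- apply: (iw (fun x => w (- x))); first exact: mN.
  by move=> v; rewrite (le_trans (wb _))// leg_weightN normrN.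
- exact: iw.
apply: eq_integral => u; rewrite inE /= in_itv /= => /andP[u0 ur].
rewrite /w leg_weightN legN /g legK ?(ltW u0) ?(ltW ur)//.
by rewrite -EFinD; congr (_%:E); ring.
Qed.

End CircleSubstitution.

(** * Integration over balls *)

Section ProductIntegrable.
Context {R : realType}.
Local Notation mu := (@lebesgue_measure R).
Local Notation T := (measurableTypeR R).

Lemma measurable_tnth_prod n (u : R -> R) : measurable_fun setT u ->
  measurable_fun setT (fun t : n.-tuple T => \prod_i u (tnth t i)).
Proof.
move=> mu_; elim: (index_enum _) => [|i s IH].
  by under eq_fun do rewrite big_nil; exact: measurable_cst.
under eq_fun do rewrite big_cons; apply: measurable_funM => //.
exact: (measurableT_comp mu_ (measurable_tnth i)).
Qed.

(** Source of dominating functions on R^n: products of indicators for balls, products of power tails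
    at infinity. *)
Lemma prod_integrable n (u : R -> R) : measurable_fun setT u ->
  (forall x, 0 <= u x) -> (\int[mu]_x (u x)%:E < +oo)%E ->
  (leb R n).-integrable setT (fun t => (\prod_i u (tnth t i))%:E).
Proof.
move=> mu_ u0 uoo.
have p0 k (t : k.-tuple T) : 0 <= \prod_i u (tnth t i) by exact: prodr_ge0.
have mp k := @measurable_tnth_prod k u mu_.
have me k : measurable_fun setT (fun t : k.-tuple T => (\prod_i u (tnth t i))%:E).
  by apply/measurable_EFinP; exact: mp.
apply/integrableP; split; first exact: me.
under eq_integral do rewrite gee0_abs ?lee_fin//.
elim: n => [|n IH].
  rewrite /leb /= integral_dirac//; last exact: me.
  by rewrite diracT mul1e ltry.
rewrite (leb_ins_tonelli ord0) => //; last by move=> t; rewrite lee_fin.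
rewrite (_ : integral _ _ _ = (\int[leb R n]_z
    ((\int[mu]_x (u x)%:E) * (\prod_i u (tnth z i))%:E))%E); last first.
  apply: eq_integral => z _; rewrite muleC -ge0_integralZl//.
  - apply: eq_integral => x _; rewrite -EFinM big_ord_recl; congr (_%:E).
    rewrite mulrC tnth_mktuple unlift_none; congr (_ * _).
    by apply: eq_bigr => i _; rewrite tnth_mktuple liftK.
  - exact/measurable_EFinP.
  - by move=> x _; rewrite lee_fin.
  - by rewrite lee_fin.
rewrite ge0_integralZl//.
- by rewrite lte_mul_pinfty ?integral_ge0// ?ge0_fin_numE// ?integral_ge0// => x _; rewrite lee_fin.
- exact: me.
- by move=> t _; rewrite lee_fin.
- by apply: integral_ge0 => x _; rewrite lee_fin.
Qed.

End ProductIntegrable.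

(** * Chords of a ball and the caps of its boundary *)

Section BallDivergence.
Context {R : realType}.
Local Notation mu := (@lebesgue_measure R).
Local Notation T := (measurableTypeR R).

Lemma dotv_ins n (i : 'I_n.+1) x (w : 'rV[R]_n) :
  dotv (insr i x w) (insr i x w) = x ^+ 2 + dotv w w.
Proof.
rewrite /dotv (bigD1_ord i)//= !mxE unlift_none expr2; congr (_ + _).
by apply: eq_bigr => k _; rewrite !mxE liftK.
Qed.

Lemma insr_swap n (j : 'I_n.+1) u v (z : 'rV[R]_n) :
  insr (lift ord0 j) v (insr ord0 u z) = insr ord0 u (insr j v z).
Proof.
apply/rowP => l; rewrite !mxE.
case: (unliftP ord0 l) => [l'|] ->.
  case: (unliftP j l') => [l''|] ->.
    have E : lift ord0 (lift j l'') = lift (lift ord0 j) (lift ord0 l'').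
      by apply: val_inj; rewrite /= /bump /= !add1n ltnS addnS.
    by transitivity (z 0 l''); [rewrite E liftK mxE liftK|rewrite mxE liftK].
  by rewrite unlift_none mxE unlift_none.
have E : (ord0 : 'I_n.+2) = lift (lift ord0 j) ord0 by exact: val_inj.
by rewrite [X in unlift (lift _ _) X]E liftK mxE unlift_none.
Qed.

Lemma insr_line n (i : 'I_n.+1) x (w : 'rV[R]_n) :
  insr i x w = insr i 0 w + x *: delta_mx 0 i.
Proof.
apply/rowP => j; rewrite !mxE eqxx /=.
case: (unliftP i j) => [k|] ->.
  by rewrite eq_sym (negbTE (neq_lift _ _)) mulr0 addr0.
by rewrite eqxx mulr1 add0r.
Qed.

Lemma continuous_insr n (S : topologicalType) (i : 'I_n.+1) (a : S -> R) (h : S -> 'rV[R]_n) :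
  continuous a -> (forall k, continuous (fun s => h s 0 k)) ->
  continuous (fun s => insr i (a s) (h s)).
Proof.
move=> ca ch; apply: mx_continuous => o j.
rewrite (_ : (fun _ => _) = fun s => if unlift i j is Some j' then h s 0 j' else a s).
  by case: (unlift i j).
by apply/funext => s; rewrite mxE.
Qed.

Lemma continuous_coord n (k : 'I_n) : continuous (fun y : 'rV[R]_n => y 0 k).
Proof. exact: coord_continuous. Qed.

Lemma continuous_dotv n : continuous (fun y : 'rV[R]_n => dotv y y).
Proof.
by apply: continuous_bigsum => k; apply: continuous_mul; exact: continuous_coord.
Qed.

Definition hgt n (r : R) (y : 'rV[R]_n) : R := Num.sqrt (r ^+ 2 - dotv y y).

Lemma continuous_hgt n r : continuous (@hgt n r).
Proof.
have c : continuous (fun y : 'rV[R]_n => r ^+ 2 - dotv y y).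
  apply: continuous_add; first exact: cst_continuous.
  by apply: continuous_neg; exact: continuous_dotv.
by move=> v; exact: (continuous_comp (c v) (@sqrt_continuous R _)).
Qed.

Lemma hgt_ins n r (i : 'I_n.+1) x (w : 'rV[R]_n) : dotv w w < r ^+ 2 ->
  hgt r (insr i x w) = leg (hgt r w) x.
Proof.
move=> h; rewrite /hgt /leg dotv_ins sqr_sqrtr ?subr_ge0 ?ltW//.
by congr Num.sqrt; ring.
Qed.

Definition cutoff n (r : R) (h : 'rV[R]_n -> R) (y : 'rV[R]_n) : R :=
  if dotv y y < r ^+ 2 then h y else 0.

Lemma coord_le_dotv n (y : 'rV[R]_n) k : (y 0 k) ^+ 2 <= dotv y y.
Proof.
rewrite /dotv (bigD1 k)//= expr2 lerDl.
by apply: sumr_ge0 => l _; rewrite -expr2 sqr_ge0.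
Qed.

Lemma measurable_cutoff n r (h : 'rV[R]_n -> R) :
  measurable_fun setT (fun t : n.-tuple T => h (rv t)) ->
  measurable_fun setT (fun t : n.-tuple T => cutoff r h (rv t)).
Proof.
move=> mh; apply: measurable_fun_ifT => //.
apply: measurable_fun_ltr; last exact: measurable_cst.
exact: continuous_rv_measurable (@continuous_dotv n).
Qed.

Lemma cutoff_integrable n r (h : 'rV[R]_n -> R) C : 0 <= r ->
  measurable_fun setT (fun t : n.-tuple T => h (rv t)) ->
  (forall y, dotv y y < r ^+ 2 -> `|h y| <= C) ->
  (leb R n).-integrable setT (fun t => (cutoff r h (rv t))%:E).
Proof.
move=> r0 mh hC.
(* The ball lies in the cube [-r, r]^n, whose indicator is a product. *)
pose u (x : R) : R := (\1_([set` `[- r, r]]) x)%R.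
have mu_ : measurable_fun setT u by apply: measurable_indic; exact: measurable_itv.
have u0 x : 0 <= u x by rewrite /u indicE.
have uoo : (\int[mu]_x (u x)%:E < +oo)%E.
  rewrite integral_indic//= setIT.
  by rewrite lebesgue_measure_itv /=; case: ifP => _; rewrite ltry.
have ip := @prod_integrable _ n u mu_ u0 uoo.
have ipC : (leb R n).-integrable setT (fun t => (`|C|%:E * (\prod_i u (tnth t i))%:E)%E).
  exact: integrableZl.
apply: (le_integrable _ _ _ ipC) => //.
  by apply/measurable_EFinP; exact: measurable_cutoff.
move=> t _; rewrite -EFinM lee_fin normrM normr_id [X in _ <= _ * X]ger0_norm ?prodr_ge0//.
rewrite /cutoff; case: ifP => [tr|_]; last by rewrite normr0 mulr_ge0// prodr_ge0.
rewrite big1 ?mulr1; first by rewrite (le_trans (hC _ tr))// ler_norm.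
move=> i _; rewrite /u indicE mem_set//= in_itv /= -ler_norml.
rewrite -(ger0_norm r0) -ler_sqr ?nnegrE// !real_normK ?num_real//.
by apply: le_trans (ltW tr); have := coord_le_dotv (rv t) i; rewrite mxE.
Qed.

Lemma bounded_on_ball n (h : 'rV[R]_n -> R) r : continuous h ->
  exists C, forall y, dotv y y <= r ^+ 2 -> `|h y| <= C.
Proof.
move=> ch; pose A := [set y : 'rV[R]_n | dotv y y <= r ^+ 2].
have A0 : A !=set0.
  by exists 0; rewrite /A /= /dotv big1 ?sqr_ge0// => k _; rewrite mxE mul0r.
have cA : compact A.
  apply: bounded_closed_compact.
    exists `|r|; split; first exact: num_real.
    move=> M rM y /= yA; have M0 : 0 <= M by exact: le_trans (normr_ge0 r) (ltW rM).
    rewrite -[leLHS]/(mx_norm y).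
    have [->//|/mx_norm_neq0[[i k] ->]] := eqVneq (mx_norm y) 0.
    rewrite /= ord1 (le_trans _ (ltW rM))// -ler_sqr ?nnegrE// !real_normK ?num_real//.
    exact: le_trans (coord_le_dotv _ _) yA.
  rewrite (_ : A = (fun y => dotv y y) @^-1` [set` `]-oo, r ^+ 2]]).
    apply: closed_comp; last exact: interval_closed.
    by move=> y _; exact: continuous_dotv.
  by apply/seteqP; split => y; rewrite /A /= in_itv.
have [c _ cmax] := EVT_max_rV A0 cA (continuous_subspaceT
   (fun x => continuous_comp (ch x) (@norm_continuous _ _ _))).
by exists `|h c| => y yA; apply: cmax; rewrite inE.
Qed.

Lemma cutoff_continuous_integrable n r (h : 'rV[R]_n -> R) : 0 <= r -> continuous h ->
  (leb R n).-integrable setT (fun t => (cutoff r h (rv t))%:E).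
Proof.
move=> r0 ch; have [C hC] := bounded_on_ball r ch.
apply: (cutoff_integrable r0 (continuous_rv_measurable ch)).
by move=> y /ltW; exact: hC.
Qed.

Lemma ball_pd n (i : 'I_n.+1) (X : 'rV[R]_n.+1 -> R) r : 0 <= r -> C1 X ->
  (\int[leb R n.+1]_t (cutoff r (pd i X) (rv t))%:E =
   \int[leb R n]_t (cutoff r (fun w => X (insr i (hgt r w) w)
                                  - X (insr i (- hgt r w) w)) (rv t))%:E)%E.
Proof.
move=> r0 cX; have cX0 : continuous X by exact: C1_continuous.
have cpd : continuous (pd i X) by exact: C1_continuous_pd.
rewrite (leb_ins_fubini i); last exact: cutoff_continuous_integrable.
apply: eq_integral => z _; rewrite /cutoff.
under eq_integral do rewrite rv_ins dotv_ins /=.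
set w := rv z; case: ltP => [wr|wr]; last first.
  under eq_integral => x _.
    rewrite ltNge (le_trans wr) ?lerDr ?sqr_ge0//=; over.
  by rewrite integral0.
pose s := hgt r w.
have s0 : 0 < s by rewrite sqrtr_gt0 subr_gt0.
have s2 : s ^+ 2 = r ^+ 2 - dotv w w by rewrite sqr_sqrtr ?subr_ge0 ?ltW.
have line x : insr i x w = insr i 0 w + x *: delta_mx 0 i := insr_line i x w.
have cl : continuous (fun x : R => insr i x w).
  by apply: continuous_insr => [x|k]; [exact: cvg_id|exact: cst_continuous].
have cp : continuous (fun x : R => pd i X (insr i x w)).
  by move=> x; exact: (continuous_comp (cl x) (cpd _)).
have cF : continuous (fun x : R => X (insr i x w)).
  by move=> x; exact: (continuous_comp (cl x) (cX0 _)).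
have dF (x : R) : is_derive x 1 (fun x : R => X (insr i x w)) (pd i X (insr i x w)).
  rewrite (_ : (fun _ => _) = fun x => X (insr i 0 w + x *: delta_mx 0 i)).
    by rewrite (line x); exact: (is_derive_line i (insr i 0 w) x cX).
  by apply/funext => y; rewrite line.
transitivity (\int[mu]_(x in `](- s)%R, s[) (pd i X (insr i x w))%:E)%E.
  rewrite [RHS]integral_mkcond; apply: eq_integral => x _.
  rewrite patchE mem_setE in_itv /= -ltr_norml -ltrBrDr -s2.
  by rewrite -(ltr_sqr (normr_nneg _)) ?nnegrE ?ltW// real_normK ?num_real//; case: ifP.
rewrite -(integral_itv_bndoo true false); last first.
  apply: measurable_funTS; apply/measurable_EFinP.
  exact: continuous_measurable_fun.
rewrite (@continuous_FTC2 _ (fun x => pd i X (insr i x w)) (fun x => X (insr i x w))) //.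
- by rewrite gtrN.
- exact: continuous_subspaceT.
- split.
  + by move=> x _; exact: ex_derive.
  + by apply: cvg_at_right_filter; exact: cF.
  + by apply: cvg_at_left_filter; exact: cF.
- by move=> x _; rewrite derive1E; exact: derive_val.
Qed.

(** The normal component y_j / r times the area density r / [hgt r y] of the hemisphere, extended by
    0. *)
Definition slope n (j : 'I_n) (r : R) : 'rV[R]_n -> R :=
  cutoff r (fun y => y 0 j / hgt r y).

Lemma slope_ins n (j : 'I_n.+1) r v (z : 'rV[R]_n) : dotv z z < r ^+ 2 ->
  slope j r (insr j v z) = leg_weight (hgt r z) v.
Proof.
move=> zr; rewrite /slope /cutoff /leg_weight dotv_ins hgt_ins// mxE unlift_none.
by rewrite -ltrBrDr sqr_sqrtr// subr_ge0 ltW.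
Qed.

Lemma slope_eq0 n (j : 'I_n) r (y : 'rV[R]_n) : r ^+ 2 <= dotv y y ->
  slope j r y = 0.
Proof. by rewrite /slope /cutoff; case: ltP. Qed.

Lemma measurable_slope n (j : 'I_n) r :
  measurable_fun setT (fun t : n.-tuple T => slope j r (rv t)).
Proof.
apply: measurable_cutoff; apply: measurable_funM.
  exact: continuous_rv_measurable (@continuous_coord n j).
rewrite (_ : (fun t => (hgt r (rv t))^-1) =
             fun t : n.-tuple T => hgt r (rv t) `^ (-1)); last first.
  by apply/funext => v; rewrite powR_inv1// sqrtr_ge0.
apply: (measurableT_comp (measurable_powR _)).
exact: continuous_rv_measurable (@continuous_hgt n r).
Qed.

(** Unbounded at the equator, but along coordinate [j] its absolute value integrates to twice the
    height over the remaining coordinates, a bounded function. *)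
Lemma slope_integrable n (j : 'I_n.+1) r : 0 <= r ->
  (leb R n.+1).-integrable setT (fun t => (slope j r (rv t))%:E).
Proof.
move=> r0; have ms := measurable_slope j r.
have c2 : continuous (fun z : 'rV[R]_n => hgt r z *+ 2).
  rewrite (_ : (fun _ => _) = fun z => hgt r z * 2).
    apply: continuous_mul; [exact: continuous_hgt|exact: cst_continuous].
  by apply/funext => z; rewrite mulr_natr.
have /integrableP[_ h] := cutoff_continuous_integrable r0 c2.
apply/integrableP; split; first exact/measurable_EFinP.
rewrite (leb_ins_tonelli j)//; last first.
  by apply/measurable_EFinP; exact: measurableT_comp.
move: h; congr (_ < _)%E; apply: eq_integral => t _; rewrite /cutoff.
under [RHS]eq_integral do rewrite rv_ins /=.
case: ltP => [tr|tr]; last first.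
  rewrite /= normr0; under eq_integral => x _.
    rewrite slope_eq0 ?dotv_ins ?(le_trans tr) ?lerDr ?sqr_ge0//= normr0; over.
  by rewrite integral0.
under [RHS]eq_integral do rewrite slope_ins//.
rewrite integral_abs_leg_weight ?sqrtr_gt0 ?subr_gt0//.
by rewrite /= ger0_norm// mulrn_wge0// sqrtr_ge0.
Qed.

Lemma hgt_dotv n r (y : 'rV[R]_n) : dotv y y < r ^+ 2 ->
  hgt r y ^+ 2 + dotv y y = r ^+ 2.
Proof. by move=> yr; rewrite sqr_sqrtr ?subrK// subr_ge0 ltW. Qed.

Lemma continuous_cap n (X : 'rV[R]_n.+1 -> R) r (i : 'I_n.+1) : continuous X ->
  continuous (fun y => X (insr i (hgt r y) y)) /\
  continuous (fun y => X (insr i (- hgt r y) y)).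
Proof.
move=> cX.
have c1 : continuous (fun y => insr i (@hgt n r y) y).
  by apply: continuous_insr => [|k]; [exact: continuous_hgt|exact: continuous_coord].
have c2 : continuous (fun y => insr i (- @hgt n r y) y).
  apply: continuous_insr => [|k]; last exact: continuous_coord.
  by apply: continuous_neg; exact: continuous_hgt.
by split=> y; [exact: (continuous_comp (c1 y) (cX _))|
               exact: (continuous_comp (c2 y) (cX _))].
Qed.

Lemma slope_cap_integrable n (j : 'I_n.+1) (X : 'rV[R]_n.+2 -> R) r s : 0 <= r ->
  continuous X -> `|s| = 1 ->
  (leb R n.+1).-integrable setT
    (fun t => (X (insr ord0 (s * hgt r (rv t)) (rv t)) * slope j r (rv t))%:E).
Proof.
move=> r0 cX s1; have [C hC] := bounded_on_ball r cX.
have iC : (leb R n.+1).-integrable setT (fun t => (C%:E * (slope j r (rv t))%:E)%E).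
  exact: integrableZl (slope_integrable j r0).
have s2 : s ^+ 2 = 1 by rewrite -(@real_normK _ s) ?num_real// s1 expr1n.
apply: (le_integrable _ _ _ iC) => //.
  apply/measurable_EFinP; apply: measurable_funM; last exact: measurable_slope.
  have c1 : continuous (fun y => insr ord0 (s * @hgt n.+1 r y) y).
    apply: continuous_insr => [|k]; last exact: continuous_coord.
    by apply: continuous_mul; [exact: cst_continuous|exact: continuous_hgt].
  have c2 : continuous (fun y => X (insr ord0 (s * @hgt n.+1 r y) y)).
    by move=> y; exact: (continuous_comp (c1 y) (cX _)).
  exact: continuous_rv_measurable c2.
move=> t _; rewrite -EFinM lee_fin !normrM.
have [tr|tr] := ltP (dotv (rv t) (rv t)) (r ^+ 2); last first.
  by rewrite slope_eq0// normr0 !mulr0.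
rewrite ler_wpM2r// (le_trans _ (ler_norm _))// hC//.
by rewrite dotv_ins exprMn s2 mul1r hgt_dotv.
Qed.

(** With the remaining coordinates z fixed, both sides are integrals over the circle of radius
    [hgt r z]. The right side is the form that [ball_pd] gives to a derivative in the direction
    [lift ord0 j]. *)
Lemma ball_side n (j : 'I_n.+1) (X : 'rV[R]_n.+2 -> R) r : 0 <= r -> continuous X ->
  (\int[leb R n.+1]_t ((X (insr ord0 (hgt r (rv t)) (rv t)) +
      X (insr ord0 (- hgt r (rv t)) (rv t))) * slope j r (rv t))%:E =
   \int[leb R n.+1]_t (cutoff r (fun w => X (insr (lift ord0 j) (hgt r w) w)
      - X (insr (lift ord0 j) (- hgt r w) w)) (rv t))%:E)%E.
Proof.
move=> r0 cX; have [C hC] := bounded_on_ball r cX.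
rewrite (leb_ins_fubini j); last first.
  have i1 := slope_cap_integrable j r0 cX (normr1 R).
  have i2 := slope_cap_integrable j r0 cX (normrN1 R).
  rewrite (_ : (fun _ => _) = (fun t =>
      (X (insr ord0 (1 * hgt r (rv t)) (rv t)) * slope j r (rv t))%:E +
      (X (insr ord0 (- 1 * hgt r (rv t)) (rv t)) * slope j r (rv t))%:E)%E).
    exact: integrableD.
  by apply/funext => t; rewrite -EFinD mul1r mulN1r mulrDl.
rewrite (leb_ins_fubini ord0); last first.
  have [c1 c2] := continuous_cap r (lift ord0 j) cX.
  apply: cutoff_continuous_integrable => //.
  by apply: continuous_add => //; exact: continuous_neg.
apply: eq_integral => t _.
under eq_integral do rewrite rv_ins /=.
under [RHS]eq_integral do rewrite rv_ins /=.
set z := rv t.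
have [zr|zr] := ltP (dotv z z) (r ^+ 2); last first.
  rewrite [LHS](_ : _ = 0%E); last first.
    under eq_integral => x _.
      rewrite slope_eq0 ?dotv_ins ?(le_trans zr) ?lerDr ?sqr_ge0//= mulr0; over.
    by rewrite integral0.
  rewrite [RHS](_ : _ = 0%E)//.
  under eq_integral => x _.
    rewrite /cutoff ltNge dotv_ins (le_trans zr) ?lerDr ?sqr_ge0//=; over.
  by rewrite integral0.
set rho := hgt r z.
have rho0 : 0 < rho by rewrite sqrtr_gt0 subr_gt0.
have rho2 : rho ^+ 2 = r ^+ 2 - dotv z z by rewrite sqr_sqrtr// subr_ge0 ltW.
pose G u v := X (insr ord0 u (insr j v z)).
transitivity (\int[mu]_v ((G (leg rho v) v + G (- leg rho v) v) * leg_weight rho v)%:E)%E.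
  by apply: eq_integral => v _; rewrite slope_ins// hgt_ins.
rewrite (@circle_flux _ rho rho0 G C).
- apply: eq_integral => u _.
  by rewrite /cutoff dotv_ins hgt_ins// !insr_swap rho2 ltrBrDr.
- move=> a b ca cb.
  have c1 : continuous (fun x => insr ord0 (a x) (insr j (b x) z)).
    apply: continuous_insr => // k.
    rewrite (_ : (fun _ => _) = fun x => if unlift j k is Some k' then z 0 k' else b x).
      by case: (unlift j k) => // k'; exact: cst_continuous.
    by apply/funext => x; rewrite mxE.
  by move=> x; exact: (continuous_comp (c1 x) (cX _)).
- by move=> u v uv; apply: hC; rewrite !dotv_ins addrA -lerBrDr -rho2.
Qed.

End BallDivergence.

(** * The divergence theorem on balls *)

Lemma Rintegral_sum d (T : measurableType d) (R : realType)
    (m : {measure set T -> \bar R}) (D : set T) (I : finType) (F : I -> T -> R) :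
  measurable D -> (forall i, m.-integrable D (EFin \o F i)) ->
  \int[m]_(x in D) (\sum_i F i x) = \sum_i \int[m]_(x in D) F i x.
Proof.
move=> mD iF; rewrite /Rintegral.
under eq_integral do rewrite -sumEFin.
rewrite integral_sum// sum_fine// => i _.
exact: (integrable_fin_num mD (iF i)).
Qed.

Section SphereDivergence.
Context {R : realType}.
Local Notation T := (measurableTypeR R).

Lemma enorm_sq n (y : 'rV[R]_n) : enorm y ^+ 2 = dotv y y.
Proof. by rewrite sqr_sqrtr// dotv_ge0. Qed.

Lemma enorm_lt n (y : 'rV[R]_n) r : 0 <= r -> (enorm y < r) = (dotv y y < r ^+ 2).
Proof. by move=> r0; rewrite -enorm_sq ltr_pXn2r// nnegrE// sqrtr_ge0. Qed.

Lemma sphere_pointE n (r : R) lower (y : 'rV[R]_n.+1) :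
  @sphere_point R n.+2 r lower y = insr ord0 ((-1) ^+ lower * hgt r y) y.
Proof.
rewrite /sphere_point conform_mx_id; apply/rowP => i; rewrite [RHS]mxE.
case: (unliftP ord0 i) => [j|] -> /=.
  have -> : lift ord0 j = rshift 1 j by exact: val_inj.
  exact: row_mxEr.
have -> : ord0 = lshift n.+1 (ord0 : 'I_1) by exact: val_inj.
by apply: (etrans (row_mxEl _ _ _ _)); rewrite mxE enorm_sq.
Qed.

(** Along the i-th axis the height is [leg] for the circle of radius [hgt r w], so the difference
    quotients are those of one variable. *)
Lemma pd_hgt n (r c : R) (i : 'I_n.+1) (y : 'rV[R]_n.+1) : dotv y y < r ^+ 2 ->
  pd i (fun y => c * hgt r y) y = - (c * (y 0 i / hgt r y)).
Proof.
move=> yr; pose w := \row_k y 0 (lift i k).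
have yE : y = insr i (y 0 i) w.
  by apply/rowP => j; rewrite !mxE; case: unliftP => [k|] -> //; rewrite mxE.
have dy : dotv y y = y 0 i ^+ 2 + dotv w w by rewrite {1 2}yE dotv_ins.
have wr : dotv w w < r ^+ 2 by apply: le_lt_trans yr; rewrite dy lerDr sqr_ge0.
pose rho := hgt r w.
have rho0 : 0 < rho by rewrite sqrtr_gt0 subr_gt0.
have hl x : hgt r (insr i x w) = leg rho x by rewrite hgt_ins.
have yi : - rho < y 0 i < rho.
  rewrite -ltr_norml -(ltr_sqr (normr_nneg _)) ?nnegrE ?ltW// real_normK ?num_real//.
  by rewrite sqr_sqrtr ?subr_ge0 ?ltW// ltrBrDr -dy.
have d1 := @is_deriveZ R _ _ _ c _ _ _ (is_derive_leg yi).
pose h (y : 'rV[R]_n.+1) : R := c * hgt r y; pose g : R -> R := c \*: leg rho.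
have E : (fun s : R => s^-1 *: (h (s *: delta_mx 0 i + y) - h y)) =
         (fun s : R => s^-1 *: (g (s *: (1 : R) + y 0 i) - g (y 0 i))).
  have hE x : h (insr i x w) = g x by rewrite /h hl.
  apply/funext => s; congr (_ *: (_ - _)); last by rewrite {1}yE hE.
  rewrite -hE; congr h; rewrite {1}yE insr_line addrC -addrA -scalerDl -insr_line.
  by rewrite [s *: (1 : R)]mulr1 addrC.
have {}E : pd i h y = 'D_1 g (y 0 i) by rewrite /pd /derive E.
have hy : hgt r y = leg rho (y 0 i) by rewrite {1}yE hl.
rewrite E (@derive_val _ _ _ _ _ _ _ d1) hy.
by rewrite scalerN.
Qed.

Lemma hemisphere_Gdet n (r : R) lower (y : 'rV[R]_n.+1) : dotv y y < r ^+ 2 ->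
  Gdet (hemisphere r lower) y = r ^+ 2 / hgt r y ^+ 2.
Proof.
move=> yr; have h2 := hgt_dotv yr.
have h0 : hgt r y != 0 by rewrite gt_eqF// sqrtr_gt0 subr_gt0.
pose c : R := (-1) ^+ lower.
have fE : @fcomp R n.+1 1 (hemisphere r lower) ord0 = (fun y => c * hgt r y).
  by apply/funext => z; rewrite /fcomp mxE enorm_sq.
pose a := \row_i (- (c * (y 0 i / hgt r y))).
rewrite /Gdet (_ : metric _ _ = 1%:M + a^T *m a).
  rewrite det_1_rank1 -dotvE.
  rewrite (_ : dotv a a = dotv y y / hgt r y ^+ 2); last first.
    rewrite /dotv mulr_suml; apply: eq_bigr => i _; rewrite !mxE.
    rewrite mulrNN mulrACA -expr2 sqrr_sign mul1r.
    by move: (y 0 i) (hgt r y) h0 => u v v0; field.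
  by rewrite -h2; move: (hgt r y) h0 => v v0; field.
apply/matrixP => i j; rewrite !mxE !big_ord_recl !big_ord0 !addr0 fE !pd_hgt//.
by rewrite !mxE.
Qed.

Lemma sphere_divergence n (r : R) (X : 'I_n.+2 -> 'rV[R]_n.+2 -> R) :
  0 < r -> (forall i, C1 (X i)) ->
  sphere_integral r (fun x => \sum_i X i x * (x 0 i / r)) =
  \int[leb R n.+2]_t cutoff r (fun x => \sum_i pd i (X i) x) (rv t).
Proof.
move=> r_gt0 cX; have r0 := ltW r_gt0.
have cX0 i : continuous (X i) by exact: C1_continuous.
pose sg (lower : bool) : R := (-1) ^+ lower.
have sg1 lower : `|sg lower| = 1 by rewrite normrX normrN1 expr1n.
(* The i-th flux density of one hemisphere in its chart. For i = 0 the area density cancels the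
   normal component and leaves the sign of the hemisphere; for the other i it is [slope]. *)
pose F (i : 'I_n.+2) lower (t : n.+1.-tuple T) : R := if unlift ord0 i is Some j
  then X i (insr ord0 (sg lower * hgt r (rv t)) (rv t)) * slope j r (rv t)
  else cutoff r (fun y => sg lower * X i (insr ord0 (sg lower * hgt r y) y)) (rv t).
have iF i lower : (leb R n.+1).-integrable setT (EFin \o F i lower).
  rewrite /F; case: unliftP => [j|] _; first exact: slope_cap_integrable.
  apply: cutoff_continuous_integrable => //; apply: continuous_mul.
    exact: cst_continuous.
  have c1 : continuous (fun y => insr ord0 (sg lower * @hgt _ n.+1 r y) y).
    apply: continuous_insr => [|k]; last exact: continuous_coord.
    by apply: continuous_mul; [exact: cst_continuous|exact: continuous_hgt].
  by move=> y; exact: (continuous_comp (c1 y) (cX0 i _)).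
have step lower : \int[leb R n.+1]_(t in [set t | enorm (rv t) < r])
      ((\sum_i X i (@sphere_point R n.+2 r lower (rv t)) *
                (@sphere_point R n.+2 r lower (rv t) 0 i / r))
       * Num.sqrt (Gdet (hemisphere r lower) (rv t))) =
    \sum_i \int[leb R n.+1]_t F i lower t.
  rewrite -Rintegral_sum// Rintegral_mkcond; apply: eq_Rintegral => t _.
  rewrite patchE; case: ifPn; rewrite ?inE ?notin_setE /= => tr; last first.
    have tr' : r ^+ 2 <= dotv (rv t) (rv t) by rewrite leNgt -enorm_lt//; exact/negP.
    rewrite big1// => i _; rewrite /F /cutoff ltNge tr'/=.
    by case: (unlift _ _) => // j; rewrite slope_eq0// mulr0.
  have tr' : dotv (rv t) (rv t) < r ^+ 2 by rewrite -enorm_lt.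
  have h0 : 0 < hgt r (rv t) by rewrite sqrtr_gt0 subr_gt0.
  rewrite hemisphere_Gdet// sqrtrM ?sqr_ge0// sqrtrV ?sqr_ge0// !sqrtr_sqr.
  rewrite (gtr0_norm r_gt0) (gtr0_norm h0) mulr_suml; apply: eq_bigr => i _.
  rewrite sphere_pointE /F.
  case: (unliftP ord0 i) => [j|] ->.
    rewrite /= /slope /cutoff tr' [insr _ _ _ 0 _]mxE liftK.
    rewrite -/(sg lower); set u := X _ _.
    move: u (rv t 0 j) (hgt _ _) h0 => u w v v0; field.
    by rewrite !gt_eqF.
  rewrite /= /cutoff tr' [insr _ _ _ 0 _]mxE unlift_none -/(sg lower).
  set u := X _ _; move: u (sg lower) (hgt _ _) h0 => u c v v0; field.
  by rewrite !gt_eqF.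
rewrite /sphere_integral (eq_bigr _ (fun lower _ => step lower)) exchange_big /=.
transitivity (\sum_i \int[leb R n.+2]_t cutoff r (pd i (X i)) (rv t)).
  apply: eq_bigr => i _; rewrite big_bool /= -RintegralD//.
  rewrite /Rintegral; congr fine.
  case: (unliftP ord0 i) => [j|] iE; rewrite ball_pd// {}iE.
    rewrite -ball_side//; apply: eq_integral => t _.
    by rewrite /F liftK /sg expr0 expr1 mul1r mulN1r -mulrDl addrC.
  apply: eq_integral => t _; rewrite /F unlift_none /cutoff; case: ifP => _.
    by rewrite /sg expr0 expr1 !mul1r !mulN1r addrC.
  by rewrite addr0.
rewrite -Rintegral_sum//.
  apply: eq_Rintegral => t _; rewrite /cutoff; case: ifP => // _.
  by rewrite big1.
by move=> i; apply: cutoff_continuous_integrable => //; exact: C1_continuous_pd.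
Qed.

End SphereDivergence.

(** * Decay at infinity *)

Section Decay.
Context {R : realType} {n : nat}.
Implicit Types (h g : 'rV[R]_n -> R) (a b : R).

(** The estimate concerns only a neighbourhood of infinity; continuity bounds the function on the
    complementary ball. *)
Definition decay a h : Prop := continuous h /\
  exists C r, forall x : 'rV[R]_n, r <= enorm x -> `|h x| <= C * enorm x `^ (- a).

Lemma decay_continuous a h : decay a h -> continuous h. Proof. by case. Qed.

Lemma decayP a h : decay a h -> exists C r, [/\ 0 <= C, 1 <= r &
  forall x : 'rV[R]_n, r <= enorm x -> `|h x| <= C * enorm x `^ (- a)].
Proof.
case=> _ [C [r hC]]; exists `|C|, (Num.max 1 r); split => //.
  by rewrite le_max lexx.
move=> x; rewrite ge_max => /andP[_ /hC]; move/le_trans; apply.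
by rewrite ler_wpM2r ?powR_ge0// ler_norm.
Qed.

Lemma decay_cst c : decay 0 (fun=> c).
Proof.
split; first exact: cst_continuous.
by exists `|c|, 0 => x _; rewrite oppr0 powRr0 mulr1.
Qed.

Lemma decay_le a b h : a <= b -> decay b h -> decay a h.
Proof.
move=> ab dh; have [C [r [C0 r1 hC]]] := decayP dh; split; first by case: dh.
exists C, r => x rx; rewrite (le_trans (hC _ rx))// ler_wpM2l// ler_powR ?lerN2//.
exact: le_trans r1 rx.
Qed.

Lemma decayM a b h g : decay a h -> decay b g -> decay (a + b) (fun x => h x * g x).
Proof.
move=> dh dg; have [C [r [C0 r1 hC]]] := decayP dh.
have [D [s [D0 s1 hD]]] := decayP dg.
split; first by apply: continuous_mul; [case: dh|case: dg].
exists (C * D), (Num.max r s) => x; rewrite ge_max => /andP[rx sx].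
have x0 : enorm x != 0 by rewrite gt_eqF// (lt_le_trans ltr01)// (le_trans r1).
rewrite normrM opprD powRD ?x0 ?implybT// mulrACA.
by apply: ler_pM => //; [exact: hC|exact: hD].
Qed.

Lemma decayD a h g : decay a h -> decay a g -> decay a (fun x => h x + g x).
Proof.
move=> dh dg; have [C [r [C0 r1 hC]]] := decayP dh.
have [D [s [D0 s1 hD]]] := decayP dg.
split; first by apply: continuous_add; [case: dh|case: dg].
exists (C + D), (Num.max r s) => x; rewrite ge_max => /andP[rx sx].
by rewrite (le_trans (ler_normD _ _))// mulrDl lerD// ?hC ?hD.
Qed.

Lemma decay0 a : decay a (fun=> 0).
Proof.
split; first exact: cst_continuous.
by exists 0, 0 => x _; rewrite normr0 mul0r.
Qed.

Lemma decay_eq a b h : a = b -> decay a h -> decay b h. Proof. by move->. Qed.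

Lemma decay_sum a I (r : seq I) (P : pred I) (F : I -> 'rV[R]_n -> R) :
  (forall i, decay a (F i)) -> decay a (fun x => \sum_(i <- r | P i) F i x).
Proof.
move=> dF; elim: r => [|i r IH].
  by under eq_fun do rewrite big_nil; exact: decay0.
under eq_fun do rewrite big_cons; case: (P i) => //; exact: decayD.
Qed.

Lemma decay_prod I (r : seq I) (P : pred I) (e : I -> R) (F : I -> 'rV[R]_n -> R) :
  (forall i, decay (e i) (F i)) ->
  decay (\sum_(i <- r | P i) e i) (fun x => \prod_(i <- r | P i) F i x).
Proof.
move=> dF; elim: r => [|i r IH].
  rewrite big_nil (_ : (fun x => _) = fun=> 1); first exact: decay_cst.
  by apply/funext => x; rewrite big_nil.
rewrite big_cons (_ : (fun x => _) = fun x =>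
    if P i then F i x * \prod_(j <- r | P j) F j x else \prod_(j <- r | P j) F j x).
  by case: (P i) => //; exact: decayM.
by apply/funext => x; rewrite big_cons.
Qed.

Lemma decayZ a c h : decay a h -> decay a (fun x => c * h x).
Proof.
by move=> dh; apply: (decay_eq (add0r a)); exact: decayM (decay_cst c) dh.
Qed.

Lemma decayN a h : decay a h -> decay a (fun x => - h x).
Proof.
by move=> /(decayZ (-1)); under eq_fun do rewrite mulN1r.
Qed.

Lemma decayB a h g : decay a h -> decay a g -> decay a (fun x => h x - g x).
Proof. by move=> dh dg; apply: decayD => //; exact: decayN. Qed.

End Decay.

(** * Decay of the tensors of an asymptotically flat graph *)

Section GraphDecay.
Context {R : realType} {n m k0 : nat}.
Variable f : 'rV[R]_n -> 'rV[R]_m.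
Hypothesis f_smooth : smooth f.
Variable tau : R.
Hypothesis tau0 : 0 <= tau.
Hypothesis f_flat : asymptotically_flat f tau.
Local Opaque pd imetric.
Implicit Types (i j : 'I_n) (al be : 'I_m).

Let t2 := tau / 2.

Lemma pd_decay al i : decay t2 (pd i (fcomp f al)).
Proof.
split; first exact: C1_continuous (f1_C1 f_smooth al i).
have [C [r hC]] := f_flat; exists C, r => x /hC /(_ al i i i); apply: le_trans.
rewrite -addrA lerDl addr_ge0// mulr_ge0// ?exprn_ge0// ?sqrtr_ge0//.
Qed.

Lemma pd2_decay al i j : decay (t2 + 1) (pd i (pd j (fcomp f al))).
Proof.
split; first exact: C1_continuous (f2_C1 f_smooth al i j).
have [C [r hC]] := f_flat; exists C, (Num.max 1 r) => x.
rewrite ge_max => /andP[x1 /hC /(_ al i j i)] h.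
have x0 : 0 < enorm x by exact: lt_le_trans x1.
rewrite opprD powRD ?(gt_eqF x0) ?implybT// powR_inv1 ?(ltW x0)// mulrA ler_pdivlMr//.
apply: le_trans h; rewrite addrAC lerDr addr_ge0// mulr_ge0// exprn_ge0// ltW//.
Qed.

Lemma imetric_decay i j : decay 0 (fun x => imetric f x i j).
Proof.
split; first exact: C1_continuous (imetric_C1 f_smooth i j).
by exists 1, 0 => x _; rewrite oppr0 powRr0 mulr1 imetric_le1.
Qed.

Lemma Yv_decay al c : decay t2 (fun x => Yv f al x 0 c).
Proof.
rewrite (_ : (fun _ => _) = fun x => \sum_e pd e (fcomp f al) x * imetric f x e c).
  apply: decay_sum => e; apply: (decay_eq (addr0 _)).
  by apply: decayM; [exact: pd_decay|exact: imetric_decay].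
by apply/funext => x; rewrite mxE; apply: eq_bigr => e _; rewrite mxE.
Qed.

Lemma hess_decay al i j : decay (t2 + 1) (fun x => hess f al x i j).
Proof.
rewrite (_ : (fun _ => _) = pd i (pd j (fcomp f al))); first exact: pd2_decay.
by apply/funext => x; rewrite mxE.
Qed.

Lemma hm_decay al a c : decay (t2 + 1) (fun x => hm f al x a c).
Proof.
rewrite (_ : (fun _ => _) = fun x => \sum_e hess f al x a e * imetric f x e c).
  apply: decay_sum => e; apply: (decay_eq (addr0 _)).
  by apply: decayM; [exact: hess_decay|exact: imetric_decay].
by apply/funext => x; rewrite mxE.
Qed.

Lemma Um_decay al be : decay 0 (Um f al be).
Proof.
apply: decayB; first exact: decay_cst.
apply: decay_sum => c; apply: (@decay_le _ _ _ (t2 + t2)).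
  by rewrite addr_ge0// divr_ge0.
by apply: decayM; [exact: pd_decay|exact: Yv_decay].
Qed.

Lemma km_decay al a c : decay (t2 + 1) (fun x => km f al x a c).
Proof.
rewrite (_ : (fun _ => _) = fun x => \sum_be Um f al be x * hm f be x a c).
  apply: decay_sum => be; apply: (decay_eq (add0r _)).
  by apply: decayM; [exact: Um_decay|exact: hm_decay].
by apply/funext => x; rewrite summxE; apply: eq_bigr => be _; rewrite mxE.
Qed.

Lemma hleftover_decay be i a c : decay (tau + 2 + t2) (hleftover f be i a c).
Proof.
apply: decay_sum => mu; apply: decayM; last exact: Yv_decay.
rewrite (_ : (fun _ => _) = fun x => \sum_e hm f be x a e * hess f mu x e i).
  apply: decay_sum => e; apply: (@decay_eq _ _ (t2 + 1 + (t2 + 1))).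
    by rewrite /t2; lra.
  by apply: decayM; [exact: hm_decay|exact: hess_decay].
by apply/funext => x; rewrite mxE.
Qed.

Lemma kleftover_decay be i a c : decay (tau + 2 + t2) (kleftover f be i a c).
Proof.
apply: decay_sum => mu; apply: decayM; last exact: Yv_decay.
rewrite (_ : (fun _ => _) = fun x => \sum_e km f be x a e * hess f mu x e i).
  apply: decay_sum => e; apply: (@decay_eq _ _ (t2 + 1 + (t2 + 1))).
    by rewrite /t2; lra.
  by apply: decayM; [exact: km_decay|exact: hess_decay].
by apply/funext => x; rewrite mxE.
Qed.

Local Notation ix := {ffun 'I_(k0.+1).*2 -> 'I_n}.
Let e (s : 'I_k0.+1) : R := if s == ord_max then tau + 1 else tau + 2.

Lemma fslot_decay s (a b : ix) : decay (e s) (fun x => fslot f x s a b).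
Proof.
rewrite /fslot /e; case: (s == ord_max).
  apply: decay_sum => al; apply: (@decay_eq _ _ (t2 + 1 + t2)); first by rewrite /t2; lra.
  by apply: decayM; [exact: hm_decay|exact: Yv_decay].
apply: decay_sum => al; apply: (@decay_eq _ _ (t2 + 1 + (t2 + 1))); first by rewrite /t2; lra.
by apply: decayM; [exact: hm_decay|exact: km_decay].
Qed.

(** Compared with the slot it replaces, a leftover has one more Hessian and one more Y, of orders
    tau/2 + 1 and tau/2. *)
Lemma leftover_decay s (a b : ix) : decay (e s + (tau + 1)) (fun x => leftover f x s a b).
Proof.
rewrite /leftover /e; case: (s == ord_max).
  apply: decay_sum => al; apply: (@decay_eq _ _ (tau + 2 + t2 + t2)).
    by rewrite /t2; lra.
  by apply: decayM; [exact: hleftover_decay|exact: Yv_decay].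
apply: decayD; apply: decay_sum => be.
  apply: (@decay_eq _ _ (tau + 2 + t2 + (t2 + 1))); first by rewrite /t2; lra.
  by apply: decayM; [exact: hleftover_decay|exact: km_decay].
apply: (@decay_eq _ _ (t2 + 1 + (tau + 2 + t2))); first by rewrite /t2; lra.
by apply: decayM; [exact: hm_decay|exact: kleftover_decay].
Qed.

Lemma commutator_term_decay :
  decay ((k0.+2)%:R * tau + 2 * (k0.+1)%:R)
    (fun x => ((k0.+1.*2.-1)`!)%:R * commutator_term f k0.+1 x).
Proof.
have -> : (fun x => ((k0.+1.*2.-1)`!)%:R * commutator_term f k0.+1 x) =
    (fun x => - \sum_s ksum (fun a b : ix => leftover f x s a b * other_slots f x s a b)).
  by apply/funext => x; exact: commutator_termE.
apply: decayN; apply: decay_sum => s.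
apply: decay_sum => a; apply: decay_sum => b; apply: decayZ.
(* Every pair consists of two Hessians except the last, where Y has one derivative less: hence the
   -1, which the extra tau + 1 of the leftover makes good. *)
have ee : \sum_s e s = k0.+1%:R * (tau + 2) - 1.
  rewrite (bigD1 ord_max)//= {1}/e eqxx.
  rewrite (eq_bigr (fun=> tau + 2)); last by move=> l lm; rewrite /e (negPf lm).
  rewrite sumr_const (_ : #|_| = k0); last first.
    by rewrite cardC1 card_ord.
  by rewrite -mulr_natl -[k0.+1]addn1 natrD; ring.
apply: (@decay_eq _ _ (e s + (tau + 1) + \sum_(l | l != s) e l)).
  move: ee; rewrite (bigD1 s)//= => ee.
  rewrite addrAC ee -[k0.+2]addn2 -[k0.+1]addn1 !natrD; ring.
apply: decayM; first exact: leftover_decay.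
by apply: decay_prod => l; exact: fslot_decay.
Qed.

End GraphDecay.

(** * Integrability of decaying functions *)

Section DecayIntegrable.
Context {R : realType}.
Local Notation mu := (@lebesgue_measure R).

Lemma continuous_powR (s : R) (h : R -> R) : continuous h -> (forall x, 0 < h x) ->
  continuous (fun x => h x `^ s).
Proof.
move=> ch h0 x.
have c : {for h x, continuous (fun y : R => y `^ s)}.
  apply: differentiable_continuous; apply/derivable1_diffP.
  by apply: derivable_powR; rewrite in_itv /= h0.
exact: (continuous_comp (ch x) c).
Qed.

Lemma powR_tail_integral (s : R) : 1 < s ->
  (\int[mu]_x (((1 + `|x|) `^ (- s))%:E) < +oo)%E.
Proof.
move=> s1.
have p0 x : 0 < 1 + `|x| :> R by rewrite ltr_pwDl.
have cu : continuous (fun x : R => (1 + `|x|) `^ (- s)).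
  apply: continuous_powR => //; apply: continuous_add; first exact: cst_continuous.
  exact: norm_continuous.
have mu_ : measurable_fun setT (fun x : R => (1 + `|x|) `^ (- s)).
  exact: continuous_measurable_fun.
rewrite integral_half// [X in (_ + X)%E](_ : _ =
    \int[mu]_(x in `]0%R, +oo[) ((1 + `|x|) `^ (- s))%:E)%E; last first.
  by apply: eq_integral => x _; rewrite normrN.
suff h : (\int[mu]_(x in `]0%R, +oo[) ((1 + `|x|) `^ (- s))%:E < +oo)%E by exact: lte_add_pinfty.
rewrite integral_itv_obnd_cbnd; last first.
  by apply: measurable_funTS; exact/measurable_EFinP.
pose F (x : R) : R := (1 - s)^-1 * (1 + x) `^ (1 - s).
have s0 : 1 - s != 0 by rewrite subr_eq0 lt_eqF.
have dF (x : R) : 0 <= x -> is_derive x 1 F ((1 + `|x|) `^ (- s)).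
  move=> x0; have x1 : 0 < 1 + x by rewrite ltr_pwDl.
  have i1 : is_derive x (1 : R) (fun x : R => 1 + x) 1.
    exact: (is_derive_eq (is_deriveD (is_derive_cst (1 : R) x 1) (is_derive_id x 1)) (add0r 1)).
  have i2 := is_derive1_powR (1 - s) x1.
  have i3 := @is_derive1_comp R (fun y : R => y `^ (1 - s)) (fun x : R => 1 + x) x _ _ i2 i1.
  have i4 := @is_deriveZ R _ _ _ (1 - s)^-1 _ _ _ i3.
  apply: (is_derive_eq i4); rewrite ger0_norm// addrAC subrr add0r mulr1.
  by rewrite -[_ *: _]/(_ * _) mulrA mulVf// mul1r.
rewrite (@ge0_continuous_FTC2y _ _ F 0 0) ?ltry// -?EFinB ?ltry//.
- exact: continuous_subspaceT.
- apply/cvgrPdist_le => e e0; near=> x.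
  have x0 : 0 <= x by near: x; exact: nbhs_pinfty_ge.
  (* The value of 1 + x at which |F x| = e. *)
  have xM : (`|(1 - s)^-1| / e) `^ (s - 1)^-1 <= x by near: x; exact: nbhs_pinfty_ge.
  have a0 : 0 < s - 1 by rewrite subr_gt0.
  rewrite sub0r normrN normrM (ger0_norm (powR_ge0 _ _)) -opprB powRN.
  rewrite ler_pdivrMr ?powR_gt0 ?ltr_pwDl// -ler_pdivrMl// mulrC.
  have := ge0_ler_powR (ltW a0) (powR_ge0 _ _) _ (le_trans xM (ler_wpDl ler01 (lexx x))).
  rewrite -powRrM mulVf ?gt_eqF// powRr1 ?divr_ge0//; last exact: ltW.
  by rewrite opprB; apply; rewrite nnegrE addr_ge0.
- by move=> y y0; have h := dF y (ltW y0); exact: ex_derive.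
- have d := dF 0 (lexx _).
  apply: cvg_at_right_filter; apply: differentiable_continuous.
  by apply/derivable1_diffP; exact: ex_derive.
- move=> x; rewrite in_itv /= andbT => x0; rewrite derive1E.
  by have h := dF x (ltW x0); exact: derive_val.
Unshelve. all: by end_near. Qed.

(** In dimension N the product of the 1 + |x_i| is at most (1 + |x|)^N, so (1 + |x|)^-a is dominated
    by a product of one-dimensional tails with exponent a / N > 1. This replaces polar
    coordinates. *)
Lemma decay_integrable n a (h : 'rV[R]_n.+1 -> R) : n.+1%:R < a -> decay a h ->
  (leb R n.+1).-integrable setT (fun t => (h (rv t))%:E).
Proof.
move=> na dh; have ch : continuous h by exact: decay_continuous dh.
have n0 : 0 < n.+1%:R :> R by rewrite ltr0n.
have a0 : 0 < a by exact: lt_trans na.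
have [C [r [C0 r1 hC]]] := decayP dh.
have [D hD] := bounded_on_ball r ch.
have r0 : 0 < r by exact: lt_le_trans r1.
pose s := a / n.+1%:R.
have s0 : 0 <= s by rewrite divr_ge0// ltW.
pose u (x : R) : R := (1 + `|x|) `^ (- s).
have p1 (x : R) : 0 < 1 + `|x| by rewrite ltr_pwDl.
have mu_ : measurable_fun setT u.
  apply: continuous_measurable_fun; apply: continuous_powR => //.
  by apply: continuous_add; [exact: cst_continuous|exact: norm_continuous].
have u0 x : 0 <= u x by exact: powR_ge0.
have uoo : (\int[mu]_x (u x)%:E < +oo)%E.
  by apply: powR_tail_integral; rewrite ltr_pdivlMr// mul1r.
have ip := @prod_integrable _ n.+1 u mu_ u0 uoo.
(* The first term serves |x| >= r, where |x| >= 1 gives 1 + |x| <= 2 |x|; the second serves the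
   ball, where |h| <= D and 1 + |x| <= 1 + r. *)
pose K := C * 2 `^ a + `|D| * (1 + r) `^ a.
have iK : (leb R n.+1).-integrable setT
    (fun t => (K%:E * (\prod_i u (tnth t i))%:E)%E) by exact: integrableZl.
apply: (le_integrable _ _ _ iK) => //.
  by apply/measurable_EFinP; exact: continuous_rv_measurable.
move=> t _; rewrite -EFinM lee_fin; apply: le_trans (ler_norm _).
set x := rv t.
pose M := \prod_(i < n.+1) (1 + `|x 0 i|) `^ s.
have M0 : 0 < M by apply: prodr_gt0 => i _; exact: powR_gt0.
have -> : \prod_i u (tnth t i) = M^-1.
  rewrite /M -prodfV; apply: eq_bigr => i _.
  by rewrite /u powRN mxE.
rewrite ler_pdivlMr//.
have e0 : 0 <= enorm x by exact: sqrtr_ge0.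
have MP : M <= (1 + enorm x) `^ a.
  have -> : (1 + enorm x) `^ a = \prod_(i < n.+1) (1 + enorm x) `^ s.
    rewrite prodr_const card_ord -powR_mulrn ?powR_ge0// -powRrM.
    by rewrite /s mulfVK// gt_eqF.
  apply: ler_prod => i _; rewrite powR_ge0/=.
  apply: ge0_ler_powR; rewrite ?nnegrE ?addr_ge0 ?(ltW (p1 _))// lerD2l.
  rewrite -sqrtr_sqr ler_wsqrtr//; exact: coord_le_dotv.
have k1 : 0 <= C * 2 `^ a by rewrite mulr_ge0// powR_ge0.
have k2 : 0 <= `|D| * (1 + r) `^ a by rewrite mulr_ge0// powR_ge0.
have [xr|xr] := leP r (enorm x).
  apply: (@le_trans _ _ (C * 2 `^ a)); last by rewrite lerDl.
  have x0 : 0 < enorm x by exact: lt_le_trans xr.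
  have x1 : 1 <= enorm x by exact: le_trans xr.
  apply: (@le_trans _ _ (C * enorm x `^ (- a) * (2 * enorm x) `^ a)).
    apply: ler_pM => //; [exact: ltW|exact: hC|].
    apply: (le_trans MP); apply: ge0_ler_powR; rewrite ?nnegrE ?addr_ge0 ?mulr_ge0 ?(ltW a0)//.
    by rewrite mulr2n mulrDl mul1r lerD2r.
  by rewrite powRM// mulrACA -powRD ?(gt_eqF x0) ?implybT// addNr powRr0 mulr1.
apply: (@le_trans _ _ (`|D| * (1 + r) `^ a)); last by rewrite lerDr.
apply: ler_pM => //; first exact: ltW.
  by rewrite (le_trans (hD _ _)) ?ler_norm// -enorm_sq lerXn2r ?nnegrE// ltW.
apply: (le_trans MP); apply: ge0_ler_powR; rewrite ?nnegrE ?addr_ge0 ?(ltW a0) ?(ltW r0)//.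
by rewrite lerD2l ltW.
Qed.

End DecayIntegrable.

(** * The mass formula *)

Section Mass.
Context {R : realType}.
Local Notation T := (measurableTypeR R).

Lemma cutoff_cvg n (h : 'rV[R]_n -> R) :
  (leb R n).-integrable setT (fun t => (h (rv t))%:E) ->
  (\int[leb R n]_t cutoff r h (rv t)) @[r --> +oo] --> \int[leb R n]_t h (rv t).
Proof.
(* Dominated convergence concerns sequences, so the limit is tested along radii [u k] tending to
   infinity; |h| itself dominates. *)
move=> ih; apply/cvg_pinftyP => u uoo.
have mh : measurable_fun setT (fun t : n.-tuple T => h (rv t)).
  by apply/measurable_EFinP; exact: measurable_int ih.
apply: fine_cvg.
rewrite fineK; last exact: (integrable_fin_num measurableT ih).
apply: (@dominated_cvg _ _ _ (leb R n) setT measurableT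
  (fun k t => (cutoff (u k) h (rv t))%:E) (fun t => (h (rv t))%:E)
  (fun t => `|(h (rv t))%:E|%E)) => //.
- by move=> k; apply/measurable_EFinP; exact: measurable_cutoff.
- move=> t _; apply: cvg_near_cst.
  have : \forall k \near \oo, enorm (rv t) + 1 <= u k.
    by move/cvgryPge : uoo; exact.
  apply: filterS => k hk; rewrite /cutoff ifT// -enorm_lt.
    by rewrite (lt_le_trans _ hk)// ltrDl.
  by apply: le_trans hk; rewrite addr_ge0// sqrtr_ge0.
- exact: integrable_abse.
- by move=> k t _; rewrite lee_fin /cutoff; case: ifP => //; rewrite normr0.
Qed.

Lemma sphere_volume_ge0 n : 0 <= sphere_volume n :> R.
Proof.
apply: sumr_ge0 => lower _; apply: Rintegral_ge0 => t _.
by rewrite mul1r sqrtr_ge0.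
Qed.

Lemma gbc_const_ge0 n q : 0 <= gbc_const n q :> R.
Proof.
by rewrite divr_ge0// !mulr_ge0 ?exprn_ge0// sphere_volume_ge0.
Qed.

(** * The flux through large spheres *)

Section Flux.
Context {n m k0 : nat}.
Variable f : 'rV[R]_n.+2 -> 'rV[R]_m.
Hypothesis f_smooth : smooth f.
Local Notation q := k0.+1.
Local Opaque pd imetric.

Let div (x : 'rV[R]_n.+2) : R := \sum_i pd i (gb_field (k0 := k0) f i) x.
Let comm (x : 'rV[R]_n.+2) : R := ((q.*2.-1)`!)%:R * commutator_term f q x.

Lemma gbc_flux_ball r : 0 < r ->
  gbc_flux f q r = \int[leb R n.+2]_t cutoff r div (rv t).
Proof.
move=> r0; rewrite -(@sphere_divergence R n r (fun i => gb_field (k0 := k0) f i))//.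
  rewrite /gbc_flux; congr sphere_integral; apply/funext => x.
  apply: eq_bigr => i _; rewrite /gb_field mulr_suml; apply: eq_bigr => j _.
  rewrite mulr_suml; apply: eq_bigr => k _.
  by rewrite mulr_suml.
by move=> i; exact: gb_field_C1.
Qed.

Lemma gbc_flux_cvg : (leb R n.+2).-integrable setT (fun t => (div (rv t))%:E) ->
  gbc_flux f q r @[r --> +oo] --> \int[leb R n.+2]_t div (rv t).
Proof.
move=> /cutoff_cvg; apply: cvg_trans; apply: near_eq_cvg; near=> r.
by rewrite gbc_flux_ball//; near: r; exact: nbhs_pinfty_gt.
Unshelve. all: by end_near. Qed.

Variable tau : R.
Hypothesis tau_gt : (n.+2%:R - 2 * q%:R) / (q%:R + 1) < tau.
Hypothesis q_lt : (q.*2 < n.+2)%N.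
Hypothesis f_flat : asymptotically_flat f tau.
Hypothesis L_int : graph_integrable f (gauss_bonnet f q).

Lemma comm_decay : decay (q.+1%:R * tau + 2 * q%:R) comm.
Proof.
apply: (commutator_term_decay f_smooth) => //.
apply: le_trans (ltW tau_gt); apply: divr_ge0; last by rewrite addr_ge0.
by rewrite subr_ge0 -natrM ler_nat mul2n ltnW.
Qed.

(** With N the dimension of the base, (q+1) tau + 2q > N is exactly the hypothesis tau > (N - 2q) /
    (q+1). *)
Lemma comm_integrable : (leb R n.+2).-integrable setT (fun t => (comm (rv t))%:E).
Proof.
apply: (decay_integrable _ comm_decay).
move: tau_gt; rewrite ltr_pdivrMr; last by rewrite ltr_wpDl.
by rewrite -[q.+1]addn1 natrD mulrC; lra.
Qed.

Lemma div_continuous : continuous div.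
Proof.
apply: continuous_bigsum => i; apply: C1_continuous_pd; exact: gb_field_C1.
Qed.

Lemma gauss_bonnet_div x : gauss_bonnet f q x = 2 * div x - comm x.
Proof.
rewrite /div divergence_identity// -/(comm x).
by move: (gauss_bonnet _ _ _) (comm x) => u v; field.
Qed.

(** The hypothesis is integrability for dM = sqrt G dx, and sqrt G >= 1. The measure dx is the
    relevant one, being dM / sqrt G. *)
Lemma gauss_bonnet_integrable :
  (leb R n.+2).-integrable setT (fun t => (gauss_bonnet f q (rv t))%:E).
Proof.
apply: (le_integrable _ _ _ L_int) => //.
  apply/measurable_EFinP; apply: continuous_rv_measurable.
  (* Measurability of L_(q) follows from the divergence identity, which expresses it through
     continuous functions. *)
  have -> : gauss_bonnet f q = fun x => 2 * div x - comm x.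
    by apply/funext => x; exact: gauss_bonnet_div.
  apply: continuous_add.
    by apply: continuous_mul; [exact: cst_continuous|exact: div_continuous].
  by apply: continuous_neg; exact: decay_continuous comm_decay.
move=> t _; rewrite lee_fin [X in _ <= X]normrM ler_peMr//.
rewrite (ger0_norm (sqrtr_ge0 _)) -[leLHS]sqrtr1 ler_wsqrtr//.
exact: Gdet_ge1.
Qed.

Lemma mass_integrand_integrable : (leb R n.+2).-integrable setT
  (fun t => (gauss_bonnet f q (rv t) + comm (rv t))%:E).
Proof. exact: integrableD gauss_bonnet_integrable comm_integrable. Qed.

Lemma gbc_flux_limit : gbc_flux f q r @[r --> +oo] -->
  2^-1 * \int[leb R n.+2]_t (gauss_bonnet f q (rv t) + comm (rv t)).
Proof.
have dE : (fun t => div (rv t)) =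
    (fun t => 2^-1 * (gauss_bonnet f q (rv t) + comm (rv t))).
  by apply/funext => t; rewrite /div divergence_identity.
rewrite -RintegralZl//; last exact: mass_integrand_integrable.
rewrite -dE; apply: gbc_flux_cvg.
rewrite (_ : (fun t => _) =
    (fun t => ((2^-1)%:E * (gauss_bonnet f q (rv t) + comm (rv t))%:E)%E)).
  exact: integrableZl mass_integrand_integrable.
by apply/funext => t; rewrite -EFinM -(congr1 (fun g => g t) dE).
Qed.

End Flux.
End Mass.

Theorem theorem1 (R : realType) (n q m : nat) (tau : R)
    (f : 'rV[R]_n -> 'rV[R]_m)
    (n_ge3 : (3 <= n)%N) (q_ge1 : (1 <= q)%N) (q_lt : (q.*2 < n)%N)
    (m_ge1 : (1 <= m)%N)
    (f_smooth : smooth f)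
    (tau_gt : (n%:R - 2 * q%:R) / (q%:R + 1) < tau)
    (f_flat : asymptotically_flat f tau)
    (L_int : graph_integrable f (gauss_bonnet f q)) :
  [/\ cvg (gbc_flux f q r @[r --> +oo]),
      (gbc_mass f q)%:E =
        ((1 / 2 * gbc_const n q)%:E *
         graph_integral f (fun x => (
           (gauss_bonnet f q x + ((q.*2.-1)`!)%:R * commutator_term f q x)
           * (1 / Num.sqrt (Gdet f x)))%R))%E
    & flat_normal_bundle f -> (forall x, 0 <= gauss_bonnet f q x) ->
      0 <= gbc_mass f q].
Proof.
(* Dimension [n.+2]: the hemisphere charts then live on R^(n+1), which has at least one
   coordinate. *)
case: n f n_ge3 q_lt f_smooth tau_gt f_flat L_int => [|[|n]]// f _.
case: q q_ge1 => [//|k0] _ q_lt f_smooth tau_gt f_flat L_int.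
have lim_flux := gbc_flux_limit f_smooth tau_gt q_lt f_flat L_int.
have mass_int := mass_integrand_integrable f_smooth tau_gt q_lt f_flat L_int.
have massE := cvg_lim (@norm_hausdorff _ _) lim_flux.
split; first by apply: cvgP lim_flux.
- rewrite /gbc_mass massE.
  have -> : graph_integral f (fun x => (gauss_bonnet f k0.+1 x +
      ((k0.+1.*2.-1)`!)%:R * commutator_term f k0.+1 x) * (1 / Num.sqrt (Gdet f x))) =
    (\int[leb R n.+2]_t (gauss_bonnet f k0.+1 (rv t) +
      ((k0.+1.*2.-1)`!)%:R * commutator_term f k0.+1 (rv t)))%:E.
    (* The factor 1 / sqrt G cancels the volume density, leaving a Lebesgue integral that is finite
       by [mass_int]. *)
    rewrite /Rintegral fineK; last exact: (integrable_fin_num measurableT mass_int).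
    apply: eq_integral => t _; rewrite div1r mulfVK//.
    by rewrite gt_eqF// sqrtr_gt0 (lt_le_trans ltr01)// Gdet_ge1.
  rewrite -EFinM; congr (_%:E).
  by move: (gbc_const _ _) (Rintegral _ _ _) => c I; field.
- move=> flat L_ge0; rewrite /gbc_mass massE mulr_ge0 ?gbc_const_ge0// mulr_ge0 ?invr_ge0//.
  apply: Rintegral_ge0 => t _.
  by rewrite flat_commutator_term// addr0.
Qed.
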